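(* The operator $L_0+L'$ (with domain $\mathcal{D}(L_0)$) generates a strongly continuous one-parameter semigroup $S:[0,\infty)\to\mathcal{B}(\mathcal{H})$ satisfying $$\|S(\tau)\|\le e^{(-\frac12+\|L'\|)\tau}$$ for all $\tau\ge0$. In particular, for $T>0$ and $\mathbf{u}_T\in\mathcal{D}(L_0)$, the Cauchy problem $$\frac{d}{d\tau}\Phi(\tau)=(L_0+L')\Phi(\tau)\ \text{ for }\tau>-\log T,\qquad \Phi(-\log T)=\mathbf{u}_T,$$ has a unique solution $\Phi:[-\log T,\infty)\to\mathcal{H}$, which is given by $\Phi(\tau)=S(\tau+\log T)\mathbf{u}_T$ for all $\tau\ge-\log T$.
   Context: All functions are complex-valued. Let $\tilde H_1=\{u\in C^2[0,1]:u(0)=u'(0)=0\}$ and $\tilde H_2=\{u\in C^1[0,1]:u(0)=0\}$ with inner products $(u|v)_1=\int_0^1 u'(\rho)\overline{v'(\rho)}\,\rho^{-2}d\rho$, $(u|v)_2=\int_0^1 u'(\rho)\overline{v'(\rho)}\,d\rho$ and induced norms $\|\cdot\|_j$. Let $H_j$ be the completion of $\tilde H_j$, $\tilde{\mathcal{H}}=\tilde H_1\times\tilde H_2$, and let $\mathcal{H}=H_1\times H_2$ be the Hilbert space with inner product $(\mathbf{u}|\mathbf{v})=(u_1|v_1)_1+(u_2|v_2)_2$ and norm $\|\cdot\|$. $\mathcal{B}(\mathcal{H})$ denotes the bounded linear operators on $\mathcal{H}$. Define $\tilde L_0:\mathcal{D}(\tilde L_0)\subset\mathcal{H}\to\mathcal{H}$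 by $\mathcal{D}(\tilde L_0)=\{u\in C^3[0,1]:u(0)=u'(0)=u''(0)=0\}\times\{u\in C^3[0,1]:u(0)=0\}$ and $$\tilde L_0\mathbf{u}(\rho)=\begin{pmatrix}-\rho u_1'(\rho)+u_1(\rho)+\rho u_2'(\rho)-u_2(\rho)\\ \frac1\rho u_1'(\rho)-\rho u_2'(\rho)\end{pmatrix}.$$ $\tilde L_0$ is closable; $L_0$ denotes its closure. Let $L':\mathcal{H}\to\mathcal{H}$ be the bounded operator extending $$L'\mathbf{u}(\rho)=\begin{pmatrix}-V_1(\rho)\int_0^\rho\rho'u_2(\rho')d\rho'\\0\end{pmatrix},\qquad V_1(\rho)=-\frac{16}{(1+\rho^2)^2},$$ from $\tilde{\mathcal{H}}$; $\|L'\|$ is its operator norm. Solutions of the Cauchy problem are understood in the usual (classical) sense of semigroup theory. *)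

(* Defs.v *)
From Stdlib Require Import Reals.
From Coquelicot Require Import Coquelicot.
Open Scope R_scope.

Definition I01 (x : R) : Prop := 0 <= x <= 1.

(* A function on [0,1] is represented by a total function [R -> C] of which
   only the values on [0,1] matter; the derivative is taken within [0,1], hence
   is one-sided at the end points. *)
Definition is_deriv01 (u : R -> C) (x : R) (l : C) : Prop :=
  filterlim (fun y => ((u y - u x) / RtoC (y - x))%C)
    (within I01 (locally' x)) (locally l).

Definition D01 (u : R -> C) (x : R) : C :=
  @iota C_CompleteNormedModule (is_deriv01 u x).

Fixpoint Ck01 (k : nat) (u : R -> C) : Prop :=
  match k with
  | O => continuous_on I01 u
  | S k => (forall x, I01 x -> exists l, is_deriv01 u x l) /\ Ck01 k (D01 u)
  end.

Definition CInt (f : R -> C) (a b : R) : C := @RInt C_R_CompleteNormedModule f a b.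

Definition Ht1 (u : R -> C) : Prop :=
  Ck01 2 u /\ u 0 = RtoC 0 /\ D01 u 0 = RtoC 0.

Definition Ht2 (u : R -> C) : Prop := Ck01 1 u /\ u 0 = RtoC 0.

(* The integrand is bounded and continuous on (0,1] for u, v in [Ht1]; the
   value of the Riemann integral does not depend on its value at 0. *)
Definition ip1 (u v : R -> C) : C :=
  CInt (fun r => (D01 u r * Cconj (D01 v r) / RtoC (r ^ 2))%C) 0 1.

Definition ip2 (u v : R -> C) : C :=
  CInt (fun r => (D01 u r * Cconj (D01 v r))%C) 0 1.

Record HilbertSpace := {
  hilbert_carrier :> CompleteNormedModule C_AbsRing;
  inner : hilbert_carrier -> hilbert_carrier -> C;
  inner_plus_l : forall x y z, inner (plus x y) z = (inner x z + inner y z)%C;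
  inner_scal_l : forall (a : C) x y, inner (scal a x) y = (a * inner x y)%C;
  inner_conj : forall x y, inner y x = Cconj (inner x y);
  inner_norm : forall x, inner x x = RtoC (norm x ^ 2)
}.

(* A completion of the pre-Hilbert space ({u | P u}, ip): a Hilbert space with a
   linear, inner-product preserving map with dense range. It is unique up to
   isometric isomorphism. [embed] is meaningful on P only; [embed_inner] forces
   it to identify functions that agree on [0,1]. *)
Record Completion (P : (R -> C) -> Prop) (ip : (R -> C) -> (R -> C) -> C) := {
  completion_space :> HilbertSpace;
  embed : (R -> C) -> completion_space;
  embed_plus : forall u v, P u -> P v ->
    embed (fun r => (u r + v r)%C) = plus (embed u) (embed v);
  embed_scal : forall (a : C) u, P u ->
    embed (fun r => (a * u r)%C) = scal a (embed u);
  embed_inner : forall u v, P u -> P v ->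
    inner completion_space (embed u) (embed v) = ip u v;
  embed_dense : forall (x : completion_space) (eps : R), 0 < eps ->
    exists u, P u /\ norm (minus x (embed u)) < eps
}.
Arguments embed {P ip} c u.

Definition V1 (r : R) : R := - (16 / (1 + r ^ 2) ^ 2).

Definition domLt_1 (u : R -> C) : Prop :=
  Ck01 3 u /\ u 0 = RtoC 0 /\ D01 u 0 = RtoC 0 /\ D01 (D01 u) 0 = RtoC 0.

Definition domLt_2 (u : R -> C) : Prop := Ck01 3 u /\ u 0 = RtoC 0.

(* At r = 0 the term (1/r) u1'(r) evaluates to 0, its limit for u1 in [domLt_1]. *)
Definition Lt_1 (u1 u2 : R -> C) (r : R) : C :=
  (- (RtoC r * D01 u1 r) + u1 r + RtoC r * D01 u2 r - u2 r)%C.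

Definition Lt_2 (u1 u2 : R -> C) (r : R) : C :=
  (RtoC (/ r) * D01 u1 r - RtoC r * D01 u2 r)%C.

Definition Lprime_1 (u2 : R -> C) (r : R) : C :=
  (- RtoC (V1 r) * CInt (fun s => (RtoC s * u2 s)%C) 0 r)%C.

Section Energy.

Variables (H1 : Completion Ht1 ip1) (H2 : Completion Ht2 ip2).

(* The norm of Coquelicot's product is sqrt (|x1|^2 + |x2|^2), i.e. the one
   induced by the inner product (x1|y1)_1 + (x2|y2)_2. *)
Definition Hsp : NormedModule C_AbsRing := prod_NormedModule C_AbsRing H1 H2.

Definition Lt_graph (x y : Hsp) : Prop :=
  exists u1 u2, domLt_1 u1 /\ domLt_2 u2 /\
    x = (embed H1 u1, embed H2 u2) /\
    y = (embed H1 (Lt_1 u1 u2), embed H2 (Lt_2 u1 u2)).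

(* Coquelicot's [is_linear] includes boundedness. *)
Definition is_Lprime (L' : Hsp -> Hsp) : Prop :=
  is_linear L' /\
  forall u1 u2, Ht1 u1 -> Ht2 u2 ->
    L' (embed H1 u1, embed H2 u2) = (embed H1 (Lprime_1 u2), zero).

End Energy.

Section Semigroups.

Context {X : NormedModule C_AbsRing}.

(* Unbounded operators are given by their graphs [A : X -> X -> Prop]. *)
Definition graph_closure (A : X -> X -> Prop) (x y : X) : Prop :=
  forall eps : R, 0 < eps ->
    exists x' y', A x' y' /\ norm (minus x x') < eps /\ norm (minus y y') < eps.

Definition dom (A : X -> X -> Prop) (x : X) : Prop := exists y, A x y.

Definition graph_plus (A : X -> X -> Prop) (B : X -> X) (x z : X) : Prop :=
  exists y, A x y /\ z = plus y (B x).

Definition op_norm (A : X -> X) : R :=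
  real (Lub_Rbar (fun r => exists x, norm x <= 1 /\ r = norm (A x))).

(* Only the restriction of S to [0,oo) matters. *)
Definition C0_semigroup (S : R -> X -> X) : Prop :=
  (forall t, 0 <= t -> is_linear (S t)) /\
  (forall x, S 0 x = x) /\
  (forall s t x, 0 <= s -> 0 <= t -> S (s + t) x = S s (S t x)) /\
  (forall x, continuous_on (fun t => 0 <= t) (fun t => S t x)).

Definition generator (S : R -> X -> X) (x y : X) : Prop :=
  filterlim (fun h : R => scal (RtoC (/ h)) (minus (S h x) x))
    (at_right 0) (locally y).

Definition generates (A : X -> X -> Prop) (S : R -> X -> X) : Prop :=
  forall x y, A x y <-> generator S x y.

Definition is_deriv_X (Phi : R -> X) (t : R) (l : X) : Prop :=
  filterlim (fun h : R => scal (RtoC (/ h)) (minus (Phi (t + h)) (Phi t)))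
    (locally' 0) (locally l).

(* Classical solution on [t0,oo): continuous on [t0,oo), continuously
   differentiable on (t0,oo), with values in the domain of A for t > t0. *)
Definition classical_solution (A : X -> X -> Prop) (t0 : R) (x0 : X)
    (Phi : R -> X) : Prop :=
  continuous_on (fun t => t0 <= t) Phi /\
  (exists dPhi : R -> X,
     (forall t, t0 < t -> is_deriv_X Phi t (dPhi t) /\ A (Phi t) (dPhi t)) /\
     continuous_on (fun t => t0 < t) dPhi) /\
  Phi t0 = x0.

End Semigroups.

(* Main.v *)
Require Import Defs.
From Stdlib Require Import Reals ZArith Lra Lia List ssreflect ClassicalEpsilon.
From Coquelicot Require Import Coquelicot.
Open Scope R_scope.

(* In the variables v = u1'/rho, w = u2' the space H becomes L^2 x L^2 and the
   free operator becomes the system v_t = -v - rho v' + w', w_t = -w - rho w' + v'.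
   Hence 2 Re (L u|u) + |u|^2 is the integral over [0,1] of the derivative of
   2 Re (v conj w) - rho |v|^2 - rho |w|^2, which is -|v(1) - w(1)|^2 <= 0.
   On odd monomials L is triangular:
     L (0, rho^m) = ((m-1) rho^m, -m rho^m),
     L (rho^m, 0) = (-(m-1) rho^m, m rho^(m-2)),
   so by induction the range of l - L contains all odd monomials for l > -1/2,
   and these span a dense subspace. Thus the closure of L is m-dissipative with
   bound -1/2, and a fixed point argument adds the bounded operator L' at the
   cost |L'|.  The semigroup of an m-dissipative A is the limit of the implicit
   Euler schemes J_h^n, J_h = (1 - hA)^-1 with dyadic steps h; they converge
   because J_h - J_(h/2)^2 = (h/2)^2 J_h J_(h/2)^2 A^2. *)

(** * Linear identities in complex vector spaces *)

(** Parity is what lets the triangular scheme close. On even powers it would have to start from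
    (rho^2, 0), which the condition u1''(0) = 0 excludes from the domain; on odd powers it starts
    from (0, rho), an eigenvector for -1. Restricting to odd powers costs no density: v and w then
    run through rho p(rho^2) and p(rho^2), and on [0,1] the square is as good a variable as rho
    itself. The same condition u1''(0) = 0 gives v(0) = 0, which removes the boundary term at the
    centre, where w is free. The completions are known only through their axioms, so every
    computation in H is brought back to embedded functions, whose distances are L^2 distances of v
    and w. The local error of the Euler scheme contains A^2. Convergence is therefore obtained on
    the domain of A^2, which the resolvent shows to be dense and a core; since all the schemes are
    contractions, uniformly in the step, the limits extend to the whole space. Dissipativity is
    stated by norms alone, so this part needs no inner product and dissipativity passes to closures
    by taking limits. *)

Inductive vexpr :=
  | VVar (n : nat) | VZero | VPlus (a b : vexpr) | VOpp (a : vexpr)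
  | VMinus (a b : vexpr) | VScal (c : C) (a : vexpr).

Fixpoint vcoef (e : vexpr) (i : nat) : C :=
  match e with
  | VVar n => if Nat.eqb n i then RtoC 1 else RtoC 0
  | VZero => RtoC 0
  | VPlus a b => (vcoef a i + vcoef b i)%C
  | VOpp a => (- vcoef a i)%C
  | VMinus a b => (vcoef a i - vcoef b i)%C
  | VScal c a => (c * vcoef a i)%C
  end.

Section Reflect.
Context {X : ModuleSpace C_Ring}.

Fixpoint veval (l : list X) (e : vexpr) : X :=
  match e with
  | VVar n => nth n l zero
  | VZero => zero
  | VPlus a b => plus (veval l a) (veval l b)
  | VOpp a => opp (veval l a)
  | VMinus a b => minus (veval l a) (veval l b)
  | VScal c a => scal c (veval l a)
  end.

Fixpoint vcomb (f : nat -> C) (l : list X) : X :=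
  match l with
  | nil => zero
  | x :: l => plus (scal (f O) x) (vcomb (fun i => f (S i)) l)
  end.

(** Agreement is asked only at the positions of [l], so that it unfolds by computation to finitely
    many equations in C. *)
Fixpoint vagree (f g : nat -> C) (l : list X) : Prop :=
  match l with
  | nil => True
  | x :: l => f O = g O /\ vagree (fun i => f (S i)) (fun i => g (S i)) l
  end.

Lemma vcomb_agree f g l : vagree f g l -> vcomb f l = vcomb g l.
Proof.
  elim: l f g => [|x l IH] f g //= [-> H].
  by rewrite (IH _ _ H).
Qed.

Lemma vcomb_zero l : vcomb (fun _ => RtoC 0) l = zero.
Proof. elim: l => [|x l IH] //=. by rewrite IH plus_zero_r (scal_zero_l x). Qed.

Lemma vcomb_plus f g l :
  vcomb (fun i => (f i + g i)%C) l = plus (vcomb f l) (vcomb g l).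
Proof.
  elim: l f g => [|x l IH] f g /=; first by rewrite plus_zero_l.
  rewrite IH (scal_distr_r (f O) (g O) x) -!plus_assoc; f_equal.
  by rewrite plus_comm -plus_assoc [plus (vcomb (fun i => g (S i)) l) _]plus_comm.
Qed.

Lemma vcomb_scal c f l : vcomb (fun i => (c * f i)%C) l = scal c (vcomb f l).
Proof.
  elim: l f => [|x l IH] f /=; first by rewrite scal_zero_r.
  by rewrite IH scal_distr_l (scal_assoc c (f O) x).
Qed.

Lemma vcomb_var n l : vcomb (vcoef (VVar n)) l = nth n l zero.
Proof.
  elim: l n => [|x l IH] [|n] //=.
  - rewrite vcomb_zero plus_zero_r. exact: (scal_one x).
  - by rewrite (scal_zero_l x) plus_zero_l -IH.
Qed.

Lemma scal_m1 (x : X) : scal (RtoC (-1)) x = opp x.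
Proof.
  rewrite -(scal_opp_one x); congr scal.
  apply: injective_projections; rewrite /= /opp /= /one /=; ring.
Qed.

Lemma vcomb_ext f g l : (forall i, f i = g i) -> vcomb f l = vcomb g l.
Proof.
  elim: l f g => [|x l IH] f g H //=.
  by rewrite H (IH _ (fun i => g (S i))).
Qed.

Lemma vevalE e l : veval l e = vcomb (vcoef e) l.
Proof.
  elim: e => [n||a IHa b IHb|a IHa|a IHa b IHb|c a IHa]; cbn [veval].
  - by rewrite vcomb_var.
  - by rewrite vcomb_zero.
  - by rewrite IHa IHb -vcomb_plus.
  - rewrite IHa -scal_m1 -vcomb_scal; apply: vcomb_ext => i.
    by apply: injective_projections => /=; ring.
  - rewrite IHa IHb /minus -scal_m1 -vcomb_scal -vcomb_plus; apply: vcomb_ext => i.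
    by apply: injective_projections => /=; ring.
  - by rewrite IHa -vcomb_scal.
Qed.

Lemma vreflect e1 e2 l : vagree (vcoef e1) (vcoef e2) l -> veval l e1 = veval l e2.
Proof. rewrite !vevalE; exact: vcomb_agree. Qed.

End Reflect.

Ltac vmem x l :=
  lazymatch l with
  | nil => constr:(false)
  | cons x _ => constr:(true)
  | cons _ ?l => vmem x l
  end.
Ltac vidx x l :=
  lazymatch l with
  | cons x _ => constr:(O)
  | cons _ ?l => let n := vidx x l in constr:(S n)
  end.
Ltac vatoms e l :=
  lazymatch e with
  | zero => l
  | plus ?a ?b => let l := vatoms a l in vatoms b l
  | minus ?a ?b => let l := vatoms a l in vatoms b l
  | opp ?a => vatoms a l
  | scal ?c ?a => vatoms a l
  | _ => let b := vmem e l in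
         lazymatch b with true => l | false => constr:(cons e l) end
  end.
Ltac vreify e l :=
  lazymatch e with
  | zero => constr:(VZero)
  | plus ?a ?b => let a := vreify a l in let b := vreify b l in constr:(VPlus a b)
  | minus ?a ?b => let a := vreify a l in let b := vreify b l in constr:(VMinus a b)
  | opp ?a => let a := vreify a l in constr:(VOpp a)
  | scal ?c ?a => let a := vreify a l in constr:(VScal c a)
  | _ => let n := vidx e l in constr:(VVar n)
  end.
(* Decides linear identities between vectors, up to field identities between
   their coefficients; side conditions [_ <> 0] are sent to [lra]. *)
Ltac vring :=
  lazymatch goal with
  | |- @eq ?T ?a ?b =>
    let l := vatoms a (@nil T) in let l := vatoms b l in
    let ea := vreify a l in let eb := vreify b l in
    refine (@vreflect _ ea eb l _);
    cbn [vcoef vagree Nat.eqb];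
    repeat split; apply: injective_projections;
    cbn [fst snd RtoC Cplus Cmult Copp Cminus];
    first [ring | field; repeat split; try lra]
  end.

Section Norms.
Context {X : NormedModule C_AbsRing}.
Implicit Types x y z : X.

(** The norm axiom gives [<=]; the converse is the same axiom for the scalar [/ r] applied to
    [r x]. *)
Lemma norm_scalR r x : norm (scal (RtoC r) x) = Rabs r * norm x.
Proof.
  have le c y : norm (scal (RtoC c) y) <= Rabs c * norm y.
  { by rewrite -Cmod_R; apply: (norm_scal (RtoC c) y). }
  case: (Req_dec r 0) => [->|Hr].
  - have -> : scal (RtoC 0) x = zero by vring.
    by rewrite norm_zero Rabs_R0 Rmult_0_l.
  - apply: Rle_antisym; first exact: le.
    have {1}-> : x = scal (RtoC (/ r)) (scal (RtoC r) x) by vring.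
    apply: Rle_trans (_ : Rabs r * (Rabs (/ r) * norm (scal (RtoC r) x)) <= _).
    + apply: Rmult_le_compat_l; [exact: Rabs_pos|exact: le].
    + rewrite -Rmult_assoc -Rabs_mult Rinv_r // Rabs_R1; lra.
Qed.

End Norms.

(** * Limits in normed spaces *)

Lemma is_lim_seq_le_real (a b : nat -> R) (l m : R) :
  (forall n, a n <= b n) -> is_lim_seq a l -> is_lim_seq b m -> l <= m.
Proof. exact: (is_lim_seq_le a b l m). Qed.

Section Tends.
Context {X : NormedModule C_AbsRing}.
Implicit Types x y z : X.

Lemma norm_minus_sym x y : norm (minus x y) = norm (minus y x).
Proof. rewrite -norm_opp; congr norm; vring. Qed.

Lemma dist_triangle y x z :
  norm (minus x z) <= norm (minus x y) + norm (minus y z).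
Proof.
  have -> : minus x z = plus (minus x y) (minus y z) by vring.
  exact: norm_triangle.
Qed.

Lemma norm_le_dist x y : norm x <= norm y + norm (minus x y).
Proof.
  have {1}-> : x = plus y (minus x y) by vring.
  exact: norm_triangle.
Qed.

Lemma dist_plus x y x' y' :
  norm (minus (plus x y) (plus x' y')) <= norm (minus x x') + norm (minus y y').
Proof.
  have -> : minus (plus x y) (plus x' y') = plus (minus x x') (minus y y') by vring.
  exact: norm_triangle.
Qed.

Lemma dist_eq_0 x y : norm (minus x y) <= 0 -> x = y.
Proof.
  move=> H.
  have /norm_eq_zero E : norm (minus x y) = 0.
  { have := norm_ge_0 (minus x y); lra. }
  have -> : x = plus (minus x y) y by vring.
  by rewrite E plus_zero_l.
Qed.

(** Convergence is phrased as a real limit, so that squeeze and comparison of real sequences apply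
    directly. *)
Definition tends (u : nat -> X) (l : X) : Prop :=
  is_lim_seq (fun n => norm (minus (u n) l)) 0.

Lemma is_lim_seq_squeeze0 (a b : nat -> R) :
  (forall n, 0 <= a n <= b n) -> is_lim_seq b 0 -> is_lim_seq a 0.
Proof.
  move=> H Hb; apply: (is_lim_seq_le_le (fun _ => 0) a b) => //.
  exact: is_lim_seq_const.
Qed.

Lemma tends_squeeze (u : nat -> X) l (b : nat -> R) :
  (forall n, norm (minus (u n) l) <= b n) -> is_lim_seq b 0 -> tends u l.
Proof.
  move=> H; apply: is_lim_seq_squeeze0 => n; split=> //; exact: norm_ge_0.
Qed.

Lemma is_lim_seq_plus0 (a b : nat -> R) :
  is_lim_seq a 0 -> is_lim_seq b 0 -> is_lim_seq (fun n => a n + b n) 0.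
Proof.
  move=> Ha Hb; have := is_lim_seq_plus' _ _ _ _ Ha Hb; by rewrite Rplus_0_l.
Qed.

Lemma is_lim_seq_scal0 (a : nat -> R) c :
  is_lim_seq a 0 -> is_lim_seq (fun n => c * a n) 0.
Proof.
  move=> Ha; have := is_lim_seq_scal_l _ c _ Ha.
  by rewrite /= Rmult_0_r.
Qed.

Lemma tends_const x : tends (fun _ => x) x.
Proof.
  apply: (tends_squeeze _ _ (fun _ => 0)); last exact: is_lim_seq_const.
  move=> _; rewrite minus_eq_zero norm_zero; lra.
Qed.

Lemma tends_unique u x y : tends u x -> tends u y -> x = y.
Proof.
  move=> Hx Hy; apply: dist_eq_0.
  have H := is_lim_seq_plus0 _ _ Hx Hy.
  apply: (is_lim_seq_le_real (fun _ => norm (minus x y)) _ _ _ _ _ H) => [n|].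
  - rewrite (norm_minus_sym (u n) x); exact: dist_triangle.
  - exact: is_lim_seq_const.
Qed.

Lemma tends_plus u v x y :
  tends u x -> tends v y -> tends (fun n => plus (u n) (v n)) (plus x y).
Proof.
  move=> Hx Hy; apply: (tends_squeeze _ _ _ _ (is_lim_seq_plus0 _ _ Hx Hy)) => n.
  exact: dist_plus.
Qed.

Lemma tends_scal (c : C) u x :
  tends u x -> tends (fun n => scal c (u n)) (scal c x).
Proof.
  move=> Hx; apply: (tends_squeeze _ _ _ _ (is_lim_seq_scal0 _ (Cmod c) Hx)) => n.
  have -> : minus (scal c (u n)) (scal c x) = scal c (minus (u n) x) by vring.
  exact: (norm_scal c).
Qed.

Lemma tends_minus u v x y :
  tends u x -> tends v y -> tends (fun n => minus (u n) (v n)) (minus x y).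
Proof.
  move=> Hx Hy; apply: (tends_squeeze _ _ _ _ (is_lim_seq_plus0 _ _ Hx Hy)) => n.
  have -> : minus (minus (u n) (v n)) (minus x y) =
    plus (minus (u n) x) (opp (minus (v n) y)) by vring.
  apply: Rle_trans (norm_triangle _ _) _; rewrite norm_opp; lra.
Qed.

Lemma tends_ext u v x : (forall n, u n = v n) -> tends u x -> tends v x.
Proof. by move=> H; apply: is_lim_seq_ext => n; rewrite H. Qed.

Lemma tends_norm u x : tends u x -> is_lim_seq (fun n => norm (u n)) (norm x).
Proof.
  move=> Hx.
  have H : is_lim_seq (fun n => norm (u n) - norm x) 0.
  { apply: (is_lim_seq_le_le (fun n => - norm (minus (u n) x)) _
             (fun n => norm (minus (u n) x))) => // [n|].
    - have := norm_le_dist (u n) x; have := norm_le_dist x (u n).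
      rewrite (norm_minus_sym x); lra.
    - have := is_lim_seq_scal0 _ (-1) Hx; apply: is_lim_seq_ext => n; ring. }
  have := is_lim_seq_plus' _ _ _ _ H (is_lim_seq_const (norm x)).
  rewrite Rplus_0_l; apply: is_lim_seq_ext => n; lra.
Qed.

Lemma tends_le u x (c : nat -> R) (c0 : R) :
  tends u x -> (forall n, norm (u n) <= c n) -> is_lim_seq c c0 -> norm x <= c0.
Proof. move=> /tends_norm Hx H Hc; exact: (is_lim_seq_le_real _ _ _ _ H Hx Hc). Qed.

Lemma tends_choice (P : X -> Prop) x :
  (forall eps, 0 < eps -> exists y, P y /\ norm (minus x y) < eps) ->
  exists u, tends u x /\ forall n, P (u n).
Proof.
  move=> H.
  have Hn n : exists y, P y /\ norm (minus x y) < / (INR n + 1).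
  { apply: H; apply: Rinv_0_lt_compat; have := pos_INR n; lra. }
  pose u n := proj1_sig (constructive_indefinite_description _ (Hn n)).
  have Hu n : P (u n) /\ norm (minus x (u n)) < / (INR n + 1).
  { exact: (proj2_sig (constructive_indefinite_description _ (Hn n))). }
  exists u; split; last by move=> n; case: (Hu n).
  apply: (tends_squeeze _ _ (fun n => / (INR n + 1))) => [n|].
  - rewrite norm_minus_sym; case: (Hu n); lra.
  - apply: (is_lim_seq_ext (fun n => / INR (S n))) => [n|].
    + by rewrite S_INR.
    + apply/(is_lim_seq_incr_1 (fun n => / INR n)).
      exact: (is_lim_seq_inv _ _ is_lim_seq_INR).
Qed.

Definition cauchy_seq (u : nat -> X) : Prop :=
  forall eps, 0 < eps -> exists N, forall n m, (N <= n)%nat -> (N <= m)%nat ->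
    norm (minus (u n) (u m)) < eps.

(** Completeness as a property of a normed module rather than as a structure, so that it can be
    asserted of the product space [Hsp]. *)
Definition cauchy_complete : Prop :=
  forall u : nat -> X, cauchy_seq u -> exists l, tends u l.

Lemma tends_eventually u x eps :
  tends u x -> 0 < eps ->
  exists N, forall n, (N <= n)%nat -> norm (minus (u n) x) < eps.
Proof.
  move=> /is_lim_seq_spec H He; case: (H (mkposreal eps He)) => N HN.
  exists N => n Hn; move: (HN n Hn).
  rewrite /= Rminus_0_r => /(Rle_lt_trans _ _ _ (Rle_abs _)) //.
Qed.

Lemma tends_cauchy u x : tends u x -> cauchy_seq u.
Proof.
  move=> H eps He; have [|N HN] := tends_eventually _ _ (eps / 2) H; first lra.
  exists N => n m Hn Hm.
  have := dist_triangle x (u n) (u m); have := HN _ Hn; have := HN _ Hm.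
  rewrite (norm_minus_sym (u m)); lra.
Qed.

End Tends.
Arguments cauchy_complete : clear implicits.

Lemma is_lim_seq_geom_half (c : R) : is_lim_seq (fun n => c * (/ 2) ^ n) 0.
Proof. apply: is_lim_seq_scal0; apply: is_lim_seq_geom; rewrite Rabs_pos_eq; lra. Qed.

(** Telescoping against a geometric series. It serves both the dyadic Euler schemes (ratio 1/2) and
    the fixed point iteration of the perturbation argument. *)
Lemma cauchy_complete_geom {X : NormedModule C_AbsRing} (u : nat -> X) (c q : R) :
  cauchy_complete X -> 0 <= c -> 0 <= q < 1 ->
  (forall n, norm (minus (u (S n)) (u n)) <= c * q ^ n) ->
  exists l, tends u l.
Proof.
  move=> HX Hc Hq H; apply: HX => eps He.
  have Hd : 0 <= c / (1 - q) by apply: Rdiv_le_0_compat; lra.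
  have Hk n k : norm (minus (u (n + k)%nat) (u n)) <= c / (1 - q) * q ^ n.
  (* The partial geometric sum is kept exactly, since the weaker bound by the full tail does not
     pass the induction. *)
  { apply: (Rle_trans _ (c / (1 - q) * (q ^ n - q ^ (n + k)))).
    - elim: k => [|k IH].
      + rewrite Nat.add_0_r minus_eq_zero norm_zero; lra.
      + rewrite Nat.add_succ_r.
        apply: Rle_trans (dist_triangle (u (n + k)%nat) _ _) _.
        have := H (n + k)%nat.
        have -> : c / (1 - q) * (q ^ n - q ^ S (n + k)) =
          c * q ^ (n + k) + c / (1 - q) * (q ^ n - q ^ (n + k)).
        { rewrite /=; field; lra. }
        lra.
    - have : 0 <= q ^ (n + k) by apply: pow_le; lra.
      nra. }
  have Hlim : is_lim_seq (fun n => c / (1 - q) * q ^ n) 0.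
  { apply: is_lim_seq_scal0; apply: is_lim_seq_geom; rewrite Rabs_pos_eq; lra. }
  have He2 : 0 < eps / 2 by lra.
  case: ((proj2 (is_lim_seq_spec _ _) Hlim) (mkposreal _ He2)) => N HN.
  have HN' : c / (1 - q) * q ^ N < eps / 2.
  { have := HN N (le_n N); rewrite /= Rminus_0_r; exact: Rle_lt_trans (Rle_abs _). }
  exists N => n m Hn Hm.
  apply: Rle_lt_trans (dist_triangle (u N) _ _) _.
  rewrite [X in _ + X]norm_minus_sym.
  have := Hk N (n - N)%nat; have := Hk N (m - N)%nat.
  have -> : (N + (n - N) = n)%nat by lia.
  have -> : (N + (m - N) = m)%nat by lia.
  lra.
Qed.

(** * Contraction semigroups of m-dissipative operators *)

(** The [+ 1] gives a legitimate radius when [c = 0] as well. *)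
Lemma mult_le_of_lt_div (e c t : R) : 0 < e -> 0 <= c -> 0 <= t < e / (c + 1) -> t * c <= e.
Proof.
  move=> He Hc; set d := e / (c + 1) => Ht.
  have <- : d * (c + 1) = e by rewrite /d; field; lra.
  nra.
Qed.

Section MDissipative.
Context {X : NormedModule C_AbsRing}.

Record linear_graph (A : X -> X -> Prop) : Prop := {
  graph_add : forall x y x' y', A x y -> A x' y' -> A (plus x x') (plus y y');
  graph_scal : forall (c : C) x y, A x y -> A (scal c x) (scal c y)
}.

Lemma graph_minus A x y x' y' : linear_graph A ->
  A x y -> A x' y' -> A (minus x x') (minus y y').
Proof.
  move=> HA H H'.
  have -> : minus x x' = plus x (scal (RtoC (-1)) x') by vring.
  have -> : minus y y' = plus y (scal (RtoC (-1)) y') by vring.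
  by apply: graph_add => //; apply: graph_scal.
Qed.

(** In a Hilbert space this expresses Re (Ax|x) <= w |x|^2. The norm form yields injectivity of l -
    A and the bound 1/(l - w) for its inverse. *)
Definition dissipative (w : R) (A : X -> X -> Prop) : Prop :=
  forall l x y, w < l -> A x y -> (l - w) * norm x <= norm (minus (scal (RtoC l) x) y).

(** The range condition is required for every [l > w] because the Euler scheme inverts 1 - hA for
    arbitrarily small h, that is for l = 1/h. *)
Record m_dissipative (w : R) (A : X -> X -> Prop) : Prop := {
  mdiss_linear : linear_graph A;
  mdiss_diss : dissipative w A;
  mdiss_range : forall l f, w < l ->
    exists x y, A x y /\ minus (scal (RtoC l) x) y = f;
  mdiss_dense : forall x eps, 0 < eps ->
    exists x', dom A x' /\ norm (minus x x') < eps
}.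

End MDissipative.

Definition nat_floor (x : R) : nat := Z.to_nat (Int_part x).

Lemma nat_floor_spec x : 0 <= x -> INR (nat_floor x) <= x < INR (nat_floor x) + 1.
Proof.
  move=> Hx; have [H1 H2] := base_Int_part x.
  have H : (0 <= Int_part x)%Z.
  { suff : (-1 < Int_part x)%Z by lia.
    apply: lt_IZR; lra. }
  rewrite /nat_floor INR_IZR_INZ Z2Nat.id //; lra.
Qed.

(** * The resolvent and the implicit Euler iterates *)

Section Contraction.
Context {X : NormedModule C_AbsRing}.
Context (HX : cauchy_complete X).
Context (A : X -> X -> Prop) (HA : m_dissipative 0 A).
Implicit Types x y z : X.

Lemma graph_contract h x y : 0 < h -> A x y -> norm x <= norm (minus x (scal (RtoC h) y)).
Proof.
  move=> Hh Hxy.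
  have Hh' : 0 < / h by apply: Rinv_0_lt_compat.
  have := mdiss_diss _ _ HA _ _ _ Hh' Hxy.
  have -> : minus (scal (RtoC (/ h)) x) y =
            scal (RtoC (/ h)) (minus x (scal (RtoC h) y)) by vring.
  rewrite norm_scalR Rabs_pos_eq; last lra.
  rewrite Rminus_0_r => /(Rmult_le_reg_l _ _ _ Hh') //.
Qed.

(** The equation u - h A u = x is solved for A u. The condition [0 < h] sits inside the existential
    so that choice produces a function of all [h]. *)
Lemma resolvent_ex h x :
  exists u, 0 < h -> A u (scal (RtoC (/ h)) (minus u x)).
Proof.
  case: (Rlt_dec 0 h) => Hh; last by exists x.
  have [u [w [Huw E]]] :=
    mdiss_range _ _ HA (/ h) (scal (RtoC (/ h)) x) (Rinv_0_lt_compat _ Hh).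
  exists u => _.
  have -> : scal (RtoC (/ h)) (minus u x) =
      minus (scal (RtoC (/ h)) u) (scal (RtoC (/ h)) x) by vring.
  rewrite -E.
  by have -> : minus (scal (RtoC (/ h)) u) (minus (scal (RtoC (/ h)) u) w) = w by vring.
Qed.

Definition resolvent h x : X :=
  proj1_sig (constructive_indefinite_description _ (resolvent_ex h x)).
Local Notation J := resolvent.

Lemma resolvent_graph h x : 0 < h -> A (J h x) (scal (RtoC (/ h)) (minus (J h x) x)).
Proof. exact: (proj2_sig (constructive_indefinite_description _ (resolvent_ex h x))). Qed.

(** The difference of two solutions solves the homogeneous equation, and [graph_contract] bounds it
    by 0. The identities for [J] below are all obtained by exhibiting a point of the graph and
    applying this lemma. *)
Lemma resolvent_unique h u w : 0 < h -> A u w -> J h (minus u (scal (RtoC h) w)) = u.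
Proof.
  move=> Hh Huw; set f := minus _ _.
  have Hf := resolvent_graph h f Hh.
  apply: dist_eq_0.
  have H := graph_minus _ _ _ _ _ (mdiss_linear _ _ HA) Hf Huw.
  apply: Rle_trans (graph_contract h _ _ Hh H) _.
  rewrite [X in norm X](_ : _ = zero); last by (rewrite /f; vring).
  rewrite norm_zero; lra.
Qed.

Lemma resolvent_le h x : 0 < h -> norm (J h x) <= norm x.
Proof.
  move=> Hh; apply: Rle_trans (graph_contract h _ _ Hh (resolvent_graph h x Hh)) _.
  rewrite [X in norm X](_ : _ = x); last by vring.
  lra.
Qed.

Lemma resolvent_plus h x y : 0 < h -> J h (plus x y) = plus (J h x) (J h y).
Proof.
  move=> Hh.
  have H := graph_add _ (mdiss_linear _ _ HA) _ _ _ _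
    (resolvent_graph h x Hh) (resolvent_graph h y Hh).
  rewrite -[RHS](resolvent_unique h _ _ Hh H); congr (J h _); vring.
Qed.

Lemma resolvent_scal h (c : C) x : 0 < h -> J h (scal c x) = scal c (J h x).
Proof.
  move=> Hh.
  have H := graph_scal _ (mdiss_linear _ _ HA) c _ _ (resolvent_graph h x Hh).
  rewrite -[RHS](resolvent_unique h _ _ Hh H); congr (J h _); vring.
Qed.

Lemma resolvent_minus h x y : 0 < h -> J h (minus x y) = minus (J h x) (J h y).
Proof.
  move=> Hh.
  have -> : minus x y = plus x (scal (RtoC (-1)) y) by vring.
  rewrite resolvent_plus // resolvent_scal //; vring.
Qed.

(** Both h A J_h x and h J_h A x: the quotient (J_h x - x)/h solves the resolvent equation with
    right-hand side y. Hence the resolvent commutes with A. *)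
Lemma resolvent_diff h x y : 0 < h -> A x y -> minus (J h x) x = scal (RtoC h) (J h y).
Proof.
  move=> Hh Hxy.
  pose w := scal (RtoC (/ h)) (minus (J h x) x).
  suff -> : J h y = w by (rewrite /w; vring).
  have H := graph_scal _ (mdiss_linear _ _ HA) (RtoC (/ h)) _ _
    (graph_minus _ _ _ _ _ (mdiss_linear _ _ HA) (resolvent_graph h x Hh) Hxy).
  rewrite -[RHS](resolvent_unique h _ _ Hh H); congr (J h _); rewrite /w; vring.
Qed.

Lemma resolvent_invariant h x y : 0 < h -> A x y -> A (J h x) (J h y).
Proof.
  move=> Hh Hxy; have := resolvent_graph h x Hh.
  rewrite (resolvent_diff _ _ _ Hh Hxy).
  by have -> : scal (RtoC (/ h)) (scal (RtoC h) (J h y)) = J h y by vring.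
Qed.

Local Notation Jn h n := (Nat.iter n (J h)).

Section Iterates.
Context (h : R) (Hh : 0 < h).

Lemma iter_le n x : norm (Jn h n x) <= norm x.
Proof.
  elim: n => [|n IH] /=; first lra.
  apply: Rle_trans (resolvent_le _ _ Hh) IH.
Qed.

Lemma iter_plus n x y : Jn h n (plus x y) = plus (Jn h n x) (Jn h n y).
Proof. by elim: n => [|n IH] //=; rewrite IH resolvent_plus. Qed.

Lemma iter_scal n (c : C) x : Jn h n (scal c x) = scal c (Jn h n x).
Proof. by elim: n => [|n IH] //=; rewrite IH resolvent_scal. Qed.

Lemma iter_minus n x y : Jn h n (minus x y) = minus (Jn h n x) (Jn h n y).
Proof. by elim: n => [|n IH] //=; rewrite IH resolvent_minus. Qed.

Lemma iter_invariant n x y : A x y -> A (Jn h n x) (Jn h n y).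
Proof. by move=> H; elim: n => [|n IH] //=; apply: resolvent_invariant. Qed.

Lemma iter_add n m x : Jn h (n + m) x = Jn h n (Jn h m x).
Proof. by elim: n => [|n IH] //=; rewrite IH. Qed.

Lemma iter_dist n x y : norm (minus (Jn h n x) (Jn h n y)) <= norm (minus x y).
Proof. rewrite -iter_minus; exact: iter_le. Qed.

Lemma iter_lipschitz n x y : A x y -> norm (minus (Jn h n x) x) <= INR n * h * norm y.
Proof.
  move=> Hxy; elim: n => [|n IH].
  - rewrite /= minus_eq_zero norm_zero; lra.
  - apply: Rle_trans (dist_triangle (Jn h n x) _ _) _.
    have E : norm (minus (Jn h (S n) x) (Jn h n x)) <= h * norm y.
    { rewrite /= (resolvent_diff _ _ _ Hh (iter_invariant n _ _ Hxy)).
      rewrite norm_scalR Rabs_pos_eq; last lra.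
      apply: Rmult_le_compat_l; first lra.
      apply: Rle_trans (resolvent_le _ _ Hh) (iter_le n y). }
    rewrite S_INR; lra.
Qed.

(** The n-th increment is h J_h^n y, which differs from h y by at most n h^2 |z|; the sum of these
    errors is at most (n h)^2 |z|. *)
Lemma iter_taylor n x y z : A x y -> A y z ->
  norm (minus (minus (Jn h n x) x) (scal (RtoC (INR n * h)) y)) <= (INR n * h) ^ 2 * norm z.
Proof.
  move=> Hxy Hyz; elim: n => [|n IH].
  - have -> : minus (minus (Jn h 0 x) x) (scal (RtoC (INR 0 * h)) y) = zero.
    { rewrite /=; vring. }
    rewrite norm_zero /=; lra.
  - have -> : minus (minus (Jn h (S n) x) x) (scal (RtoC (INR (S n) * h)) y) =
      plus (minus (minus (Jn h n x) x) (scal (RtoC (INR n * h)) y))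
           (scal (RtoC h) (minus (Jn h (S n) y) y)).
    { have E := resolvent_diff _ _ _ Hh (iter_invariant n _ _ Hxy).
      have -> : Jn h (S n) x = plus (Jn h n x) (scal (RtoC h) (Jn h (S n) y)).
      { rewrite /= -E; vring. }
      rewrite S_INR; vring. }
    apply: Rle_trans (norm_triangle _ _) _.
    rewrite norm_scalR Rabs_pos_eq; last lra.
    have H1 := iter_lipschitz (S n) _ _ Hyz.
    have H2 := Rmult_le_compat_l h _ _ (Rlt_le _ _ Hh) H1.
    have : 0 <= INR n * h * h * norm z.
    { apply: Rmult_le_pos (norm_ge_0 _).
      apply: Rmult_le_pos; last lra.
      apply: Rmult_le_pos; [exact: pos_INR|lra]. }
    move: IH H2; rewrite S_INR; lra.
Qed.

End Iterates.

(** With k = h/2, (1 - kA)^2 = (1 - hA) + k^2 A^2. Hence 1 - hA sends J_k^2 x to x - k^2 J_k^2 z,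
    and applying the contraction J_h leaves an error of at most k^2 |z|. *)
Lemma resolvent_half h x y z : 0 < h -> A x y -> A y z ->
  norm (minus (J h x) (J (h / 2) (J (h / 2) x))) <= (h / 2) ^ 2 * norm z.
Proof.
  move=> Hh Hxy Hyz; set k := h / 2.
  have Hk : 0 < k by rewrite /k; lra.
  have inv u w := resolvent_invariant k u w Hk.
  have E1 := resolvent_diff _ _ _ Hk Hxy.
  have E2 := resolvent_diff _ _ _ Hk (inv _ _ Hxy).
  have E3 := resolvent_diff _ _ _ Hk Hyz.
  have E4 := resolvent_diff _ _ _ Hk (inv _ _ Hyz).
  have -> : J k (J k x) = J h (minus x (scal (RtoC (k ^ 2)) (J k (J k z)))).
  { rewrite -[LHS](resolvent_unique h _ _ Hh (inv _ _ (inv _ _ Hxy))).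
    congr (J h _).
    have -> : J k (J k x) = plus (J k x) (scal (RtoC k) (J k (J k y))).
    { rewrite -E2; vring. }
    have -> : J k x = plus x (scal (RtoC k) (J k y)) by (rewrite -E1; vring).
    have -> : J k (J k y) = plus (J k y) (scal (RtoC k) (J k (J k z))).
    { rewrite -E4; vring. }
    have -> : h = 2 * k by rewrite /k; lra.
    vring. }
  rewrite -resolvent_minus //.
  apply: Rle_trans (resolvent_le _ _ Hh) _.
  rewrite [X in norm X](_ : _ = scal (RtoC (k ^ 2)) (J k (J k z))); last by vring.
  rewrite norm_scalR Rabs_pos_eq; last by apply: pow2_ge_0.
  apply: Rmult_le_compat_l; first by apply: pow2_ge_0.
  apply: Rle_trans (resolvent_le _ _ Hk) (resolvent_le _ _ Hk).
Qed.

(** The n local errors add up without amplification: the iterates are contractions, and replacing x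
    by J_k^2 x keeps it in the domain of A^2 with |J_k^2 z| <= |z|. *)
Lemma iter_half h n x y z : 0 < h -> A x y -> A y z ->
  norm (minus (Jn h n x) (Jn (h / 2) (2 * n) x)) <= INR n * (h / 2) ^ 2 * norm z.
Proof.
  move=> Hh; set k := h / 2.
  have Hk : 0 < k by rewrite /k; lra.
  elim: n x y z => [|n IH] x y z Hxy Hyz.
  - rewrite /= minus_eq_zero norm_zero; lra.
  - have -> : Jn h (S n) x = Jn h n (J h x).
    { by have := iter_add h n 1 x; rewrite Nat.add_1_r. }
    have -> : Jn k (2 * S n) x = Jn k (2 * n) (J k (J k x)).
    { have -> : (2 * S n = 2 * n + 2)%nat by lia.
      by rewrite iter_add. }
    apply: Rle_trans (dist_triangle (Jn h n (J k (J k x))) _ _) _.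
    have inv u w := resolvent_invariant k u w Hk.
    have H1 := IH _ _ _ (inv _ _ (inv _ _ Hxy)) (inv _ _ (inv _ _ Hyz)).
    have H2 := iter_dist h Hh n (J h x) (J k (J k x)).
    have H3 := resolvent_half _ _ _ _ Hh Hxy Hyz; rewrite -/k in H3.
    have H4 : norm (J k (J k z)) <= norm z.
    { apply: Rle_trans (resolvent_le _ _ Hk) (resolvent_le _ _ Hk). }
    have H5 : 0 <= INR n * k ^ 2.
    { apply: Rmult_le_pos; [exact: pos_INR|exact: pow2_ge_0]. }
    have := Rmult_le_compat_l _ _ _ H5 H4.
    rewrite S_INR; lra.
Qed.

Lemma iter_gap h n m x y : 0 < h -> A x y -> (n <= m)%nat ->
  norm (minus (Jn h m x) (Jn h n x)) <= (INR m - INR n) * h * norm y.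
Proof.
  move=> Hh Hxy Hnm.
  have E : Jn h m x = Jn h n (Jn h (m - n) x).
  { rewrite -iter_add; congr (Nat.iter _ (J h) x); lia. }
  rewrite E -minus_INR //.
  apply: Rle_trans (iter_dist h Hh _ _ _) _.
  exact: iter_lipschitz.
Qed.

(** * Dyadic Euler approximations *)

Local Notation step m := ((/ 2) ^ m).
Local Notation fl t m := (nat_floor (t * 2 ^ m)).

Lemma step_gt_0 m : 0 < step m.
Proof. apply: pow_lt; lra. Qed.

Lemma step_pow m : 2 ^ m * step m = 1.
Proof. rewrite -Rpow_mult_distr Rinv_r ?pow1 //; lra. Qed.

Lemma floor_step t m : 0 <= t -> INR (fl t m) * step m <= t < INR (fl t m) * step m + step m.
Proof.
  move=> Ht.
  have Hp : 0 < 2 ^ m by apply: pow_lt; lra.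
  have H0 : 0 <= t * 2 ^ m by nra.
  have [H1 H2] := nat_floor_spec _ H0.
  have E : t * 2 ^ m * step m = t by rewrite Rmult_assoc step_pow Rmult_1_r.
  have Hs := step_gt_0 m.
  have := Rmult_le_compat_r _ _ _ (Rlt_le _ _ Hs) H1.
  have := Rmult_lt_compat_r _ _ _ Hs H2.
  rewrite E; lra.
Qed.

Definition euler m t x : X := Jn (step m) (fl t m) x.

Lemma euler_le m t x : norm (euler m t x) <= norm x.
Proof. exact: iter_le (step_gt_0 m) _ _. Qed.

Lemma euler_dist m t x y : norm (minus (euler m t x) (euler m t y)) <= norm (minus x y).
Proof. exact: iter_dist (step_gt_0 m) _ _ _. Qed.

(** With n steps of length h at one level, the next level has 2n or 2n + 1 steps of length h/2.
    Halving n steps costs n (h/2)^2 |z| <= t h |z|, and the possible extra half step costs at most h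
    |y|. *)
Lemma euler_step m t x y z : 0 <= t -> A x y -> A y z ->
  norm (minus (euler (S m) t x) (euler m t x)) <= (t * norm z + norm y) * step m.
Proof.
  move=> Ht Hxy Hyz; rewrite /euler.
  have [H1 H2] := floor_step t m Ht; have [H3 H4] := floor_step t (S m) Ht.
  move: H1 H2 H3 H4; set n := fl t m; set n' := fl t (S m).
  have Hs := step_gt_0 m; set h := step m in Hs *.
  have -> : step (S m) = h / 2 by rewrite /h /=; lra.
  move=> H1 H2 H3 H4.
  have Hn : (2 * n <= n')%nat.
  { suff : (2 * n < n' + 1)%nat by lia.
    apply: INR_lt; rewrite mult_INR plus_INR /=; nra. }
  have Hn' : INR n' - INR (2 * n) <= 1.
  { have : (n' < 2 * n + 2)%nat.
    { apply: INR_lt; rewrite plus_INR mult_INR /=; nra. }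
    move=> Hlt; have : (n' <= 2 * n + 1)%nat by lia.
    move=> /le_INR; rewrite plus_INR /=; lra. }
  apply: Rle_trans (dist_triangle (Jn (h / 2) (2 * n) x) _ _) _.
  have Hh2 : 0 < h / 2 by lra.
  have G1 := iter_gap _ _ _ _ _ Hh2 Hxy Hn.
  have G2 := iter_half h n _ _ _ Hs Hxy Hyz.
  rewrite (norm_minus_sym (Jn (h / 2) (2 * n) x)).
  have Ny := norm_ge_0 y; have Nz := norm_ge_0 z.
  have B1 : (INR n' - INR (2 * n)) * (h / 2) * norm y <= h * norm y.
  { apply: Rmult_le_compat_r => //; nra. }
  have B2 : INR n * (h / 2) ^ 2 * norm z <= t * h * norm z.
  { apply: Rmult_le_compat_r => //.
    have := pos_INR n; nra. }
  lra.
Qed.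

(** Smoothing by the resolvent: J_h maps a point x1 of the domain into the domain of A^2 and moves
    it by h |J_h y1| <= h |y1|. *)
Lemma dom_dense2 x eps : 0 < eps ->
  exists x' y z, A x' y /\ A y z /\ norm (minus x x') < eps.
Proof.
  move=> He; have [|x1 [[y1 H1] D1]] := mdiss_dense _ _ HA x (eps / 2); first lra.
  have Hy1 := norm_ge_0 y1.
  have [h [Hh Hh']] : exists h, 0 < h /\ h * norm y1 < eps / 2.
  { exists (eps / 4 / (norm y1 + 1)); split; first by apply: Rdiv_lt_0_compat; lra.
    have : eps / 4 / (norm y1 + 1) * (norm y1 + 1) = eps / 4 by field; lra.
    have : 0 < eps / 4 / (norm y1 + 1) by apply: Rdiv_lt_0_compat; lra.
    nra. }
  exists (J h x1), (J h y1), (scal (RtoC (/ h)) (minus (J h y1) y1)).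
  split; [exact: resolvent_invariant|split; first exact: resolvent_graph].
  apply: Rle_lt_trans (dist_triangle x1 _ _) _.
  rewrite (norm_minus_sym x1) (resolvent_diff _ _ _ Hh H1) norm_scalR Rabs_pos_eq; last lra.
  have := resolvent_le h y1 Hh; nra.
Qed.

(** The domain of A^2 is a core. J_h x is near x at the rate h |y|; since y need not lie in the
    domain, J_h y is compared with J_h x1 for a point x1 of the domain close to y. *)
Lemma core2 x y eps : 0 < eps -> A x y ->
  exists x' y' z, A x' y' /\ A y' z /\ norm (minus x x') < eps /\ norm (minus y y') < eps.
Proof.
  move=> He Hxy.
  have [|x1 [[y1 H1] D1]] := mdiss_dense _ _ HA y (eps / 4); first lra.
  (* One [M] for both displacements: h |y| and h |y1| are then at most eps/4. *)
  pose M := norm y + norm y1 + 1.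
  have Hy := norm_ge_0 y; have Hy1 := norm_ge_0 y1.
  pose h := eps / 4 / M.
  have HM : 1 <= M by rewrite /M; lra.
  have Hh : 0 < h by rewrite /h; apply: Rdiv_lt_0_compat; lra.
  have HhM : h * M = eps / 4 by rewrite /h; field; lra.
  exists (J h x), (J h y), (scal (RtoC (/ h)) (minus (J h y) y)).
  split; [exact: resolvent_invariant|split; first exact: resolvent_graph].
  split.
  - rewrite norm_minus_sym (resolvent_diff _ _ _ Hh Hxy) norm_scalR Rabs_pos_eq; last lra.
    have := resolvent_le h y Hh; rewrite /M in HhM; nra.
  - apply: Rle_lt_trans (dist_triangle x1 _ _) _.
    have T1 := dist_triangle (J h x1) x1 (J h y).
    have E1 : norm (minus (J h x1) (J h y)) <= norm (minus x1 y).
    { rewrite -resolvent_minus //; exact: resolvent_le. }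
    have E2 : norm (minus x1 (J h x1)) <= h * norm y1.
    { rewrite norm_minus_sym (resolvent_diff _ _ _ Hh H1) norm_scalR Rabs_pos_eq; last lra.
      apply: Rmult_le_compat_l; [lra|exact: resolvent_le]. }
    rewrite (norm_minus_sym x1 y) in E1.
    rewrite /M in HhM; nra.
Qed.

(** On the domain of A^2 the dyadic schemes form a geometric Cauchy sequence; elsewhere an
    approximation within eps/3 suffices, the schemes being contractions uniformly in m. *)
Lemma euler_cv t x : 0 <= t -> exists l, tends (fun m => euler m t x) l.
Proof.
  move=> Ht.
  have H2 x' y z : A x' y -> A y z -> exists l, tends (fun m => euler m t x') l.
  { move=> Hxy Hyz.
    apply: (cauchy_complete_geom _ (t * norm z + norm y) (/ 2)) => //; last first.
    - move=> m; exact: euler_step.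
    - lra.
    - have := norm_ge_0 y; have := norm_ge_0 z; nra. }
  apply: HX => eps He.
  have [|x' [y [z [Hxy [Hyz D]]]]] := dom_dense2 x (eps / 3); first lra.
  have [l Hl] := H2 _ _ _ Hxy Hyz.
  have [|N HN] := tends_cauchy _ _ Hl (eps / 3); first lra.
  exists N => n m Hn Hm.
  apply: Rle_lt_trans (dist_triangle (euler n t x') _ _) _.
  have := dist_triangle (euler m t x') (euler n t x') (euler m t x).
  have := euler_dist n t x x'; have := euler_dist m t x' x.
  have := HN _ _ Hn Hm; rewrite (norm_minus_sym x' x); lra.
Qed.

(** * The limit semigroup and its generator *)

Lemma semigroup_ex t x : exists l, 0 <= t -> tends (fun m => euler m t x) l.
Proof.
  case: (Rle_dec 0 t) => Ht; last by exists x.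
  by case: (euler_cv t x Ht) => l Hl; exists l.
Qed.

Definition semigroup t x : X :=
  proj1_sig (constructive_indefinite_description _ (semigroup_ex t x)).

Lemma semigroup_tends t x : 0 <= t -> tends (fun m => euler m t x) (semigroup t x).
Proof. exact: (proj2_sig (constructive_indefinite_description _ (semigroup_ex t x))). Qed.

Local Notation SG := semigroup.

Lemma semigroup_le t x : 0 <= t -> norm (SG t x) <= norm x.
Proof.
  move=> Ht.
  apply: (tends_le _ _ (fun _ => norm x) _ (semigroup_tends t x Ht)).
  - move=> m; exact: euler_le.
  - exact: is_lim_seq_const.
Qed.

Lemma semigroup_plus t x y : 0 <= t -> SG t (plus x y) = plus (SG t x) (SG t y).
Proof.
  move=> Ht; apply: (tends_unique _ _ _ (semigroup_tends t _ Ht)).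
  apply: (tends_ext (fun m => plus (euler m t x) (euler m t y))) => [m|].
  - rewrite /euler iter_plus //; exact: step_gt_0.
  - apply: tends_plus; exact: semigroup_tends.
Qed.

Lemma semigroup_scal t (c : C) x : 0 <= t -> SG t (scal c x) = scal c (SG t x).
Proof.
  move=> Ht; apply: (tends_unique _ _ _ (semigroup_tends t _ Ht)).
  apply: (tends_ext (fun m => scal c (euler m t x))) => [m|].
  - rewrite /euler iter_scal //; exact: step_gt_0.
  - apply: tends_scal; exact: semigroup_tends.
Qed.

Lemma semigroup_minus t x y : 0 <= t -> SG t (minus x y) = minus (SG t x) (SG t y).
Proof.
  move=> Ht.
  have -> : minus x y = plus x (scal (RtoC (-1)) y) by vring.
  rewrite semigroup_plus // semigroup_scal //; vring.
Qed.

Lemma semigroup_dist t x y : 0 <= t -> norm (minus (SG t x) (SG t y)) <= norm (minus x y).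
Proof. move=> Ht; rewrite -semigroup_minus //; exact: semigroup_le. Qed.

Lemma is_lim_floor t : 0 <= t -> is_lim_seq (fun m => INR (fl t m) * step m) t.
Proof.
  move=> Ht.
  apply: (is_lim_seq_le_le (fun m => t - step m) _ (fun _ => t)).
  - move=> m; have := floor_step t m Ht; lra.
  - have H := is_lim_seq_geom (/ 2).
    have -> : Finite t = Finite (t - 0) by rewrite Rminus_0_r.
    apply: is_lim_seq_minus'; first exact: is_lim_seq_const.
    apply: H; rewrite Rabs_pos_eq; lra.
  - exact: is_lim_seq_const.
Qed.

Lemma semigroup_0 x : SG 0 x = x.
Proof.
  have H0 : 0 <= 0 by lra.
  apply: (tends_unique _ _ _ (semigroup_tends 0 x H0)).
  apply: (tends_ext (fun m => x)); last exact: tends_const.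
  move=> m; rewrite /euler Rmult_0_l.
  have -> : nat_floor 0 = 0%nat.
  { have [H1 _] := nat_floor_spec 0 H0.
    apply: INR_eq; have := pos_INR (nat_floor 0); rewrite [INR 0]/=; lra. }
  by [].
Qed.

Lemma semigroup_lipschitz t x y : 0 <= t -> A x y ->
  norm (minus (SG t x) x) <= t * norm y.
Proof.
  move=> Ht Hxy.
  apply: (tends_le _ _ (fun m => INR (fl t m) * step m * norm y) _
           (tends_minus _ _ _ _ (semigroup_tends t x Ht) (tends_const x))).
  - move=> m; apply: iter_lipschitz => //; exact: step_gt_0.
  - apply: is_lim_seq_mult'; [exact: is_lim_floor|exact: is_lim_seq_const].
Qed.

Lemma semigroup_taylor t x y z : 0 <= t -> A x y -> A y z ->
  norm (minus (minus (SG t x) x) (scal (RtoC t) y)) <= t ^ 2 * norm z.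
Proof.
  move=> Ht Hxy Hyz.
  pose a m := INR (fl t m) * step m.
  have Ha : is_lim_seq a t by exact: is_lim_floor.
  have Hty : tends (fun m => scal (RtoC (a m)) y) (scal (RtoC t) y).
  { apply: (tends_squeeze _ _ (fun m => Rabs (a m - t) * norm y)) => [m|].
    - have -> : minus (scal (RtoC (a m)) y) (scal (RtoC t) y) =
               scal (RtoC (a m - t)) y by vring.
      rewrite norm_scalR; lra.
    - have -> : Finite 0 = Finite (Rabs (t - t) * norm y).
      { by rewrite Rminus_diag Rabs_R0 Rmult_0_l. }
      apply: is_lim_seq_mult'; last exact: is_lim_seq_const.
      apply: (is_lim_seq_abs _ (t - t)); apply: is_lim_seq_minus' => //.
      exact: is_lim_seq_const. }
  apply: (tends_le _ _ (fun m => a m ^ 2 * norm z) _ (tends_minus _ _ _ _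
    (tends_minus _ _ _ _ (semigroup_tends t x Ht) (tends_const x)) Hty)).
  - move=> m; apply: iter_taylor => //; exact: step_gt_0.
  - apply: is_lim_seq_mult'; last exact: is_lim_seq_const.
    rewrite /= Rmult_1_r; apply: (is_lim_seq_ext (fun m => a m * a m)) => [m|].
    + ring.
    + exact: is_lim_seq_mult'.
Qed.

(** At level m the step counts of s and t add up to that of s + t or to one less, so for x in the
    domain the two schemes differ by at most one step, of size 2^-m |y|. Contractivity lets the
    inner scheme be replaced by its limit, and density removes the restriction on x. *)
Lemma semigroup_add s t x : 0 <= s -> 0 <= t -> SG (s + t) x = SG s (SG t x).
Proof.
  move=> Hs Ht; have Hst : 0 <= s + t by lra.
  have dense x' y : A x' y -> SG (s + t) x' = SG s (SG t x').
  { move=> Hxy.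
    apply: (tends_unique (fun m => euler m s (euler m t x'))).
    - have H := semigroup_tends _ x' Hst.
      have Hl : tends (fun m => minus (euler m s (euler m t x')) (euler m (s + t) x')) zero.
      { apply: (tends_squeeze _ _ (fun m => norm y * step m)); last first.
        { exact: is_lim_seq_geom_half. }
        move=> m; rewrite minus_zero_r /euler -iter_add norm_minus_sym.
        have Hm := step_gt_0 m.
        have [F1 F2] := floor_step s m Hs; have [F3 F4] := floor_step t m Ht.
        have [F5 F6] := floor_step _ m Hst.
        move: F1 F2 F3 F4 F5 F6.
        move: (fl s m) (fl t m) (fl (s + t) m) => a b c F1 F2 F3 F4 F5 F6.
        have Hab : (a + b <= c)%nat.
        { suff : (a + b < c + 1)%nat by lia.
          apply: INR_lt; rewrite !plus_INR /=; nra. }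
        have Hc : (c <= a + b + 1)%nat.
        { suff : (c < a + b + 2)%nat by lia.
          apply: INR_lt; rewrite !plus_INR /=; nra. }
        apply: Rle_trans (iter_gap _ _ _ _ _ Hm Hxy Hab) _.
        have := le_INR _ _ Hc; rewrite [INR (_ + 1)]plus_INR [INR 1]/= => Hc'.
        rewrite (Rmult_comm (norm y)); apply: Rmult_le_compat_r; first exact: norm_ge_0.
        nra. }
      have := tends_plus _ _ _ _ H Hl; rewrite plus_zero_r.
      apply: tends_ext => m; vring.
    - have H1 := semigroup_tends _ (SG t x') Hs.
      have H2 := semigroup_tends _ x' Ht.
      apply: (tends_squeeze _ _ (fun m => norm (minus (euler m t x') (SG t x')) +
          norm (minus (euler m s (SG t x')) (SG s (SG t x'))))).
      + move=> m; apply: Rle_trans (dist_triangle (euler m s (SG t x')) _ _) _.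
        have := euler_dist m s (euler m t x') (SG t x'); lra.
      + exact: is_lim_seq_plus0. }
  apply: dist_eq_0; apply: le_epsilon => eps He.
  have [|x' [[y Hxy] D]] := mdiss_dense _ _ HA x (eps / 2); first lra.
  have E := dense _ _ Hxy.
  apply: Rle_trans (dist_triangle (SG (s + t) x') _ _) _.
  have := semigroup_dist (s + t) x x' Hst.
  have := semigroup_dist s (SG t x') (SG t x) Hs; rewrite -E.
  have := semigroup_dist t x' x Ht; rewrite (norm_minus_sym x' x); lra.
Qed.

(** The later time is reached from the earlier one, and the common factor is a contraction; strong
    continuity is thereby reduced to time 0. *)
Lemma semigroup_shift s t x : 0 <= s <= t ->
  norm (minus (SG t x) (SG s x)) <= norm (minus (SG (t - s) x) x).
Proof.
  move=> Hst.
  have {1}-> : t = s + (t - s) by ring.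
  rewrite semigroup_add; [|lra|lra].
  apply: semigroup_dist; lra.
Qed.

Lemma semigroup_cont0 x eps : 0 < eps ->
  exists d, 0 < d /\ forall t, 0 <= t < d -> norm (minus (SG t x) x) < eps.
Proof.
  move=> He.
  have [|x' [[y Hxy] D]] := mdiss_dense _ _ HA x (eps / 3); first lra.
  have Hy := norm_ge_0 y.
  exists (eps / 3 / (norm y + 1)); split; first by apply: Rdiv_lt_0_compat; lra.
  move=> t [Ht Ht'].
  have H1 : t * norm y <= eps / 3.
  { apply: mult_le_of_lt_div; lra. }
  have := semigroup_lipschitz t _ _ Ht Hxy.
  have := dist_triangle (SG t x') (SG t x) x; have := dist_triangle x' (SG t x') x.
  have := semigroup_dist t x x' Ht; rewrite (norm_minus_sym x' x); lra.
Qed.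

(** The second-order estimate holds only on the domain of A^2. The remaining part x - x' lies in the
    domain with small image y - y', so the Lipschitz estimate makes its contribution at most a small
    multiple of t. *)
Lemma semigroup_deriv x y eps : A x y -> 0 < eps ->
  exists d, 0 < d /\ forall t, 0 <= t < d ->
    norm (minus (minus (SG t x) x) (scal (RtoC t) y)) <= eps * t.
Proof.
  move=> Hxy He.
  have [|x' [y' [z [H1 [H2 [D1 D2]]]]]] := core2 x y (eps / 3) _ Hxy; first lra.
  have Hz := norm_ge_0 z.
  exists (eps / 3 / (norm z + 1)); split; first by apply: Rdiv_lt_0_compat; lra.
  move=> t [Ht Ht'].
  have E1 : t * norm z <= eps / 3.
  { apply: mult_le_of_lt_div; lra. }
  have -> : minus (minus (SG t x) x) (scal (RtoC t) y) =
    plus (minus (minus (SG t x') x') (scal (RtoC t) y'))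
      (plus (minus (SG t (minus x x')) (minus x x')) (scal (RtoC t) (minus y' y))).
  { rewrite semigroup_minus //; vring. }
  apply: Rle_trans (norm_triangle _ _) _.
  have T := norm_triangle (minus (SG t (minus x x')) (minus x x')) (scal (RtoC t) (minus y' y)).
  have E2 := semigroup_taylor t _ _ _ Ht H1 H2.
  have E3 := semigroup_lipschitz t _ _ Ht (graph_minus _ _ _ _ _ (mdiss_linear _ _ HA) Hxy H1).
  rewrite norm_scalR Rabs_pos_eq // in T; rewrite (norm_minus_sym y' y) in T.
  have E4 : t ^ 2 * norm z <= eps / 3 * t by nra.
  have E5 : t * norm (minus y y') <= t * (eps / 3) by apply: Rmult_le_compat_l; lra.
  apply: Rle_trans (Rplus_le_compat _ _ _ _ E2 (Rle_trans _ _ _ T (Rplus_le_compat_r _ _ _ E3))) _.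
  lra.
Qed.

(** Surjectivity of 1 - A excludes a proper extension. If x0 - A x0 = x - y, then d = x - x0 is its
    own right derivative under the semigroup; such growth contradicts contractivity unless d = 0. *)
Lemma semigroup_deriv_graph x y :
  (forall eps, 0 < eps -> exists d, 0 < d /\ forall t, 0 <= t < d ->
    norm (minus (minus (SG t x) x) (scal (RtoC t) y)) <= eps * t) -> A x y.
Proof.
  move=> H.
  have [|x0 [y0 [H0 E0]]] := mdiss_range _ _ HA 1 (minus x y); first lra.
  have Ed : minus x x0 = minus y y0.
  { have -> : minus x x0 = plus (minus x y) (minus y x0) by vring.
    rewrite -E0; vring. }
  set d := minus x x0 in Ed.
  have Hd eps : 0 < eps -> norm d <= eps.
  { move=> He.
    have [|d1 [Hd1 D1]] := H (eps / 2); first lra.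
    have [|d2 [Hd2 D2]] := semigroup_deriv _ _ (eps / 2) H0; first lra.
    pose t := Rmin d1 d2 / 2.
    have Hm : 0 < Rmin d1 d2 by apply: Rmin_pos.
    have Ht : 0 < t by rewrite /t; lra.
    have {}D1 := D1 t (conj (Rlt_le _ _ Ht) _).
    have {}D1 := D1 ltac:(have := Rmin_l d1 d2; rewrite /t; lra).
    have {}D2 := D2 t (conj (Rlt_le _ _ Ht) _).
    have {}D2 := D2 ltac:(have := Rmin_r d1 d2; rewrite /t; lra).
    (* Taking norms gives (1 + t) |d| <= |d| + eps t, hence |d| <= eps. *)
    have E : scal (RtoC (1 + t)) d =
      plus (SG t d) (minus (minus (minus (SG t x0) x0) (scal (RtoC t) y0))
        (minus (minus (SG t x) x) (scal (RtoC t) y))).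
    { have -> : scal (RtoC (1 + t)) d = plus d (scal (RtoC t) (minus y y0)).
      { rewrite -Ed; vring. }
      rewrite /d semigroup_minus; last lra. vring. }
    have := norm_triangle (SG t d) (minus (minus (minus (SG t x0) x0) (scal (RtoC t) y0))
        (minus (minus (SG t x) x) (scal (RtoC t) y))).
    rewrite -E norm_scalR Rabs_pos_eq; last lra.
    have := dist_triangle zero (minus (minus (SG t x0) x0) (scal (RtoC t) y0))
       (minus (minus (SG t x) x) (scal (RtoC t) y)).
    rewrite minus_zero_r (norm_minus_sym zero) minus_zero_r.
    have := semigroup_le t d (Rlt_le _ _ Ht).
    move=> ? ? ?; apply: (Rmult_le_reg_l t) => //; lra. }
  have Hd0 : d = zero.
  { have N0 : norm d <= 0 by apply: le_epsilon => eps He; have := Hd _ He; lra.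
    apply: dist_eq_0; by rewrite minus_zero_r. }
  have -> : x = x0.
  { have -> : x = plus d x0 by (rewrite /d; vring).
    by rewrite Hd0 plus_zero_l. }
  have -> : y = y0.
  { have -> : y = plus (minus y y0) y0 by vring.
    by rewrite -Ed Hd0 plus_zero_l. }
  exact: H0.
Qed.

End Contraction.

(** * The Hille-Yosida theorem *)

Section EpsDelta.
Context {X : NormedModule C_AbsRing}.

Lemma locallyP (P : R -> Prop) x :
  locally x P <-> exists d, 0 < d /\ forall y, Rabs (y - x) < d -> P y.
Proof.
  split=> [[[d Hd] H]|[d [Hd H]]].
  - exists d; split=> // y Hy; exact: H.
  - exists (mkposreal d Hd) => y Hy; exact: H.
Qed.

Lemma filterlim_withinP (D : R -> Prop) (f : R -> X) (x : R) (l : X) :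
  filterlim f (within D (locally x)) (locally l) <->
  (forall eps, 0 < eps -> exists d, 0 < d /\
     forall y, Rabs (y - x) < d -> D y -> norm (minus (f y) l) < eps).
Proof.
  have FF : Filter (within D (locally x)) by apply: within_filter.
  rewrite filterlim_locally_ball_norm; split=> H.
  - move=> eps He; exact: (proj1 (locallyP _ _) (H (mkposreal eps He))).
  - move=> [eps He]; apply: (proj2 (locallyP _ _)); exact: H.
Qed.

Lemma continuous_on_normP (D : R -> Prop) (f : R -> X) :
  continuous_on D f <->
  (forall t, D t -> forall eps, 0 < eps -> exists d, 0 < d /\
     forall s, Rabs (s - t) < d -> D s -> norm (minus (f s) (f t)) < eps).
Proof. by split=> H t Ht; apply/filterlim_withinP; apply: H. Qed.

(** The difference quotient cleared of its denominator, which makes [t = 0] harmless and lets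
    estimates be added and composed with linear maps. *)
Definition right_deriv (F : R -> X) (y : X) : Prop :=
  forall eps, 0 < eps -> exists d, 0 < d /\ forall t, 0 <= t < d ->
    norm (minus (minus (F t) (F 0)) (scal (RtoC t) y)) <= eps * t.

Lemma norm_diff_quotient (h : R) (d l : X) : h <> 0 ->
  norm (minus d (scal (RtoC h) l)) = Rabs h * norm (minus (scal (RtoC (/ h)) d) l).
Proof. move=> Hh; rewrite -norm_scalR; congr norm; vring. Qed.

Lemma generatorP (S : R -> X -> X) x y : S 0 x = x ->
  generator S x y <-> right_deriv (fun t => S t x) y.
Proof.
  move=> S0; rewrite /generator filterlim_withinP; split=> H eps He.
  - have [d [Hd Hs]] := H _ He.
    exists d; split=> // t [[Ht|<-] Ht'].
    + rewrite S0 norm_diff_quotient; last lra.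
      rewrite Rabs_pos_eq; last lra.
      rewrite Rmult_comm; apply: Rmult_le_compat_r; first lra.
      apply: Rlt_le; apply: Hs => //; rewrite Rminus_0_r Rabs_pos_eq; lra.
    + rewrite [X in norm X](_ : _ = zero); last by vring.
      rewrite norm_zero; lra.
  - have [|d [Hd Hs]] := H (eps / 2); first lra.
    exists d; split=> // t; rewrite Rminus_0_r => Ht Ht0.
    rewrite Rabs_pos_eq in Ht; last lra.
    have := Hs t (conj (Rlt_le _ _ Ht0) Ht).
    rewrite S0 norm_diff_quotient; last lra.
    rewrite Rabs_pos_eq; last lra.
    rewrite (Rmult_comm (eps / 2)) => /(Rmult_le_reg_l _ _ _ Ht0) Hq.
    apply: Rle_lt_trans Hq _; lra.
Qed.

Lemma is_deriv_XP (Phi : R -> X) t l :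
  is_deriv_X Phi t l <->
  (forall eps, 0 < eps -> exists d, 0 < d /\ forall h, Rabs h < d ->
     norm (minus (minus (Phi (t + h)) (Phi t)) (scal (RtoC h) l)) <= eps * Rabs h).
Proof.
  rewrite /is_deriv_X filterlim_withinP; split=> H eps He.
  - have [d [Hd Hs]] := H _ He.
    exists d; split=> // h Hh; case: (Req_dec h 0) => [->|Hh0].
    + rewrite Rplus_0_r [X in norm X](_ : _ = zero); last by vring.
      rewrite norm_zero Rabs_R0; lra.
    + rewrite norm_diff_quotient // Rmult_comm.
      apply: Rmult_le_compat_r; first exact: Rabs_pos.
      apply: Rlt_le; apply: Hs => //; by rewrite Rminus_0_r.
  - have [|d [Hd Hs]] := H (eps / 2); first lra.
    exists d; split=> // h; rewrite Rminus_0_r => Hh Hh0.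
    have := Hs h Hh; rewrite norm_diff_quotient //.
    rewrite (Rmult_comm (eps / 2)).
    move=> /(Rmult_le_reg_l _ _ _ (Rabs_pos_lt _ Hh0)) Hq.
    apply: Rle_lt_trans Hq _; lra.
Qed.

End EpsDelta.

Lemma exp_deriv_eps (w eps : R) : 0 < eps ->
  exists d, 0 < d /\ forall t, Rabs t < d -> Rabs (exp (w * t) - 1 - w * t) <= eps * Rabs t.
Proof.
  move=> He.
  have H : is_derive (fun t => exp (w * t)) 0 w.
  { auto_derive => //; rewrite Rmult_0_r exp_0; ring. }
  move/is_derive_Reals: H => /(_ eps He) [[d Hd] Hs].
  exists d; split=> // t Ht; case: (Req_dec t 0) => [->|Ht0].
  - rewrite !Rmult_0_r exp_0 Rabs_R0 Rmult_0_r Rminus_diag Rminus_0_r Rabs_R0; lra.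
  - have := Hs t Ht0 Ht; rewrite Rplus_0_l Rmult_0_r exp_0 => H.
    have -> : exp (w * t) - 1 - w * t = t * ((exp (w * t) - 1) / t - w) by field.
    rewrite Rabs_mult Rmult_comm; apply: Rmult_le_compat_r; [exact: Rabs_pos|lra].
Qed.

Lemma exp_cont_eps (w t eps : R) : 0 < eps ->
  exists d, 0 < d /\ forall s, Rabs (s - t) < d -> Rabs (exp (w * s) - exp (w * t)) < eps.
Proof.
  move=> He.
  have H : continuous (fun s => exp (w * s)) t.
  { apply: ex_derive_continuous; auto_derive => //. }
  have [d [Hd Hs]] := proj1 (locallyP _ _)
    (H _ (locally_ball (exp (w * t)) (mkposreal eps He))).
  exists d; split=> // s Hst; exact: Hs.
Qed.

(** * Exponential rescaling *)

Section Rescaling.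
Context {X : NormedModule C_AbsRing}.

(** Product rule: with e = exp(wt) the error splits into e (F(t) - F(0) - t y), (e - 1) t y and (e -
    1 - wt) F(0), each at most eps t / 3. *)
Lemma right_deriv_exp (w : R) (F : R -> X) y : right_deriv F y ->
  right_deriv (fun t => scal (RtoC (exp (w * t))) (F t)) (plus y (scal (RtoC w) (F 0))).
Proof.
  move=> HF eps He.
  have [|d1 [Hd1 D1]] := HF (eps / 6); first lra.
  have Hy := norm_ge_0 y; have Hx := norm_ge_0 (F 0).
  have [|d2 [Hd2 D2]] := exp_deriv_eps w (eps / 3 / (norm (F 0) + 1)).
  { apply: Rdiv_lt_0_compat; lra. }
  (* The bound 1 forces e <= 2, which accounts for the eps/6 asked of F above. *)
  have [|d3 [Hd3 D3]] := exp_cont_eps w 0 (Rmin 1 (eps / 3 / (norm y + 1))).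
  { apply: Rmin_pos; first lra. apply: Rdiv_lt_0_compat; lra. }
  exists (Rmin d1 (Rmin d2 d3)); split; first by do ?apply: Rmin_pos.
  move=> t [Ht Ht'].
  have {}D1 := D1 t (conj Ht (Rlt_le_trans _ _ _ Ht' (Rmin_l _ _))).
  have Ht2 : t < d2.
  { apply: Rlt_le_trans Ht' _; apply: Rle_trans (Rmin_r _ _) (Rmin_l _ _). }
  have Ht3 : t < d3.
  { apply: Rlt_le_trans Ht' _; apply: Rle_trans (Rmin_r _ _) (Rmin_r _ _). }
  have {}D2 := D2 t; rewrite Rabs_pos_eq // in D2; have {}D2 := D2 Ht2.
  have {}D3 := D3 t; rewrite Rminus_0_r Rabs_pos_eq // Rmult_0_r exp_0 in D3.
  have {}D3 := D3 Ht3.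
  set e := exp (w * t) in D2 D3 *.
  have E1 : Rabs (e - 1) < 1 by apply: Rlt_le_trans D3 (Rmin_l _ _).
  have E2 : Rabs (e - 1) < eps / 3 / (norm y + 1) by apply: Rlt_le_trans D3 (Rmin_r _ _).
  have He0 : 0 < e by apply: exp_pos.
  have He2 : e <= 2 by have := Rle_abs (e - 1); lra.
  rewrite Rmult_0_r exp_0.
  have -> : minus (minus (scal (RtoC e) (F t)) (scal (RtoC 1) (F 0)))
      (scal (RtoC t) (plus y (scal (RtoC w) (F 0)))) =
    plus (scal (RtoC e) (minus (minus (F t) (F 0)) (scal (RtoC t) y)))
     (plus (scal (RtoC ((e - 1) * t)) y) (scal (RtoC (e - 1 - w * t)) (F 0))) by vring.
  apply: Rle_trans (norm_triangle _ _) _.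
  have T := norm_triangle (scal (RtoC ((e - 1) * t)) y) (scal (RtoC (e - 1 - w * t)) (F 0)).
  apply: Rle_trans (Rplus_le_compat_l _ _ _ T) _.
  rewrite !norm_scalR Rabs_mult (Rabs_pos_eq t) // (Rabs_pos_eq e); last lra.
  have B1 : Rabs (e - 1) * norm y <= eps / 3.
  { apply: mult_le_of_lt_div; [lra|done|split=> //; exact: Rabs_pos]. }
  have B2 : Rabs (e - 1 - w * t) * norm (F 0) <= eps / 3 * t.
  { apply: Rle_trans (Rmult_le_compat_r _ _ _ Hx D2) _.
    have : eps / 3 / (norm (F 0) + 1) * norm (F 0) <= eps / 3.
    { have {2}<- : eps / 3 / (norm (F 0) + 1) * (norm (F 0) + 1) = eps / 3 by field; lra.
      apply: Rmult_le_compat_l; last lra.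
      apply: Rlt_le; apply: Rdiv_lt_0_compat; lra. }
    nra. }
  have B3 : e * norm (minus (minus (F t) (F 0)) (scal (RtoC t) y)) <= 2 * (eps / 6 * t).
  { apply: Rmult_le_compat => //; [lra|exact: norm_ge_0]. }
  nra.
Qed.

End Rescaling.

Section HilleYosida.
Context {X : NormedModule C_AbsRing}.

Lemma m_dissipative_shift w (B : X -> X -> Prop) : m_dissipative w B ->
  m_dissipative 0 (fun x y => B x (plus y (scal (RtoC w) x))).
Proof.
  move=> [[Badd Bscal] Bdiss Brange Bdense]; split.
  - split=> [x y x' y' H H'|c x y H].
    + have -> : plus (plus y y') (scal (RtoC w) (plus x x')) =
        plus (plus y (scal (RtoC w) x)) (plus y' (scal (RtoC w) x')) by vring.
      exact: Badd.
    + have -> : plus (scal c y) (scal (RtoC w) (scal c x)) =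
        scal c (plus y (scal (RtoC w) x)) by vring.
      exact: Bscal.
  - move=> l x y Hl H.
    have := Bdiss (l + w) _ _ _ H.
    have -> : minus (scal (RtoC (l + w)) x) (plus y (scal (RtoC w) x)) =
      minus (scal (RtoC l) x) y by vring.
    have -> : l + w - w = l - 0 by ring.
    apply; lra.
  - move=> l f Hl.
    have [|x [y [H E]]] := Brange (l + w) f; first lra.
    exists x, (minus y (scal (RtoC w) x)); split.
    + by have -> : plus (minus y (scal (RtoC w) x)) (scal (RtoC w) x) = y by vring.
    + rewrite -E; vring.
  - move=> x eps He; have [x' [[y H] D]] := Bdense x eps He.
    exists x'; split=> //; exists (minus y (scal (RtoC w) x')).
    by have -> : plus (minus y (scal (RtoC w) x')) (scal (RtoC w) x') = y by vring.
Qed.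

(** S(t) = exp(wt) T(t), where T is the contraction semigroup of B - w. *)
Theorem hille_yosida w (B : X -> X -> Prop) : cauchy_complete X -> m_dissipative w B ->
  exists S : R -> X -> X, C0_semigroup S /\ generates B S /\
    forall t x, 0 <= t -> norm (S t x) <= exp (w * t) * norm x.
Proof.
  move=> HX HB; have HA := m_dissipative_shift _ _ HB.
  set A := (fun x y => _) in HA.
  pose T := semigroup HX A HA.
  pose S t x := scal (RtoC (exp (w * t))) (T t x).
  have Sle t x : 0 <= t -> norm (S t x) <= exp (w * t) * norm x.
  { move=> Ht; rewrite /S norm_scalR Rabs_pos_eq; last by apply: Rlt_le (exp_pos _).
    apply: Rmult_le_compat_l; first by apply: Rlt_le (exp_pos _).
    exact: semigroup_le. }
  have S0 x : S 0 x = x.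
  { rewrite /S /T semigroup_0 Rmult_0_r exp_0; vring. }
  exists S; split; [split; [|split; [|split]]|split] => //.
  - move=> t Ht; split.
    + move=> x y; rewrite /S /T semigroup_plus //; vring.
    + move=> c x; rewrite /S /T semigroup_scal //.
      change (scal (RtoC (exp (w * t))) (scal c (semigroup HX A HA t x)) =
              scal c (scal (RtoC (exp (w * t))) (semigroup HX A HA t x))).
      vring.
    + exists (exp (w * t)); split; first exact: exp_pos.
      move=> x; exact: Sle.
  - move=> s t x Hs Ht; rewrite /S /T semigroup_add //.
    rewrite semigroup_scal // Rmult_plus_distr_l exp_plus; vring.
  - move=> x; apply/continuous_on_normP => t Ht eps He.
    have [|d1 [Hd1 D1]] := semigroup_cont0 HX A HA x (eps / 2 / (exp (w * t) + 1)).
    { apply: Rdiv_lt_0_compat; have := exp_pos (w * t); lra. }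
    have Hx := norm_ge_0 x.
    have [|d2 [Hd2 D2]] := exp_cont_eps w t (eps / 2 / (norm x + 1)).
    { apply: Rdiv_lt_0_compat; lra. }
    exists (Rmin d1 d2); split; first exact: Rmin_pos.
    move=> s Hst Hs.
    have {}D2 := D2 s (Rlt_le_trans _ _ _ Hst (Rmin_r _ _)).
    have Hst1 := Rlt_le_trans _ _ _ Hst (Rmin_l _ _).
    have H1 : norm (minus (T s x) (T t x)) < eps / 2 / (exp (w * t) + 1).
    { case: (Rle_dec s t) => Hle.
      - rewrite norm_minus_sym.
        apply: Rle_lt_trans (semigroup_shift HX A HA _ _ _ (conj Hs Hle)) (D1 _ _).
        move: Hst1; rewrite -Rabs_Ropp Rabs_pos_eq; lra.
      - have Hle' : 0 <= t <= s by lra.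
        apply: Rle_lt_trans (semigroup_shift HX A HA _ _ _ Hle') (D1 _ _).
        move: Hst1; rewrite Rabs_pos_eq; lra. }
    have -> : minus (S s x) (S t x) =
      plus (scal (RtoC (exp (w * s) - exp (w * t))) (T s x))
           (scal (RtoC (exp (w * t))) (minus (T s x) (T t x))) by (rewrite /S; vring).
    apply: Rle_lt_trans (norm_triangle _ _) _.
    rewrite !norm_scalR (Rabs_pos_eq (exp _)); last by apply: Rlt_le (exp_pos _).
    have B1 : Rabs (exp (w * s) - exp (w * t)) * norm (T s x) <= eps / 2.
    { apply: Rle_trans (_ : _ <= Rabs (exp (w * s) - exp (w * t)) * norm x) _.
      - apply: Rmult_le_compat_l; [exact: Rabs_pos|exact: semigroup_le].
      - apply: mult_le_of_lt_div => //; [lra|split=> //; exact: Rabs_pos]. }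
    have Het := exp_pos (w * t).
    have B2 : exp (w * t) * norm (minus (T s x) (T t x)) < eps / 2.
    { have E : eps / 2 / (exp (w * t) + 1) * (exp (w * t) + 1) = eps / 2 by field; lra.
      have P : 0 < eps / 2 / (exp (w * t) + 1) by apply: Rdiv_lt_0_compat; lra.
      have := norm_ge_0 (minus (T s x) (T t x)); nra. }
    lra.
  - move=> x y.
    have AE : B x y <-> A x (minus y (scal (RtoC w) x)).
    { by rewrite /A; have -> : plus (minus y (scal (RtoC w) x)) (scal (RtoC w) x) = y by vring. }
    rewrite AE generatorP //; split=> H.
    + have H1 : right_deriv (fun t => T t x) (minus y (scal (RtoC w) x)).
      { move=> eps He; have [d [Hd D]] := semigroup_deriv HX A HA _ _ _ H He.
        exists d; split=> // t Ht; rewrite [T 0 x]semigroup_0; exact: D. }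
      have := right_deriv_exp w _ _ H1; rewrite [T 0 x]semigroup_0.
      by have -> : plus (minus y (scal (RtoC w) x)) (scal (RtoC w) x) = y by vring.
    (* T(t) x = exp(-wt) S(t) x, so the converse is the same product rule with -w. *)
    + apply: (semigroup_deriv_graph HX A HA) => eps He.
      have [d [Hd D]] := right_deriv_exp (- w) _ _ H eps He.
      exists d; split=> // t Ht; have := D t Ht.
      rewrite Rmult_0_r exp_0 S0.
      have -> : scal (RtoC (exp (- w * t))) (S t x) = T t x.
      { rewrite /S.
        have E : exp (- w * t) * exp (w * t) = 1.
        { rewrite -exp_plus -exp_0; congr exp; ring. }
        have -> : scal (RtoC (exp (- w * t))) (scal (RtoC (exp (w * t))) (T t x)) =
          scal (RtoC (exp (- w * t) * exp (w * t))) (T t x) by vring.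
        rewrite E; vring. }
      have -> : scal (RtoC 1) x = x by vring.
      by have -> : plus y (scal (RtoC (- w)) x) = minus y (scal (RtoC w) x) by vring.
Qed.

End HilleYosida.

(** * Bounded perturbations and closures *)

Lemma linear_minus {X Y : NormedModule C_AbsRing} (L : X -> Y) x y :
  is_linear L -> L (minus x y) = minus (L x) (L y).
Proof.
  move=> HL.
  have -> : minus x y = plus x (scal (RtoC (-1)) y) by vring.
  rewrite (linear_plus _ HL) (linear_scal _ HL); vring.
Qed.

(** * The operator norm *)

Section OpNorm.
Context {X : NormedModule C_AbsRing}.

(** [op_norm] takes the real part of a least upper bound in the extended reals. The bound M excludes
    plus infinity and the value at [zero] excludes minus infinity, so nothing is lost. *)
Lemma op_norm_bounds (L : X -> X) M : 0 <= M -> (forall x, norm (L x) <= M * norm x) ->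
  0 <= op_norm L <= M /\ forall x, norm x <= 1 -> norm (L x) <= op_norm L.
Proof.
  move=> HM H; rewrite /op_norm; set E := fun r => _.
  have E0 : E (norm (L zero)) by exists zero; rewrite norm_zero; split=> //; lra.
  have N0 := norm_ge_0 (L zero).
  have UB x : norm x <= 1 -> norm (L x) <= M.
  { move=> Hx; apply: Rle_trans (H x) _; nra. }
  have [Hub Hlub] := Lub_Rbar_correct E.
  have HlM : Rbar_le (Lub_Rbar E) M.
  { by apply: Hlub => r [x [Hx ->]]; apply: UB. }
  have H0 := Hub _ E0.
  case EL : (Lub_Rbar E) HlM H0 Hub => [l||] //= HlM H0 Hub.
  split; first lra.
  by move=> x Hx; apply: (Hub (norm (L x))); exists x.
Qed.

Lemma op_norm_ge_0 (L : X -> X) : is_linear L -> 0 <= op_norm L.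
Proof.
  move=> HL; have [M [HM H]] := linear_norm _ HL.
  have [[H0 _] _] := op_norm_bounds L M (Rlt_le _ _ HM) H; exact: H0.
Qed.

Lemma op_norm_le (L : X -> X) x : is_linear L -> norm (L x) <= op_norm L * norm x.
Proof.
  move=> HL; have [M [HM H]] := linear_norm _ HL.
  have [_ HO] := op_norm_bounds L M (Rlt_le _ _ HM) H.
  case: (Req_dec (norm x) 0) => [E|Hx].
  - have := H x; rewrite E !Rmult_0_r //.
  - have Hx0 : 0 < norm x by have := norm_ge_0 x; lra.
    have Hi := Rinv_0_lt_compat _ Hx0.
    have := HO (scal (RtoC (/ norm x)) x).
    rewrite (linear_scal _ HL) !norm_scalR Rabs_pos_eq; last lra.
    rewrite Rinv_l // => /(_ (Rle_refl 1)) H1.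
    have := Rmult_le_compat_r _ _ _ (Rlt_le _ _ Hx0) H1.
    have -> : / norm x * norm (L x) * norm x = norm (L x) by field; lra.
    done.
Qed.

End OpNorm.

Lemma complete_normed_cauchy (X : CompleteNormedModule C_AbsRing) : cauchy_complete X.
Proof.
  move=> u Hu.
  have [|l Hl] := proj1 (filterlim_locally_cauchy (F := eventually) u).
  { move=> eps; have [N HN] := Hu eps (cond_pos eps).
    exists (fun n => (N <= n)%nat); split; first by exists N.
    move=> n m Hn Hm; apply: norm_compat1; exact: HN. }
  exists l; apply/is_lim_seq_spec => eps.
  have [N HN] := proj1 (filterlim_locally_ball_norm _ _) Hl eps.
  exists N => n Hn; rewrite Rminus_0_r Rabs_pos_eq; [exact: HN|exact: norm_ge_0].
Qed.

Section Product.
Context {U V : NormedModule C_AbsRing}.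

Lemma norm_fst_le (x : prod_NormedModule C_AbsRing U V) : norm (fst x) <= norm x.
Proof.
  rewrite -(sqrt_Rsqr _ (norm_ge_0 (fst x))); apply: sqrt_le_1_alt.
  rewrite /Rsqr; have := pow2_ge_0 (norm (snd x)); lra.
Qed.

Lemma norm_snd_le (x : prod_NormedModule C_AbsRing U V) : norm (snd x) <= norm x.
Proof.
  rewrite -(sqrt_Rsqr _ (norm_ge_0 (snd x))); apply: sqrt_le_1_alt.
  rewrite /Rsqr; have := pow2_ge_0 (norm (fst x)); lra.
Qed.

Lemma norm_pair_le (x : prod_NormedModule C_AbsRing U V) :
  norm x <= norm (fst x) + norm (snd x).
Proof.
  have H1 := norm_ge_0 (fst x); have H2 := norm_ge_0 (snd x).
  rewrite -(sqrt_Rsqr (norm (fst x) + norm (snd x))); last lra.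
  apply: sqrt_le_1_alt; rewrite /Rsqr; nra.
Qed.

Lemma cauchy_complete_prod :
  cauchy_complete U -> cauchy_complete V -> cauchy_complete (prod_NormedModule C_AbsRing U V).
Proof.
  move=> HU HV u Hu.
  have [|l1 H1] := HU (fun n => fst (u n)).
  { move=> eps He; have [N HN] := Hu eps He; exists N => n m Hn Hm.
    exact: Rle_lt_trans (norm_fst_le (minus (u n) (u m))) (HN _ _ Hn Hm). }
  have [|l2 H2] := HV (fun n => snd (u n)).
  { move=> eps He; have [N HN] := Hu eps He; exists N => n m Hn Hm.
    exact: Rle_lt_trans (norm_snd_le (minus (u n) (u m))) (HN _ _ Hn Hm). }
  exists (l1, l2).
  apply: (tends_squeeze _ _ _ _ (is_lim_seq_plus0 _ _ H1 H2)) => n.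
  exact: (norm_pair_le (minus (u n) (l1, l2))).
Qed.

End Product.

Section Perturbation.
Context {X : NormedModule C_AbsRing} (HX : cauchy_complete X).

(** (l - B)^-1 is Lipschitz with constant 1/(l - w), so x -> (l - B)^-1 (f + L x) contracts with
    ratio q = M/(l - w), which is below 1 for l > w + M. Its fixed point solves (l - B - L) x =
    f. *)
Lemma m_dissipative_perturb w M (B : X -> X -> Prop) (L : X -> X) :
  m_dissipative w B -> is_linear L -> 0 <= M -> (forall x, norm (L x) <= M * norm x) ->
  m_dissipative (w + M) (graph_plus B L).
Proof.
  move=> [Blin Bdiss Brange Bdense] HL HM LM; split.
  - split=> [x y x' y' [z [H ->]] [z' [H' ->]]|c x y [z [H ->]]].
    + exists (plus z z'); split; first exact: graph_add.
      rewrite (linear_plus _ HL); vring.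
    + exists (scal c z); split; first exact: graph_scal.
      rewrite (linear_scal _ HL); vring.
  - move=> l x y Hl [z [H ->]].
    have := Bdiss l _ _ _ H => /(_ ltac:(lra)) H1.
    have := norm_le_dist (minus (scal (RtoC l) x) z) (minus (scal (RtoC l) x) (plus z (L x))).
    rewrite [X in _ + norm X](_ : _ = L x); last by vring.
    have := LM x; lra.
  - move=> l f Hl; have Hl' : w < l by lra.
    pose r g := proj1_sig (constructive_indefinite_description _ (Brange l g Hl')).
    have Hr g : B (r g) (minus (scal (RtoC l) (r g)) g).
    { have [y [H E]] := proj2_sig (constructive_indefinite_description _ (Brange l g Hl')).
      rewrite -/(r g) in H E; suff <- : y = minus (scal (RtoC l) (r g)) g by [].
      transitivity (minus (scal (RtoC l) (r g)) (minus (scal (RtoC l) (r g)) y)).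
      - vring.
      - by rewrite E. }
    have Hd : 0 < l - w by lra.
    have Lip g g' : (l - w) * norm (minus (r g) (r g')) <= norm (minus g g').
    { have := Bdiss l _ _ Hl' (graph_minus _ _ _ _ _ Blin (Hr g) (Hr g')).
      rewrite [X in _ <= norm X](_ : _ = minus g g') //; vring. }
    pose q := M / (l - w).
    have Hq : 0 <= q < 1.
    { split; first by apply: Rdiv_le_0_compat.
      apply: (Rmult_lt_reg_r (l - w)) => //.
      have -> : q * (l - w) = M by rewrite /q; field; lra.
      lra. }
    pose F x := r (plus f (L x)).
    have HF x x' : norm (minus (F x) (F x')) <= q * norm (minus x x').
    { apply: (Rmult_le_reg_l (l - w)) => //.
      apply: Rle_trans (Lip _ _) _.
      rewrite [X in norm X](_ : _ = minus (L x) (L x')); last by vring.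
      rewrite -linear_minus //.
      have -> : (l - w) * (q * norm (minus x x')) = M * norm (minus x x').
      { rewrite /q; field; lra. }
      exact: LM. }
    pose u n := Nat.iter n F zero.
    have [||n|x Hx] := cauchy_complete_geom u (norm (minus (u 1%nat) (u 0%nat))) q HX.
    + exact: norm_ge_0.
    + exact: Hq.
    + elim: n => [|n IH]; first by rewrite /=; lra.
      apply: Rle_trans (HF (u (S n)) (u n)) _; rewrite [q ^ S n]/=; nra.
    + have Ex : x = F x.
      { apply: (tends_unique (fun n => u (S n))).
        - exact: (proj1 (is_lim_seq_incr_1 _ _) Hx).
        - apply: (tends_squeeze _ _ _ _ (is_lim_seq_scal0 _ q Hx)) => n.
          exact: HF. }
      exists x, (plus (minus (scal (RtoC l) x) (plus f (L x))) (L x)); split.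
      * exists (minus (scal (RtoC l) x) (plus f (L x))); split=> //.
        have := Hr (plus f (L x)); by rewrite -/(F x) -Ex.
      * vring.
  - move=> x eps He; have [x' [[y H] D]] := Bdense x eps He.
    by exists x'; split=> //; exists (plus y (L x')), y.
Qed.

Lemma graph_closureP (A : X -> X -> Prop) x y :
  graph_closure A x y <->
  exists u v, tends u x /\ tends v y /\ forall n, A (u n) (v n).
Proof.
  split=> [H|[u [v [Hu [Hv HA]]]] eps He].
  - have Hn n : exists p, A (fst p) (snd p) /\ norm (minus x (fst p)) < (/ 2) ^ n /\
        norm (minus y (snd p)) < (/ 2) ^ n.
    { have [|x' [y' [H1 [H2 H3]]]] := H ((/ 2) ^ n); first by apply: pow_lt; lra.
      by exists (x', y'). }
    pose p n := proj1_sig (constructive_indefinite_description _ (Hn n)).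
    have Hp n := proj2_sig (constructive_indefinite_description _ (Hn n)).
    have Hg := is_lim_seq_geom_half 1.
    exists (fun n => fst (p n)), (fun n => snd (p n)); split; [|split].
    + apply: (tends_squeeze _ _ _ _ Hg) => n; rewrite norm_minus_sym.
      have [_ [H1 _]] := Hp n; rewrite -/(p n) in H1; lra.
    + apply: (tends_squeeze _ _ _ _ Hg) => n; rewrite norm_minus_sym.
      have [_ [_ H1]] := Hp n; rewrite -/(p n) in H1; lra.
    + by move=> n; case: (Hp n).
  - have [N1 H1] := tends_eventually _ _ _ Hu He.
    have [N2 H2] := tends_eventually _ _ _ Hv He.
    exists (u (N1 + N2)%nat), (v (N1 + N2)%nat); split=> //; split.
    + rewrite norm_minus_sym; apply: H1; lia.
    + rewrite norm_minus_sym; apply: H2; lia.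
Qed.

Lemma graph_closure_incl (A : X -> X -> Prop) x y : A x y -> graph_closure A x y.
Proof.
  move=> H eps He; exists x, y; split=> //; by rewrite !minus_eq_zero !norm_zero.
Qed.

Lemma linear_graph_closure (A : X -> X -> Prop) :
  linear_graph A -> linear_graph (graph_closure A).
Proof.
  move=> HA; split.
  - move=> x y x' y' /graph_closureP [u [v [Hu [Hv H]]]] /graph_closureP [u' [v' [Hu' [Hv' H']]]].
    apply/graph_closureP; exists (fun n => plus (u n) (u' n)), (fun n => plus (v n) (v' n)).
    split; [exact: tends_plus|split; first exact: tends_plus].
    by move=> n; apply: graph_add.
  - move=> c x y /graph_closureP [u [v [Hu [Hv H]]]].
    apply/graph_closureP; exists (fun n => scal c (u n)), (fun n => scal c (v n)).
    split; [exact: tends_scal|split; first exact: tends_scal].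
    by move=> n; apply: graph_scal.
Qed.

Lemma dissipative_closure w (A : X -> X -> Prop) :
  dissipative w A -> dissipative w (graph_closure A).
Proof.
  move=> HA l x y Hl /graph_closureP [u [v [Hu [Hv H]]]].
  apply: (is_lim_seq_le_real (fun n => (l - w) * norm (u n))
           (fun n => norm (minus (scal (RtoC l) (u n)) (v n)))).
  - move=> n; exact: HA.
  - apply: is_lim_seq_mult'; [exact: is_lim_seq_const|exact: tends_norm].
  - apply: tends_norm; apply: tends_minus => //; exact: tends_scal.
Qed.

(** Dissipativity makes the preimages of a convergent sequence Cauchy; completeness provides their
    limit, and the limit pair belongs to the closed graph. *)
Lemma range_closure w l (A : X -> X -> Prop) : linear_graph A -> dissipative w A -> w < l ->
  forall u f, tends u f ->
    (forall n, exists x y, graph_closure A x y /\ minus (scal (RtoC l) x) y = u n) ->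
    exists x y, graph_closure A x y /\ minus (scal (RtoC l) x) y = f.
Proof.
  move=> Alin Adiss Hl f0 f Hf H.
  have Clin := linear_graph_closure _ Alin; have Cdiss := dissipative_closure _ _ Adiss.
  pose xs n := proj1_sig (constructive_indefinite_description _ (H n)).
  have Hxs n : graph_closure A (xs n) (minus (scal (RtoC l) (xs n)) (f0 n)).
  { have [y [Hy E]] := proj2_sig (constructive_indefinite_description _ (H n)).
    rewrite -/(xs n) in Hy E; rewrite -E.
    by have -> : minus (scal (RtoC l) (xs n)) (minus (scal (RtoC l) (xs n)) y) = y by vring. }
  have Hd : 0 < l - w by lra.
  have [|x Hx] := HX xs.
  { move=> eps He.
    have [|N HN] := tends_cauchy _ _ Hf (eps * (l - w)); first nra.
    exists N => n m Hn Hm.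
    have := Cdiss l _ _ Hl (graph_minus _ _ _ _ _ Clin (Hxs n) (Hxs m)).
    rewrite [X in _ <= norm X](_ : _ = minus (f0 n) (f0 m)); last by vring.
    move=> H1; have := Rle_lt_trans _ _ _ H1 (HN _ _ Hn Hm).
    rewrite (Rmult_comm (l - w)) => /Rmult_lt_reg_r; exact. }
  exists x, (minus (scal (RtoC l) x) f); split; last by vring.
  have Hy : tends (fun n => minus (scal (RtoC l) (xs n)) (f0 n)) (minus (scal (RtoC l) x) f).
  { apply: tends_minus => //; exact: tends_scal. }
  move=> eps He.
  have [N1 H1] := tends_eventually _ _ (eps / 2) Hx ltac:(lra).
  have [N2 H2] := tends_eventually _ _ (eps / 2) Hy ltac:(lra).
  pose n := (N1 + N2)%nat.
  have {}H1 : norm (minus (xs n) x) < eps / 2 by apply: H1; rewrite /n; lia.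
  have {}H2 := H2 n ltac:(rewrite /n; lia).
  have [|x' [y' [HA' [D1 D2]]]] := Hxs n (eps / 2); first lra.
  exists x', y'; split=> //; split.
  - have := dist_triangle (xs n) x x'; rewrite (norm_minus_sym x (xs n)); lra.
  - apply: Rle_lt_trans (dist_triangle (minus (scal (RtoC l) (xs n)) (f0 n)) _ _) _.
    rewrite norm_minus_sym in H2; lra.
Qed.

End Perturbation.

(** * The Cauchy problem *)

(** A 1-Lipschitz retraction onto [a,b]. Composing with it turns continuity on the interval into
    continuity on R, the form in which real analysis theorems take it. *)
Definition clamp (a b x : R) : R := Rmax a (Rmin b x).

Lemma clamp_in a b x : a <= b -> a <= clamp a b x <= b.
Proof.
  move=> H; rewrite /clamp; split; first exact: Rmax_l.
  apply: Rmax_lub => //; exact: Rmin_l.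
Qed.

Lemma clamp_id a b x : a <= x <= b -> clamp a b x = x.
Proof.
  move=> [H1 H2]; rewrite /clamp Rmin_right // Rmax_right //.
Qed.

Lemma clamp_lipschitz a b x y : Rabs (clamp a b y - clamp a b x) <= Rabs (y - x).
Proof.
  rewrite /clamp /Rmin; case: (Rle_dec b x) => Hx; case: (Rle_dec b y) => Hy;
    rewrite /Rmax; repeat case: Rle_dec => ?; rewrite /Rabs; repeat case: Rcase_abs => ?; lra.
Qed.

Lemma continuous_clamp {U : UniformSpace} (f : R -> U) a b x : a <= b ->
  continuous_on (fun t => a <= t <= b) f -> continuous (fun t => f (clamp a b t)) x.
Proof.
  move=> Hab Hf P HP.
  have [d Hd] := Hf _ (clamp_in a b x Hab) P HP.
  exists d => y Hy; apply: Hd; last exact: clamp_in.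
  exact: Rle_lt_trans (clamp_lipschitz _ _ _ _) Hy.
Qed.

(** The point [c] is located only in the closed interval, so a bound on [df] must cover the end
    points. *)
Lemma mvt_continuous_on (f df : R -> R) a b : a < b ->
  (forall x, a < x < b -> is_derive f x (df x)) ->
  continuous_on (fun t => a <= t <= b) f ->
  exists c, a <= c <= b /\ f b - f a = df c * (b - a).
Proof.
  move=> Hab Hd Hc.
  have [||c [Hcab E]] := MVT_gen (fun t => f (clamp a b t)) a b df.
  - rewrite Rmin_left ?Rmax_right; [|lra|lra] => x Hx.
    apply: (is_derive_ext_loc f); last exact: Hd.
    have He : 0 < Rmin (x - a) (b - x) by apply: Rmin_pos; lra.
    exists (mkposreal _ He) => y Hy.
    have {}Hy : Rabs (y - x) < Rmin (x - a) (b - x) by exact: Hy.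
    rewrite clamp_id //.
    have := Rmin_l (x - a) (b - x); have := Rmin_r (x - a) (b - x).
    move: Hy => /Rabs_def2; lra.
  - move=> x _; apply/continuity_pt_filterlim; apply: continuous_clamp => //; lra.
  - exists c; move: Hcab E; rewrite Rmin_left ?Rmax_right; [|lra|lra].
    rewrite !clamp_id //; lra.
Qed.

Section CauchyProblem.
Context {X : NormedModule C_AbsRing}.

(** By the reverse triangle inequality the real function |F(t) - F(a)| also has derivative 0, and
    the mean value theorem applies to it. *)
Lemma zero_deriv_const (F : R -> X) a b : a < b ->
  continuous_on (fun t => a <= t <= b) F ->
  (forall t, a < t < b -> is_deriv_X F t zero) -> F b = F a.
Proof.
  move=> Hab Hc Hd; pose n t := norm (minus (F t) (F a)).
  have Hn s t : Rabs (n s - n t) <= norm (minus (F s) (F t)).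
  { rewrite /n; apply: Rabs_le.
    have := dist_triangle (F t) (F s) (F a); have := dist_triangle (F s) (F t) (F a).
    rewrite (norm_minus_sym (F t) (F s)); lra. }
  have [||c [_ E]] := mvt_continuous_on n (fun _ => 0) a b Hab.
  - move=> t Ht; apply/is_derive_Reals => eps He.
    have [|d [Hd0 D]] := proj1 (is_deriv_XP _ _ _) (Hd t Ht) (eps / 2); first lra.
    exists (mkposreal d Hd0) => h Hh Hhd.
    have := D h Hhd; have -> : minus (minus (F (t + h)) (F t)) (scal (RtoC h) zero) =
      minus (F (t + h)) (F t) by vring.
    move=> D1; have := Hn (t + h) t => D2.
    have Hp := Rabs_pos_lt _ Hh.
    rewrite Rminus_0_r Rabs_div //.
    apply: (Rmult_lt_reg_r (Rabs h)) => //.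
    rewrite /Rdiv Rmult_assoc Rinv_l; last lra.
    rewrite Rmult_1_r; nra.
  - move=> t Ht P [[e He] HP].
    have [d [Hd0 D]] := proj1 (continuous_on_normP _ _) Hc t Ht e He.
    exists (mkposreal d Hd0) => s Hs Hs'; apply: HP.
    exact: Rle_lt_trans (Hn s t) (D s Hs Hs').
  - apply: dist_eq_0; move: E; rewrite /n minus_eq_zero norm_zero; lra.
Qed.

Context (S : R -> X -> X) (B : X -> X -> Prop) (w : R).
Context (HS : C0_semigroup S) (HB : generates B S).
Context (Sle : forall t x, 0 <= t -> norm (S t x) <= exp (w * t) * norm x).

Lemma C0_at_0 x : S 0 x = x.
Proof. by case: HS => _ [H _]. Qed.

Lemma C0_add s t x : 0 <= s -> 0 <= t -> S (s + t) x = S s (S t x).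
Proof. case: HS => _ [_ [H _]]; exact: H. Qed.

Lemma C0_linear t : 0 <= t -> is_linear (S t).
Proof. case: HS => H _; exact: H. Qed.

Lemma C0_minus t x y : 0 <= t -> S t (minus x y) = minus (S t x) (S t y).
Proof. move=> Ht; apply: linear_minus; exact: C0_linear. Qed.

Lemma C0_continuous x t eps : 0 <= t -> 0 < eps ->
  exists d, 0 < d /\ forall s, Rabs (s - t) < d -> 0 <= s -> norm (minus (S s x) (S t x)) < eps.
Proof.
  move=> Ht He; case: HS => _ [_ [_ H]].
  exact: (proj1 (continuous_on_normP _ _) (H x) t Ht eps He).
Qed.

(** With |w| in place of w the bound is uniform for times in [0,r], whatever the sign of w. *)
Lemma C0_le r t x : 0 <= t <= r -> norm (S t x) <= exp (Rabs w * r) * norm x.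
Proof.
  move=> Ht; apply: Rle_trans (Sle t x (proj1 Ht)) _.
  apply: Rmult_le_compat_r; first exact: norm_ge_0.
  have H : w * t <= Rabs w * r.
  { have := Rle_abs w; have := Rabs_pos w; nra. }
  case: (Rle_lt_or_eq_dec _ _ H) => [H1|->]; last lra.
  apply: Rlt_le; exact: exp_increasing.
Qed.

Lemma generator_right_deriv x y : B x y -> right_deriv (fun t => S t x) y.
Proof. move=> H; apply/generatorP; [exact: C0_at_0|exact/HB]. Qed.

Lemma generator_invariant t x y : 0 <= t -> B x y -> B (S t x) (S t y).
Proof.
  move=> Ht H; apply/HB; apply/generatorP; first exact: C0_at_0.
  move=> eps He.
  have Hp := exp_pos (w * t).
  have [|d [Hd D]] := generator_right_deriv _ _ H (eps / exp (w * t)).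
  { exact: Rdiv_lt_0_compat. }
  exists d; split=> // h Hh; rewrite C0_at_0 -C0_add; [|lra|lra].
  rewrite Rplus_comm C0_add; [|lra|lra].
  have -> : minus (minus (S t (S h x)) (S t x)) (scal (RtoC h) (S t y)) =
    S t (minus (minus (S h x) (S 0 x)) (scal (RtoC h) y)).
  { rewrite C0_at_0 !C0_minus //; by rewrite (linear_scal _ (C0_linear t Ht)). }
  apply: Rle_trans (Sle _ _ Ht) _.
  have := Rmult_le_compat_l _ _ _ (Rlt_le _ _ Hp) (D h Hh).
  have -> : exp (w * t) * (eps / exp (w * t) * h) = eps * h by field; lra.
  done.
Qed.

(** Both one-sided derivatives come from the right derivative at 0, transported by S(s) with s <= t:
    s = t on the right, and s = t + h on the left. *)
Lemma C0_deriv t x y : 0 < t -> B x y -> is_deriv_X (fun s => S s x) t (S t y).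
Proof.
  move=> Ht H; apply/is_deriv_XP => eps He.
  pose K := exp (Rabs w * t).
  have HK : 0 < K by apply: exp_pos.
  have [|d1 [Hd1 D1]] := generator_right_deriv _ _ H (eps / 2 / K).
  { apply: Rdiv_lt_0_compat; lra. }
  have [||d2 [Hd2 D2]] := C0_continuous y t (eps / 2); [lra|lra|].
  exists (Rmin t (Rmin d1 d2)); split; first by do ?apply: Rmin_pos.
  move=> h Hh.
  have Hh0 : Rabs h < t := Rlt_le_trans _ _ _ Hh (Rmin_l _ _).
  have Hh' := Rlt_le_trans _ _ _ Hh (Rmin_r _ _).
  have Hh1 := Rlt_le_trans _ _ _ Hh' (Rmin_l _ _).
  have Hh2 := Rlt_le_trans _ _ _ Hh' (Rmin_r _ _).
  have main s k : 0 <= s <= t -> 0 <= k < d1 ->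
    norm (minus (minus (S s (S k x)) (S s x)) (scal (RtoC k) (S s y))) <= eps / 2 * k.
  { move=> Hs Hk.
    have -> : minus (minus (S s (S k x)) (S s x)) (scal (RtoC k) (S s y)) =
      S s (minus (minus (S k x) (S 0 x)) (scal (RtoC k) y)).
    { rewrite C0_at_0 !C0_minus ?(linear_scal _ (C0_linear s _)) //; lra. }
    apply: Rle_trans (C0_le t _ _ Hs) _.
    have := Rmult_le_compat_l _ _ _ (Rlt_le _ _ HK) (D1 k Hk).
    have -> : K * (eps / 2 / K * k) = eps / 2 * k by field; lra.
    done. }
  case: (Rle_dec 0 h) => Hs.
  - rewrite (Rabs_pos_eq h Hs) in Hh1 *; rewrite C0_add; [|lra|lra].
    apply: Rle_trans (main t h _ _) _; [lra|lra|nra].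
  - have Eh : Rabs h = - h by apply: Rabs_left; lra.
    rewrite Eh in Hh0 Hh1 *.
    (* From the left, S(t) x is a forward increment of length -h started at time t + h; replacing
       S(t + h) y by S(t) y then costs only strong continuity at y. *)
    have E : S t x = S (t + h) (S (- h) x) by (rewrite -C0_add; [congr S|..]; lra).
    have -> : minus (minus (S (t + h) x) (S t x)) (scal (RtoC h) (S t y)) =
      plus (opp (minus (minus (S (t + h) (S (- h) x)) (S (t + h) x))
        (scal (RtoC (- h)) (S (t + h) y))))
       (scal (RtoC (- h)) (minus (S t y) (S (t + h) y))).
    { rewrite -E; vring. }
    apply: Rle_trans (norm_triangle _ _) _.
    rewrite norm_opp norm_scalR Rabs_pos_eq; last lra.
    have M := main (t + h) (- h) ltac:(lra) ltac:(lra).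
    have := D2 (t + h); have -> : t + h - t = h by ring.
    move=> /(_ Hh2 ltac:(lra)); rewrite norm_minus_sym => N.
    have := Rmult_le_compat_l (- h) _ _ ltac:(lra) (Rlt_le _ _ N).
    lra.
Qed.

Lemma semigroup_classical s x0 : dom B x0 ->
  classical_solution B (- s) x0 (fun t => S (t + s) x0).
Proof.
  move=> [y0 H]; split; [|split].
  - apply/continuous_on_normP => t Ht eps He.
    have [||d [Hd D]] := C0_continuous x0 (t + s) eps; [lra|lra|].
    exists d; split=> // t' Ht' Hs; apply: D; last lra.
    by have -> : t' + s - (t + s) = t' - t by ring.
  - exists (fun t => S (t + s) y0); split=> [t Ht|].
    + split; last by apply: generator_invariant => //; lra.
      apply/is_deriv_XP => eps He.
      have Hts : 0 < t + s by lra.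
      have [d [Hd D]] := proj1 (is_deriv_XP _ _ _) (C0_deriv _ _ _ Hts H) eps He.
      exists d; split=> // h Hh; have := D h Hh.
      by have -> : t + s + h = t + h + s by ring.
    + apply/continuous_on_normP => t Ht eps He.
      have [||d [Hd D]] := C0_continuous y0 (t + s) eps; [lra|lra|].
      exists d; split=> // t' Ht' Hs; apply: D; last lra.
      by have -> : t' + s - (t + s) = t' - t by ring.
  - by rewrite Rplus_opp_l C0_at_0.
Qed.

(** The curve r -> S(t - r) Phi(r) runs from S(t - t0) x0 to Phi(t), and its derivative S(t - r)
    Phi'(r) - S(t - r) B Phi(r) vanishes. *)
Lemma classical_unique t0 x0 (Phi : R -> X) : classical_solution B t0 x0 Phi ->
  forall t, t0 <= t -> Phi t = S (t - t0) x0.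
Proof.
  move=> [Pcont [[dPhi [Pd _]] P0]] t [Ht|<-]; last by rewrite Rminus_diag C0_at_0.
  pose K := exp (Rabs w * (t - t0)); have HK : 0 < K by apply: exp_pos.
  pose F r := S (t - r) (Phi r).
  have -> : Phi t = F t by rewrite /F Rminus_diag C0_at_0.
  rewrite -P0 -/(F t0).
  apply: zero_deriv_const => //.
  - apply/continuous_on_normP => r Hr eps He.
    have Hr0 : t0 <= r by lra.
    have [|d1 [Hd1 D1]] := proj1 (continuous_on_normP _ _) Pcont r Hr0 (eps / 2 / K).
    { apply: Rdiv_lt_0_compat; lra. }
    have [||d2 [Hd2 D2]] := C0_continuous (Phi r) (t - r) (eps / 2); [lra|lra|].
    exists (Rmin d1 d2); split; first exact: Rmin_pos.
    move=> s Hs Hs'.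
    have N1 := D1 s (Rlt_le_trans _ _ _ Hs (Rmin_l _ _)) (proj1 Hs').
    have N2 : norm (minus (S (t - s) (Phi r)) (S (t - r) (Phi r))) < eps / 2.
    { apply: D2; last lra.
      have -> : t - s - (t - r) = - (s - r) by ring.
      rewrite Rabs_Ropp; exact: Rlt_le_trans Hs (Rmin_r _ _). }
    apply: Rle_lt_trans (dist_triangle (S (t - s) (Phi r)) _ _) _.
    have N3 : norm (minus (F s) (S (t - s) (Phi r))) <= eps / 2.
    { rewrite /F -C0_minus; last lra.
      apply: Rle_trans (C0_le (t - t0) _ _ _) _; first lra.
      have := Rmult_le_compat_l _ _ _ (Rlt_le _ _ HK) (Rlt_le _ _ N1).
      have -> : K * (eps / 2 / K) = eps / 2 by field; lra.
      done. }
    rewrite -/(F r) in N2; rewrite /F in N2 N3 *; lra.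
  - move=> r Hr; apply/is_deriv_XP => eps He.
    have [PD PA] := Pd r (proj1 Hr).
    set psi := dPhi r in PD PA.
    have [|d1 [Hd1 D1]] := proj1 (is_deriv_XP _ _ _) PD (eps / 3 / K).
    { apply: Rdiv_lt_0_compat; lra. }
    have [||d2 [Hd2 D2]] := C0_continuous psi (t - r) (eps / 3); [lra|lra|].
    have Htr : 0 < t - r by lra.
    have [|d3 [Hd3 D3]] := proj1 (is_deriv_XP _ _ _) (C0_deriv _ _ _ Htr PA) (eps / 3).
    { lra. }
    pose m := Rmin (r - t0) (t - r).
    exists (Rmin m (Rmin d1 (Rmin d2 d3))); split.
    { do ?apply: Rmin_pos; lra. }
    move=> h Hh.
    have Hm := Rlt_le_trans _ _ _ Hh (Rmin_l _ _).
    have {}Hh := Rlt_le_trans _ _ _ Hh (Rmin_r _ _).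
    have Hh1 := Rlt_le_trans _ _ _ Hh (Rmin_l _ _).
    have {}Hh := Rlt_le_trans _ _ _ Hh (Rmin_r _ _).
    have Hh2 := Rlt_le_trans _ _ _ Hh (Rmin_l _ _).
    have Hh3 := Rlt_le_trans _ _ _ Hh (Rmin_r _ _).
    have Hm1 := Rlt_le_trans _ _ _ Hm (Rmin_l _ _).
    have Hm2 := Rlt_le_trans _ _ _ Hm (Rmin_r _ _).
    move: Hm1 Hm2 => /Rabs_def2 Hm1 /Rabs_def2 Hm2.
    have Ht0 : 0 <= t - (r + h) <= t - t0 by lra.
    pose S' := S (t - (r + h)).
    (* Three errors, each at most eps |h| / 3: differentiability of Phi seen through a bounded
       operator, strong continuity at psi, and differentiability of the orbit of Phi(r). *)
    have -> : minus (minus (F (r + h)) (F r)) (scal (RtoC h) zero) =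
      plus (S' (minus (minus (Phi (r + h)) (Phi r)) (scal (RtoC h) psi)))
       (plus (scal (RtoC h) (minus (S' psi) (S (t - r) psi)))
         (minus (minus (S (t - r + - h) (Phi r)) (S (t - r) (Phi r)))
           (scal (RtoC (- h)) (S (t - r) psi)))).
    { have -> : t - r + - h = t - (r + h) by ring.
      rewrite /F /S' !C0_minus ?(linear_scal _ (C0_linear _ _)); [vring|lra|lra|lra]. }
    apply: Rle_trans (norm_triangle _ _) _.
    have T2 := norm_triangle (scal (RtoC h) (minus (S' psi) (S (t - r) psi)))
      (minus (minus (S (t - r + - h) (Phi r)) (S (t - r) (Phi r)))
           (scal (RtoC (- h)) (S (t - r) psi))).
    apply: Rle_trans (Rplus_le_compat_l _ _ _ T2) _.
    rewrite norm_scalR.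
    have N3 := D3 (- h); rewrite Rabs_Ropp in N3; have {}N3 := N3 Hh3.
    have N1 : norm (S' (minus (minus (Phi (r + h)) (Phi r)) (scal (RtoC h) psi))) <=
      eps / 3 * Rabs h.
    { apply: Rle_trans (C0_le _ _ _ Ht0) _.
      have := Rmult_le_compat_l _ _ _ (Rlt_le _ _ HK) (D1 h Hh1).
      have -> : K * (eps / 3 / K * Rabs h) = eps / 3 * Rabs h by field; lra.
      done. }
    have N2 : norm (minus (S' psi) (S (t - r) psi)) < eps / 3.
    { apply: D2; last lra.
      have -> : t - (r + h) - (t - r) = - h by ring.
      by rewrite Rabs_Ropp. }
    have := Rmult_le_compat_l _ _ _ (Rabs_pos h) (Rlt_le _ _ N2).
    have : eps * Rabs h = eps / 3 * Rabs h + (Rabs h * (eps / 3) + eps / 3 * Rabs h) by field.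
    move=> -> N2'; apply: Rplus_le_compat N1 (Rplus_le_compat _ _ _ _ N2' N3).
Qed.

End CauchyProblem.

(** * Differentiation on the unit interval *)

(** Every point of [0,1] is an accumulation point of [0,1]: a small move to the right from the left
    half, to the left from the right half. This is what makes the limit defining [D01] unique. *)
Lemma I01_proper x : I01 x -> ProperFilter' (within I01 (locally' x)).
Proof.
  move=> Hx; apply: Proper_StrongProper.
  split; last exact: within_filter.
  move=> P [d Hd].
  have [y [Hy [Hyx Hb]]] : exists y, I01 y /\ y <> x /\ Rabs (y - x) < d.
  { have Hd0 := cond_pos d; case: Hx => H0 H1.
    pose e := Rmin (d / 2) (1 / 2).
    have He : 0 < e by apply: Rmin_pos; lra.
    have He1 : e <= d / 2 by apply: Rmin_l.
    have He2 : e <= 1 / 2 by apply: Rmin_r.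
    case: (Rle_dec x (1 / 2)) => Hx.
    - exists (x + e); split; [split; lra|split; first lra].
      have -> : x + e - x = e by ring.
      rewrite Rabs_pos_eq; lra.
    - exists (x - e); split; [split; lra|split; first lra].
      have -> : x - e - x = - e by ring.
      rewrite Rabs_Ropp Rabs_pos_eq; lra. }
  by exists y; apply: (Hd y).
Qed.

Lemma is_deriv01P (u : R -> C) x (l : C) :
  is_deriv01 u x l <->
  (forall eps, 0 < eps -> exists d, 0 < d /\ forall y, Rabs (y - x) < d -> I01 y ->
     Cmod (u y - u x - RtoC (y - x) * l) <= eps * Rabs (y - x)).
Proof.
  have E y : y <> x -> Cmod (u y - u x - RtoC (y - x) * l) =
     Rabs (y - x) * Cmod ((u y - u x) / RtoC (y - x) - l).
  { move=> Hy; rewrite -Cmod_R -Cmod_mult; congr Cmod; field.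
    by move=> H; apply: Hy; move/RtoC_inj: H; lra. }
  have FF : Filter (within I01 (locally' x)) by apply: within_filter.
  rewrite /is_deriv01 (@filterlim_locally_ball_norm C_AbsRing R C_NormedModule _ FF).
  split=> H.
  - move=> eps He.
    have [d [Hd Hs]] := proj1 (locallyP _ _) (H (mkposreal eps He)).
    exists d; split=> // y Hy Iy; case: (Req_dec y x) => [->|Hyx].
    + have -> : (u x - u x - RtoC (x - x) * l)%C = RtoC 0.
      { rewrite Rminus_diag; ring. }
      rewrite Cmod_0 Rminus_diag Rabs_R0; lra.
    + rewrite E // Rmult_comm; apply: Rmult_le_compat_r; first exact: Rabs_pos.
      apply: Rlt_le; exact: (Hs y Hy Hyx Iy).
  - move=> [eps He].
    have [|d [Hd Hs]] := H (eps / 2); first lra.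
    apply: (proj2 (locallyP _ _)); exists d; split=> // y Hy Hyx Iy.
    have Hp : 0 < Rabs (y - x) by apply: Rabs_pos_lt; lra.
    have := Hs y Hy Iy; rewrite E // (Rmult_comm (eps / 2)).
    move=> /(Rmult_le_reg_l _ _ _ Hp) H1.
    apply: Rle_lt_trans (H1 : norm (minus _ l) <= _) _; rewrite /=; lra.
Qed.

Lemma D01_eq u x l : I01 x -> is_deriv01 u x l -> D01 u x = l.
Proof.
  move=> Hx H; have FF := I01_proper x Hx.
  exact: (@iota_filterlim_locally C_AbsRing C_CompleteNormedModule R _ FF _ l H).
Qed.

Lemma continuous_on01P (u : R -> C) :
  continuous_on I01 u <->
  (forall x, I01 x -> forall eps, 0 < eps -> exists d, 0 < d /\
     forall y, Rabs (y - x) < d -> I01 y -> Cmod (u y - u x) < eps).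
Proof. exact: (@continuous_on_normP C_NormedModule I01 u). Qed.

Lemma is_deriv01_ext u v x l : I01 x -> (forall y, I01 y -> u y = v y) ->
  is_deriv01 u x l -> is_deriv01 v x l.
Proof.
  move=> Hx E /is_deriv01P H; apply/is_deriv01P => eps He.
  have [d [Hd D]] := H eps He; exists d; split=> // y Hy Iy.
  rewrite -!E //; exact: D.
Qed.

Lemma is_deriv01_plus u v x l m : is_deriv01 u x l -> is_deriv01 v x m ->
  is_deriv01 (fun r => (u r + v r)%C) x (l + m)%C.
Proof.
  move=> /is_deriv01P Hu /is_deriv01P Hv; apply/is_deriv01P => eps He.
  have [|d1 [Hd1 D1]] := Hu (eps / 2); first lra.
  have [|d2 [Hd2 D2]] := Hv (eps / 2); first lra.
  exists (Rmin d1 d2); split; first exact: Rmin_pos.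
  move=> y Hy Iy.
  have -> : (u y + v y - (u x + v x) - RtoC (y - x) * (l + m))%C =
    ((u y - u x - RtoC (y - x) * l) + (v y - v x - RtoC (y - x) * m))%C by ring.
  apply: Rle_trans (Cmod_triangle _ _) _.
  have := D1 y (Rlt_le_trans _ _ _ Hy (Rmin_l _ _)) Iy.
  have := D2 y (Rlt_le_trans _ _ _ Hy (Rmin_r _ _)) Iy; lra.
Qed.

Lemma is_deriv01_scal (c : C) u x l : is_deriv01 u x l ->
  is_deriv01 (fun r => (c * u r)%C) x (c * l)%C.
Proof.
  move=> /is_deriv01P Hu; apply/is_deriv01P => eps He.
  have Hc := Cmod_ge_0 c.
  have Hc1 : 0 < Cmod c + 1 by lra.
  have [|d [Hd D]] := Hu (eps / (Cmod c + 1)); first by apply: Rdiv_lt_0_compat.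
  exists d; split=> // y Hy Iy.
  have -> : (c * u y - c * u x - RtoC (y - x) * (c * l))%C =
    (c * (u y - u x - RtoC (y - x) * l))%C by ring.
  rewrite Cmod_mult.
  have := D y Hy Iy; set a := Cmod (_ - _) => Ha.
  have Ha0 : 0 <= a by apply: Cmod_ge_0.
  have E : eps * Rabs (y - x) = (Cmod c + 1) * (eps / (Cmod c + 1) * Rabs (y - x)) by field; lra.
  rewrite E; apply: Rmult_le_compat => //; lra.
Qed.

Lemma is_deriv01_const (c : C) x : is_deriv01 (fun _ => c) x (RtoC 0).
Proof.
  apply/is_deriv01P => eps He; exists 1; split; first lra.
  move=> y _ _.
  have -> : (c - c - RtoC (y - x) * RtoC 0)%C = RtoC 0 by ring.
  rewrite Cmod_0; have := Rabs_pos (y - x); nra.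
Qed.

Lemma is_deriv01_continuous u x l : is_deriv01 u x l ->
  forall eps, 0 < eps -> exists d, 0 < d /\
     forall y, Rabs (y - x) < d -> I01 y -> Cmod (u y - u x) < eps.
Proof.
  move=> /is_deriv01P H eps He.
  have [|d [Hd D]] := H 1; first lra.
  have Hl := Cmod_ge_0 l.
  exists (Rmin d (eps / (Cmod l + 1 + 1))); split.
  { apply: Rmin_pos => //; apply: Rdiv_lt_0_compat; lra. }
  move=> y Hy Iy.
  have Hy1 := D y (Rlt_le_trans _ _ _ Hy (Rmin_l _ _)) Iy.
  have Hy2 := Rlt_le_trans _ _ _ Hy (Rmin_r _ _).
  have -> : (u y - u x)%C = ((u y - u x - RtoC (y - x) * l) + RtoC (y - x) * l)%C by ring.
  apply: Rle_lt_trans (Cmod_triangle _ _) _.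
  rewrite Cmod_mult Cmod_R.
  have Ha := Rabs_pos (y - x).
  have E : eps = eps / (Cmod l + 1 + 1) * (Cmod l + 1 + 1) by field; lra.
  have : Rabs (y - x) * (Cmod l + 1 + 1) < eps by rewrite E; nra.
  nra.
Qed.

Lemma is_deriv01_mulX u x l : is_deriv01 u x l ->
  is_deriv01 (fun r => (RtoC r * u r)%C) x (u x + RtoC x * l)%C.
Proof.
  move=> Hu; have Hc := is_deriv01_continuous _ _ _ Hu.
  move: Hu => /is_deriv01P Hu; apply/is_deriv01P => eps He.
  have Hx := Rabs_pos x.
  have [|d1 [Hd1 D1]] := Hu (eps / 2 / (Rabs x + 1)).
  { apply: Rdiv_lt_0_compat; lra. }
  have [|d2 [Hd2 D2]] := Hc (eps / 2); first lra.
  exists (Rmin d1 d2); split; first exact: Rmin_pos.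
  move=> y Hy Iy.
  have {}D1 := D1 y (Rlt_le_trans _ _ _ Hy (Rmin_l _ _)) Iy.
  have {}D2 := D2 y (Rlt_le_trans _ _ _ Hy (Rmin_r _ _)) Iy.
  have -> : (RtoC y * u y - RtoC x * u x - RtoC (y - x) * (u x + RtoC x * l))%C =
    (RtoC x * (u y - u x - RtoC (y - x) * l) + RtoC (y - x) * (u y - u x))%C.
  { rewrite RtoC_minus; ring. }
  apply: Rle_trans (Cmod_triangle _ _) _.
  rewrite !Cmod_mult !Cmod_R.
  move: D1; set a := Cmod (_ - _ * l) => D1.
  have Ha : 0 <= a by apply: Cmod_ge_0.
  have Hyx := Rabs_pos (y - x).
  have E : eps / 2 * Rabs (y - x) =
    (Rabs x + 1) * (eps / 2 / (Rabs x + 1) * Rabs (y - x)) by field; lra.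
  have B1 : Rabs x * a <= eps / 2 * Rabs (y - x).
  { rewrite E; apply: Rmult_le_compat => //; lra. }
  have B2 : Rabs (y - x) * Cmod (u y - u x) <= Rabs (y - x) * (eps / 2).
  { apply: Rmult_le_compat_l => //; lra. }
  lra.
Qed.

Lemma is_deriv01_D01 u x : I01 x -> (exists l, is_deriv01 u x l) -> is_deriv01 u x (D01 u x).
Proof. by move=> Hx [l Hl]; rewrite (D01_eq _ _ _ Hx Hl). Qed.

Lemma Ck01_D01 k u x : Ck01 (S k) u -> I01 x -> is_deriv01 u x (D01 u x).
Proof. by move=> [H _] Hx; apply: is_deriv01_D01 => //; apply: H. Qed.

Lemma continuous_on01_ext (u v : R -> C) : (forall y, I01 y -> u y = v y) ->
  continuous_on I01 u -> continuous_on I01 v.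
Proof.
  move=> E /continuous_on01P H; apply/continuous_on01P => x Hx eps He.
  have [d [Hd D]] := H x Hx eps He; exists d; split=> // y Hy Iy.
  rewrite -!E //; exact: D.
Qed.

Lemma D01_ext u v x : I01 x -> (forall y, I01 y -> u y = v y) ->
  (exists l, is_deriv01 u x l) -> D01 u x = D01 v x.
Proof.
  move=> Hx E [l Hl]; rewrite (D01_eq _ _ _ Hx Hl); symmetry; apply: D01_eq => //.
  exact: is_deriv01_ext E Hl.
Qed.

Lemma Ck01_ext k u v : (forall y, I01 y -> u y = v y) -> Ck01 k u -> Ck01 k v.
Proof.
  elim: k u v => [|k IH] u v E; first exact: continuous_on01_ext.
  move=> [H1 H2]; split.
  - move=> x Hx; have [l Hl] := H1 x Hx; exists l; exact: is_deriv01_ext E Hl.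
  - apply: IH H2 => y Hy; apply: D01_ext => //; exact: H1.
Qed.

(** [D01 u] is known to coincide with [v] on [0,1] only, whence the passage through [Ck01_ext]. *)
Lemma Ck01_intro k u v : (forall x, I01 x -> is_deriv01 u x (v x)) -> Ck01 k v -> Ck01 (S k) u.
Proof.
  move=> H Hv; split=> [x Hx|]; first by exists (v x); apply: H.
  apply: Ck01_ext Hv => y Hy; symmetry; apply: D01_eq => //; exact: H.
Qed.

Lemma Ck01_pred k u : Ck01 (S k) u -> Ck01 k u.
Proof.
  elim: k u => [|k IH] u [H1 H2].
  - apply/continuous_on01P => x Hx eps He; have [l Hl] := H1 x Hx.
    exact: is_deriv01_continuous Hl eps He.
  - split=> //; exact: IH.
Qed.

Lemma Ck01_continuous k u : Ck01 k u -> continuous_on I01 u.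
Proof. by elim: k u => [|k IH] u // /Ck01_pred /IH. Qed.

Lemma continuous_on01_plus (u v : R -> C) : continuous_on I01 u -> continuous_on I01 v ->
  continuous_on I01 (fun r => (u r + v r)%C).
Proof.
  move=> /continuous_on01P Hu /continuous_on01P Hv; apply/continuous_on01P => x Hx eps He.
  have [|d1 [Hd1 D1]] := Hu x Hx (eps / 2); first lra.
  have [|d2 [Hd2 D2]] := Hv x Hx (eps / 2); first lra.
  exists (Rmin d1 d2); split; first exact: Rmin_pos.
  move=> y Hy Iy.
  have -> : (u y + v y - (u x + v x))%C = ((u y - u x) + (v y - v x))%C by ring.
  apply: Rle_lt_trans (Cmod_triangle _ _) _.
  have := D1 y (Rlt_le_trans _ _ _ Hy (Rmin_l _ _)) Iy.
  have := D2 y (Rlt_le_trans _ _ _ Hy (Rmin_r _ _)) Iy; lra.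
Qed.

Lemma continuous_on01_scal c (u : R -> C) : continuous_on I01 u -> continuous_on I01 (fun r => (c * u r)%C).
Proof.
  move=> /continuous_on01P Hu; apply/continuous_on01P => x Hx eps He.
  have Hc := Cmod_ge_0 c.
  have [|d [Hd D]] := Hu x Hx (eps / (Cmod c + 1)); first by apply: Rdiv_lt_0_compat; lra.
  exists d; split=> // y Hy Iy.
  have -> : (c * u y - c * u x)%C = (c * (u y - u x))%C by ring.
  rewrite Cmod_mult; have := D y Hy Iy; have := Cmod_ge_0 (u y - u x).
  have E : eps = (Cmod c + 1) * (eps / (Cmod c + 1)) by field; lra.
  rewrite {2}E => *; apply: Rle_lt_trans (_ : _ <= (Cmod c + 1) * Cmod (u y - u x)) _; nra.
Qed.

Lemma continuous_on01_mulX (u : R -> C) : continuous_on I01 u ->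
  continuous_on I01 (fun r => (RtoC r * u r)%C).
Proof.
  move=> /continuous_on01P Hu; apply/continuous_on01P => x Hx eps He.
  have [|d [Hd D]] := Hu x Hx (eps / 2); first lra.
  have Hc := Cmod_ge_0 (u x).
  exists (Rmin d (eps / 2 / (Cmod (u x) + 1))); split.
  { apply: Rmin_pos => //; apply: Rdiv_lt_0_compat; lra. }
  move=> y Hy Iy.
  have -> : (RtoC y * u y - RtoC x * u x)%C =
    (RtoC y * (u y - u x) + RtoC (y - x) * u x)%C by rewrite RtoC_minus; ring.
  apply: Rle_lt_trans (Cmod_triangle _ _) _.
  rewrite !Cmod_mult !Cmod_R (Rabs_pos_eq y); last by case: Iy.
  have D1 := D y (Rlt_le_trans _ _ _ Hy (Rmin_l _ _)) Iy.
  have B : Rabs (y - x) * Cmod (u x) <= eps / 2.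
  { apply: mult_le_of_lt_div => //; first lra.
    split; [exact: Rabs_pos|exact: Rlt_le_trans Hy (Rmin_r _ _)]. }
  have := Cmod_ge_0 (u y - u x); case: Iy; nra.
Qed.

Lemma Ck01_plus k u v : Ck01 k u -> Ck01 k v -> Ck01 k (fun r => (u r + v r)%C).
Proof.
  elim: k u v => [|k IH] u v; first exact: continuous_on01_plus.
  move=> Hu Hv; apply: (Ck01_intro _ _ (fun r => (D01 u r + D01 v r)%C)).
  - move=> x Hx; apply: is_deriv01_plus; [exact: (Ck01_D01 k)|exact: (Ck01_D01 k)].
  - by apply: IH; [case: Hu|case: Hv].
Qed.

Lemma Ck01_scal k c u : Ck01 k u -> Ck01 k (fun r => (c * u r)%C).
Proof.
  elim: k u => [|k IH] u; first exact: continuous_on01_scal.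
  move=> Hu; apply: (Ck01_intro _ _ (fun r => (c * D01 u r)%C)).
  - move=> x Hx; apply: is_deriv01_scal; exact: (Ck01_D01 k).
  - by apply: IH; case: Hu.
Qed.

Lemma Ck01_mulX k u : Ck01 k u -> Ck01 k (fun r => (RtoC r * u r)%C).
Proof.
  elim: k u => [|k IH] u; first exact: continuous_on01_mulX.
  move=> Hu; apply: (Ck01_intro _ _ (fun r => (u r + RtoC r * D01 u r)%C)).
  - move=> x Hx; apply: is_deriv01_mulX; exact: (Ck01_D01 k).
  - apply: Ck01_plus; first exact: Ck01_pred.
    by apply: IH; case: Hu.
Qed.

Lemma Ck01_const k c : Ck01 k (fun _ => c).
Proof.
  elim: k c => [|k IH] c.
  - apply/continuous_on01P => x Hx eps He; exists 1; split; first lra.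
    move=> y _ _; have -> : (c - c)%C = RtoC 0 by ring.
    by rewrite Cmod_0.
  - apply: (Ck01_intro _ _ (fun _ => RtoC 0)); last exact: IH.
    move=> x _; exact: is_deriv01_const.
Qed.

Lemma Ck01_opp k u : Ck01 k u -> Ck01 k (fun r => (- u r)%C).
Proof.
  move=> H; apply: (Ck01_ext k (fun r => (RtoC (-1) * u r)%C)); last exact: Ck01_scal.
  by move=> y _; apply: injective_projections => /=; ring.
Qed.

Lemma is_deriv01_opp u x l : I01 x -> is_deriv01 u x l -> is_deriv01 (fun r => (- u r)%C) x (- l)%C.
Proof.
  move=> Hx H; have -> : (- l)%C = (RtoC (-1) * l)%C.
  { by apply: injective_projections => /=; ring. }
  apply: (is_deriv01_ext (fun r => (RtoC (-1) * u r)%C)) => //; last exact: is_deriv01_scal.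
  by move=> y _; apply: injective_projections => /=; ring.
Qed.

Lemma is_deriv01_minus u v x l m : I01 x -> is_deriv01 u x l -> is_deriv01 v x m ->
  is_deriv01 (fun r => (u r - v r)%C) x (l - m)%C.
Proof. move=> Hx Hu Hv; apply: is_deriv01_plus => //; exact: is_deriv01_opp. Qed.

Lemma Ck01_minus k u v : Ck01 k u -> Ck01 k v -> Ck01 k (fun r => (u r - v r)%C).
Proof. move=> Hu Hv; apply: Ck01_plus => //; exact: Ck01_opp. Qed.

(** * Division by the radial variable *)

Lemma Rabs_fst_le (z : C) : Rabs (fst z) <= Cmod z.
Proof. exact: Rle_trans (Rmax_l _ _) (Rmax_Cmod z). Qed.

Lemma Rabs_snd_le (z : C) : Rabs (snd z) <= Cmod z.
Proof. exact: Rle_trans (Rmax_r _ _) (Rmax_Cmod z). Qed.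

Lemma Cmod_le_components (z : C) : Cmod z <= Rabs (fst z) + Rabs (snd z).
Proof.
  have H1 := Rabs_pos (fst z); have H2 := Rabs_pos (snd z).
  rewrite -(sqrt_Rsqr (Rabs (fst z) + Rabs (snd z))); last lra.
  apply: sqrt_le_1_alt; rewrite -(pow2_abs (fst z)) -(pow2_abs (snd z)) /Rsqr; nra.
Qed.

(** Real and imaginary part treated by one argument, so that real theorems are applied once for
    both. *)
Definition component (c : C -> R) : Prop := c = fst \/ c = snd.

Lemma component_le c z : component c -> Rabs (c z) <= Cmod z.
Proof. by case=> ->; [exact: Rabs_fst_le|exact: Rabs_snd_le]. Qed.

Lemma component_deriv c u x l : component c -> 0 < x < 1 -> is_deriv01 u x l ->
  is_derive (fun t => c (u t)) x (c l).
Proof.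
  move=> Hc Hx /is_deriv01P H; apply/is_derive_Reals => eps He.
  have [|d [Hd D]] := H (eps / 2); first lra.
  have Hm : 0 < Rmin d (Rmin x (1 - x)) by do ?apply: Rmin_pos; lra.
  exists (mkposreal _ Hm) => h Hh /= Hhm.
  have H1 : Rabs h < d := Rlt_le_trans _ _ _ Hhm (Rmin_l _ _).
  have {}Hhm := Rlt_le_trans _ _ _ Hhm (Rmin_r _ _).
  have H2 := Rlt_le_trans _ _ _ Hhm (Rmin_l _ _).
  have H3 := Rlt_le_trans _ _ _ Hhm (Rmin_r _ _).
  move: H2 H3 => /Rabs_def2 H2 /Rabs_def2 H3.
  have Hp := Rabs_pos_lt _ Hh.
  have := D (x + h); have -> : x + h - x = h by ring.
  move=> /(_ H1 ltac:(split; lra)) B.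
  have {}B := Rle_trans _ _ _ (component_le c _ Hc) B.
  have E : c (u (x + h)%R - u x - RtoC h * l)%C = c (u (x + h)) - c (u x) - h * c l.
  { by case: Hc => -> /=; ring. }
  rewrite E in B.
  have -> : (c (u (x + h)) - c (u x)) / h - c l = (c (u (x + h)) - c (u x) - h * c l) / h.
  { by field. }
  rewrite Rabs_div //; apply: (Rmult_lt_reg_r (Rabs h)) => //.
  rewrite /Rdiv Rmult_assoc Rinv_l; last lra.
  rewrite Rmult_1_r; nra.
Qed.

Lemma component_continuous c (u : R -> C) : component c -> continuous_on I01 u ->
  continuous_on I01 (fun t => c (u t)).
Proof.
  move=> Hc /continuous_on01P H x Hx P [[e He] HP].
  have [d [Hd D]] := H x Hx e He; exists (mkposreal d Hd) => y Hy Iy; apply: HP.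
  have E : c (u y - u x)%C = c (u y) - c (u x) by case: Hc => -> /=; ring.
  have := Rle_lt_trans _ _ _ (component_le c (u y - u x)%C Hc) (D y Hy Iy).
  by rewrite E.
Qed.

(** The factor 2 arises because the mean value theorem is applied to the two components separately,
    with different intermediate points. *)
Lemma mean_value01 (u v : R -> C) M y : 0 < y <= 1 ->
  (forall x, I01 x -> is_deriv01 u x (v x)) -> u 0 = RtoC 0 ->
  (forall c, 0 <= c <= y -> Cmod (v c) <= M) -> Cmod (u y) <= 2 * M * y.
Proof.
  move=> Hy Hu u0 Hv.
  have Hc : continuous_on I01 u.
  { apply/continuous_on01P => x Hx eps He; exact: is_deriv01_continuous (Hu x Hx) eps He. }
  have comp c : component c -> Rabs (c (u y)) <= M * y.
  { move=> Cc.
    have [|x Hx||z [Hz E]] := mvt_continuous_on (fun t => c (u t)) (fun t => c (v t)) 0 y.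
    - lra.
    - apply: component_deriv => //; first lra. apply: Hu; split; lra.
    - apply: (continuous_on_subset I01); first by move=> t Ht; split; lra.
      exact: component_continuous.
    - have E0 : c (u 0) = 0 by rewrite u0; case: Cc => ->.
      move: E; rewrite E0 !Rminus_0_r => ->.
      rewrite Rabs_mult (Rabs_pos_eq y); last lra.
      apply: Rmult_le_compat_r; first lra.
      exact: Rle_trans (component_le _ _ Cc) (Hv z Hz). }
  have := Cmod_le_components (u y).
  have := comp fst (or_introl eq_refl); have := comp snd (or_intror eq_refl); lra.
Qed.

(** The derivative of u - m y^2 / 2 is v - m y, which is o(y) since v is differentiable at 0; the
    mean value bound integrates this. *)
Lemma taylor01 (u v : R -> C) m eps : (forall x, I01 x -> is_deriv01 u x (v x)) ->
  u 0 = RtoC 0 -> v 0 = RtoC 0 -> is_deriv01 v 0 m -> 0 < eps ->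
  exists d, 0 < d /\ forall y, 0 <= y < d -> I01 y ->
    Cmod (u y - RtoC y * (RtoC y * (m / 2)))%C <= eps * y ^ 2.
Proof.
  move=> Hu u0 v0 /is_deriv01P Hm He.
  have [|d [Hd D]] := Hm (eps / 2); first lra.
  exists d; split=> // y [[Hy|<-] Hyd] Iy; last first.
  { rewrite u0 [X in Cmod X](_ : _ = RtoC 0); last by ring.
    rewrite Cmod_0; lra. }
  have -> : eps * y ^ 2 = 2 * (eps / 2 * y) * y by field.
  (* The derivative is left in the unreduced shape produced by two uses of [is_deriv01_mulX]. *)
  apply: (mean_value01 (fun t => (u t - RtoC t * (RtoC t * (m / 2)))%C)
           (fun t => (v t - (RtoC t * (m / 2) + RtoC t * (m / 2 + RtoC t * RtoC 0)))%C)).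
  - case: Iy; lra.
  - move=> x Hx; apply: is_deriv01_minus => //; first exact: Hu.
    apply: is_deriv01_mulX; apply: is_deriv01_mulX; exact: is_deriv01_const.
  - rewrite u0; ring.
  - move=> c Hc.
    have Ic : I01 c by case: Iy; split; lra.
    have -> : (v c - (RtoC c * (m / 2) + RtoC c * (m / 2 + RtoC c * RtoC 0)))%C =
      (v c - v 0 - RtoC (c - 0) * m)%C by rewrite v0 Rminus_0_r; field.
    have := D c; rewrite Rminus_0_r Rabs_pos_eq; last lra.
    move=> /(_ ltac:(lra) Ic) B; apply: Rle_trans B _.
    apply: Rmult_le_compat_l; lra.
Qed.

(** The quotient q(y)/y with a prescribed value [L] at 0, which is q'(0) whenever continuity is
    wanted. *)
Definition divX (q : R -> C) (L : C) (y : R) : C :=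
  match Req_dec_T y 0 with left _ => L | right _ => (q y * RtoC (/ y))%C end.

Lemma mulX_divX q L y : q 0 = RtoC 0 -> (RtoC y * divX q L y)%C = q y.
Proof.
  move=> q0; rewrite /divX; case: Req_dec_T => [->|Hy]; first by rewrite q0; ring.
  by rewrite RtoC_inv //; field; move/RtoC_inj.
Qed.

Lemma divX_continuous (q : R -> C) (L : C) : continuous_on I01 q -> q 0 = RtoC 0 -> is_deriv01 q 0 L ->
  continuous_on I01 (divX q L).
Proof.
  move=> /continuous_on01P Hq q0 /is_deriv01P HL.
  apply/continuous_on01P => x Hx eps He.
  case: (Req_dec x 0) => [->|Hx0].
  - have [|d [Hd D]] := HL (eps / 2); first lra.
    exists d; split=> // y Hy Iy.
    rewrite /divX; case: (Req_dec_T 0 0) => // _; case: Req_dec_T => [_|Hy0].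
    { have -> : (L - L)%C = RtoC 0 by ring. by rewrite Cmod_0. }
    have B := D y Hy Iy; rewrite Rminus_0_r q0 in B.
    have Hp := Rabs_pos_lt _ Hy0.
    apply: (Rmult_lt_reg_r (Rabs y)) => //.
    rewrite -{1}Cmod_R -Cmod_mult.
    have -> : ((q y * RtoC (/ y) - L) * RtoC y)%C = (q y - RtoC 0 - RtoC y * L)%C.
    { rewrite RtoC_inv //; field; by move/RtoC_inj. }
    nra.
  - have Hx' : 0 < x by case: Hx; lra.
    (* [K] bounds the quotient near x: there |q(y)| <= |q(x)| + 1 and y > x/2. It enters through x
       (u(y) - u(x)) = q(y) - q(x) - (y - x) u(y), where u is the quotient. *)
    pose K := (Cmod (q x) + 1) * (2 / x).
    have Hqx := Cmod_ge_0 (q x).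
    have H2x : 0 < 2 / x by apply: Rdiv_lt_0_compat; lra.
    have HK : 0 < K by rewrite /K; nra.
    have [|d [Hd D]] := Hq x Hx (Rmin 1 (eps * x / 2)).
    { apply: Rmin_pos; nra. }
    exists (Rmin d (Rmin (x / 2) (eps * x / 2 / (K + 1)))); split.
    { do ?apply: Rmin_pos => //; [lra|apply: Rdiv_lt_0_compat; nra]. }
    move=> y Hy Iy.
    have Hy1 := Rlt_le_trans _ _ _ Hy (Rmin_l _ _).
    have {}Hy := Rlt_le_trans _ _ _ Hy (Rmin_r _ _).
    have Hy2 := Rlt_le_trans _ _ _ Hy (Rmin_l _ _).
    have Hy3 := Rlt_le_trans _ _ _ Hy (Rmin_r _ _).
    have {}D := D y Hy1 Iy.
    have Da := Rlt_le_trans _ _ _ D (Rmin_l _ _).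
    have Db := Rlt_le_trans _ _ _ D (Rmin_r _ _).
    have Hyx : x / 2 < y by move: Hy2 => /Rabs_def2; lra.
    have By : Cmod (divX q L y) <= K.
    { rewrite /divX; case: Req_dec_T => [?|_]; first lra.
      rewrite Cmod_mult Cmod_R Rabs_pos_eq; last by apply: Rlt_le; apply: Rinv_0_lt_compat; lra.
      apply: Rmult_le_compat; [exact: Cmod_ge_0| | |].
      - apply: Rlt_le; apply: Rinv_0_lt_compat; lra.
      - have -> : q y = (q x + (q y - q x))%C by ring.
        apply: Rle_trans (Cmod_triangle _ _) _; lra.
      - have -> : 2 / x = / (x / 2) by field; lra.
        apply: Rinv_le_contravar; lra. }
    apply: (Rmult_lt_reg_r x) => //.
    rewrite -{2}(Rabs_pos_eq x); last lra.
    rewrite -Cmod_R -Cmod_mult.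
    have -> : ((divX q L y - divX q L x) * RtoC x)%C =
      ((q y - q x) + - (RtoC (y - x) * divX q L y))%C.
    { rewrite -(mulX_divX q L y q0) -(mulX_divX q L x q0) RtoC_minus; ring. }
    apply: Rle_lt_trans (Cmod_triangle _ _) _.
    rewrite Cmod_opp Cmod_mult Cmod_R.
    have B : Rabs (y - x) * K <= eps * x / 2.
    { apply: mult_le_of_lt_div; [nra|lra|split=> //; exact: Rabs_pos]. }
    have : Rabs (y - x) * Cmod (divX q L y) <= Rabs (y - x) * K.
    { apply: Rmult_le_compat_l => //; exact: Rabs_pos. }
    lra.
Qed.

(** The product rule for y u(y) = q(y) read backwards: continuity of u suffices, as x times the
    error for u is the error for q minus (y - x)(u(y) - u(x)). *)
Lemma is_deriv01_divX (u q : R -> C) x l : I01 x -> x <> 0 ->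
  continuous_on I01 u -> (forall y, I01 y -> (RtoC y * u y)%C = q y) ->
  is_deriv01 q x l -> is_deriv01 u x ((l - u x) * RtoC (/ x))%C.
Proof.
  move=> Ix Hx /continuous_on01P Hu E /is_deriv01P Hq; apply/is_deriv01P => eps He.
  have Hx' : 0 < x by case: Ix; lra.
  have Hex : 0 < eps * x / 2 by nra.
  have [d1 [Hd1 D1]] := Hq _ Hex; have [d2 [Hd2 D2]] := Hu x Ix _ Hex.
  exists (Rmin d1 d2); split; first exact: Rmin_pos.
  move=> y Hy Iy.
  have {}D1 := D1 y (Rlt_le_trans _ _ _ Hy (Rmin_l _ _)) Iy.
  have {}D2 := D2 y (Rlt_le_trans _ _ _ Hy (Rmin_r _ _)) Iy.
  apply: (Rmult_le_reg_r x) => //.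
  have Ex : Cmod (RtoC x) = x by rewrite Cmod_R Rabs_pos_eq; lra.
  rewrite -[X in _ * X <= _]Ex -Cmod_mult.
  have -> : ((u y - u x - RtoC (y - x) * ((l - u x) * RtoC (/ x))) * RtoC x)%C =
    ((q y - q x - RtoC (y - x) * l) + - (RtoC (y - x) * (u y - u x)))%C.
  { rewrite -!E // RtoC_minus RtoC_inv //; field; by move/RtoC_inj. }
  apply: Rle_trans (Cmod_triangle _ _) _.
  rewrite Cmod_opp Cmod_mult Cmod_R.
  have : Rabs (y - x) * Cmod (u y - u x) <= Rabs (y - x) * (eps * x / 2).
  { apply: Rmult_le_compat_l; [exact: Rabs_pos|lra]. }
  lra.
Qed.

Lemma C0_quotient p : Ck01 1 p -> p 0 = RtoC 0 ->
  exists v : R -> C, continuous_on I01 v /\ forall x, p x = (RtoC x * v x)%C.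
Proof.
  move=> Hp p0; have I0 : I01 0 by split; lra.
  exists (divX p (D01 p 0)); split.
  - apply: divX_continuous => //; [exact: (Ck01_continuous 1)|exact: (Ck01_D01 0)].
  - by move=> x; rewrite mulX_divX.
Qed.

(** Away from 0, v' = (p' - v)/x; at 0 Taylor's formula gives p''(0)/2. The two match because p' - v
    vanishes at 0 and has derivative p''(0) - p''(0)/2 there. *)
Lemma C1_quotient p : Ck01 2 p -> p 0 = RtoC 0 -> D01 p 0 = RtoC 0 ->
  exists v v' : R -> C, continuous_on I01 v' /\ (forall x, I01 x -> is_deriv01 v x (v' x)) /\
    v 0 = RtoC 0 /\ forall x, p x = (RtoC x * v x)%C.
Proof.
  move=> Hp p0 p0'; have I0 : I01 0 by split; lra.
  have Hp1 : Ck01 1 (D01 p) by case: Hp.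
  have dp x : I01 x -> is_deriv01 p x (D01 p x) by exact: (Ck01_D01 1).
  pose m := D01 (D01 p) 0.
  have dp1 : is_deriv01 (D01 p) 0 m by apply: (Ck01_D01 0).
  pose v := divX p (RtoC 0).
  have pv x : (RtoC x * v x)%C = p x by apply: mulX_divX.
  have v0 : v 0 = RtoC 0 by rewrite /v /divX; case: Req_dec_T.
  have vc : continuous_on I01 v.
  { apply: divX_continuous => //; first exact: (Ck01_continuous 2).
    rewrite -p0'; exact: dp. }
  have dv0 : is_deriv01 v 0 (m / 2)%C.
  { apply/is_deriv01P => eps He.
    have [d [Hd D]] := taylor01 p (D01 p) m eps dp p0 p0' dp1 He.
    exists d; split=> // y; rewrite Rminus_0_r => Hy Iy.
    have Hy0 : 0 <= y by case: Iy.
    rewrite Rabs_pos_eq // in Hy *.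
    rewrite v0; case: Hy0 => [Hy0|<-]; last first.
    { rewrite v0 [X in Cmod X](_ : _ = RtoC 0); last by ring.
      rewrite Cmod_0; lra. }
    apply: (Rmult_le_reg_l y) => //.
    rewrite -{1}(Rabs_pos_eq y); last lra.
    rewrite -Cmod_R -Cmod_mult.
    have -> : (RtoC y * (v y - RtoC 0 - RtoC y * (m / 2)))%C =
      (p y - RtoC y * (RtoC y * (m / 2)))%C by rewrite -pv; field.
    have -> : y * (eps * y) = eps * y ^ 2 by ring.
    apply: D => //; lra. }
  exists v, (divX (fun x => (D01 p x - v x)%C) (m / 2)%C); split; [|split; [|split]] => //.
  - apply: divX_continuous.
    + apply: continuous_on01_plus; first exact: (Ck01_continuous 1).
      exact: (Ck01_opp 0).
    + rewrite p0' v0; ring.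
    + have -> : (m / 2)%C = (m - m / 2)%C by field.
      exact: is_deriv01_minus.
  - move=> x Hx; rewrite /divX; case: Req_dec_T => [->|Hx0] //.
    apply: (is_deriv01_divX v p) => //; exact: dp.
Qed.

(** * The energy identity *)

Lemma ex_RInt_clamp (g : R -> R) : (forall x, continuous (fun t => g (clamp 0 1 t)) x) ->
  ex_RInt g 0 1.
Proof.
  move=> H; apply: (ex_RInt_ext (fun t => g (clamp 0 1 t))).
  - rewrite Rmin_left ?Rmax_right; [|lra|lra] => x Hx; rewrite clamp_id //; lra.
  - by apply: (@ex_RInt_continuous R_CompleteNormedModule) => x _; apply: H.
Qed.

(** At the end points only one-sided derivatives are at hand, so F is compared with the primitive of
    the clamped integrand: their difference is continuous on [0,1] with zero derivative inside. *)
Lemma ftc01 (F f : R -> R) :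
  (forall x, continuous (fun t => F (clamp 0 1 t)) x) ->
  (forall x, continuous (fun t => f (clamp 0 1 t)) x) ->
  (forall x, 0 < x < 1 -> is_derive F x (f x)) ->
  RInt f 0 1 = F 1 - F 0.
Proof.
  move=> HF Hf Hd.
  pose fc t := f (clamp 0 1 t); pose G x := RInt fc 0 x.
  have GE x : is_derive G x (fc x).
  { apply: (is_derive_RInt _ _ 0); last exact: Hf.
    exists (mkposreal 1 Rlt_0_1) => y _; apply: RInt_correct.
    by apply: (@ex_RInt_continuous R_CompleteNormedModule) => z _; apply: Hf. }
  pose K x := G x - F (clamp 0 1 x).
  have [||c [_ E]] := mvt_continuous_on K (fun _ => 0) 0 1 Rlt_0_1.
  - move=> x Hx.
    have -> : 0 = fc x - f x by rewrite /fc clamp_id; lra.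
    apply: is_derive_minus; first exact: GE.
    apply: (is_derive_ext_loc F); last exact: Hd.
    have He : 0 < Rmin x (1 - x) by apply: Rmin_pos; lra.
    exists (mkposreal _ He) => y Hy.
    have {}Hy : Rabs (y - x) < Rmin x (1 - x) by exact: Hy.
    rewrite clamp_id //.
    have := Rmin_l x (1 - x); have := Rmin_r x (1 - x).
    move: Hy => /Rabs_def2; lra.
  - apply: (continuous_on_forall (fun t => 0 <= t <= 1)) => x _.
    apply: (@continuous_minus R_UniformSpace R_AbsRing R_NormedModule) => //.
    apply: ex_derive_continuous; exists (fc x); exact: GE.
  - have -> : RInt f 0 1 = G 1.
    { apply: RInt_ext; rewrite Rmin_left ?Rmax_right; [|lra|lra] => x Hx.
      rewrite /fc clamp_id //; lra. }
    move: E; rewrite /K !clamp_id; [|lra|lra].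
    rewrite /G RInt_point /zero /=; lra.
Qed.

(** Continuity on [0,1] in a form stable under the algebraic operations, so that it can be checked
    by structural recursion on the integrand. *)
Definition clamp_cont (f : R -> R) : Prop := forall x, continuous (fun t => f (clamp 0 1 t)) x.

Lemma clamp_cont_plus f g : clamp_cont f -> clamp_cont g -> clamp_cont (fun t => f t + g t).
Proof.
  move=> Hf Hg x; exact: (@continuous_plus R_UniformSpace R_AbsRing R_NormedModule) (Hf x) (Hg x).
Qed.

Lemma clamp_cont_minus f g : clamp_cont f -> clamp_cont g -> clamp_cont (fun t => f t - g t).
Proof.
  move=> Hf Hg x; exact: (@continuous_minus R_UniformSpace R_AbsRing R_NormedModule) (Hf x) (Hg x).
Qed.

Lemma clamp_cont_mult f g : clamp_cont f -> clamp_cont g -> clamp_cont (fun t => f t * g t).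
Proof.
  move=> Hf Hg x; exact: (@continuous_mult R_UniformSpace R_AbsRing) (Hf x) (Hg x).
Qed.

Lemma clamp_cont_const c : clamp_cont (fun _ => c).
Proof. move=> x; exact: continuous_const. Qed.

Lemma clamp_cont_id : clamp_cont (fun t => t).
Proof.
  move=> x P [d Hd]; exists d => y Hy; apply: Hd.
  exact: Rle_lt_trans (clamp_lipschitz _ _ _ _) Hy.
Qed.

Lemma clamp_cont_component c (u : R -> C) : component c -> continuous_on I01 u ->
  clamp_cont (fun t => c (u t)).
Proof.
  move=> Hc Hu x; apply: (continuous_clamp (fun t => c (u t))); first lra.
  exact: component_continuous.
Qed.

Ltac clamp_cont_tac :=
  lazymatch goal with
  | |- clamp_cont (fun _ => ?c) => apply (clamp_cont_const c)
  | |- clamp_cont (fun t => t) => apply clamp_cont_id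
  | |- clamp_cont (fun t => @?f t + @?g t) => apply (clamp_cont_plus f g); clamp_cont_tac
  | |- clamp_cont (fun t => @?f t - @?g t) => apply (clamp_cont_minus f g); clamp_cont_tac
  | |- clamp_cont (fun t => @?f t * @?g t) => apply (clamp_cont_mult f g); clamp_cont_tac
  | |- _ => assumption
  end.

Lemma CInt_pair (f : R -> C) : ex_RInt (fun t => fst (f t)) 0 1 ->
  ex_RInt (fun t => snd (f t)) 0 1 ->
  CInt f 0 1 = (RInt (fun t => fst (f t)) 0 1, RInt (fun t => snd (f t)) 0 1).
Proof.
  move=> /RInt_correct H1 /RInt_correct H2.
  apply: (@is_RInt_unique C_R_CompleteNormedModule).
  exact: (@is_RInt_fct_extend_pair R_NormedModule R_NormedModule f 0 1 _ _ H1 H2).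
Qed.

(** Re (z conj w), the real inner product of the plane. *)
Definition re_dot (z w : C) : R := fst z * fst w + snd z * snd w.

Lemma re_dot_self z : re_dot z z = Cmod z ^ 2.
Proof. by rewrite Cmod2_alt /re_dot /Re /Im; ring. Qed.

(** The identity for f is asked on the open interval only, since the integrand of [ip1] is singular
    in form at 0. *)
Lemma re_CInt_conj (f v w : R -> C) : continuous_on I01 v -> continuous_on I01 w ->
  (forall x, 0 < x < 1 -> f x = (v x * Cconj (w x))%C) ->
  is_RInt (fun x => re_dot (v x) (w x)) 0 1 (fst (CInt f 0 1)).
Proof.
  move=> Hv Hw E.
  have v1 := clamp_cont_component fst v (or_introl eq_refl) Hv.
  have v2 := clamp_cont_component snd v (or_intror eq_refl) Hv.
  have w1 := clamp_cont_component fst w (or_introl eq_refl) Hw.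
  have w2 := clamp_cont_component snd w (or_intror eq_refl) Hw.
  have X1 : ex_RInt (fun x => re_dot (v x) (w x)) 0 1.
  { apply: ex_RInt_clamp; change (clamp_cont (fun x => re_dot (v x) (w x))).
    rewrite /re_dot; clamp_cont_tac. }
  (* The imaginary part must be integrable too for the complex integral to split into components. *)
  have X2 : ex_RInt (fun x => snd (v x) * fst (w x) - fst (v x) * snd (w x)) 0 1.
  { apply: ex_RInt_clamp.
    change (clamp_cont (fun x => snd (v x) * fst (w x) - fst (v x) * snd (w x))).
    clamp_cont_tac. }
  have E1 x : Rmin 0 1 < x < Rmax 0 1 -> re_dot (v x) (w x) = fst (f x).
  { rewrite Rmin_left ?Rmax_right; [|lra|lra] => Hx; rewrite E // /re_dot /=; ring. }
  have E2 x : Rmin 0 1 < x < Rmax 0 1 ->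
    snd (v x) * fst (w x) - fst (v x) * snd (w x) = snd (f x).
  { rewrite Rmin_left ?Rmax_right; [|lra|lra] => Hx; rewrite E //=; ring. }
  rewrite CInt_pair.
  - rewrite -(RInt_ext _ _ _ _ E1); exact: RInt_correct.
  - exact: ex_RInt_ext E1 X1.
  - exact: ex_RInt_ext E2 X2.
Qed.

Lemma re_ip1 u1 u2 v1 v2 : continuous_on I01 v1 -> continuous_on I01 v2 ->
  (forall x, I01 x -> D01 u1 x = (RtoC x * v1 x)%C) ->
  (forall x, I01 x -> D01 u2 x = (RtoC x * v2 x)%C) ->
  is_RInt (fun x => re_dot (v1 x) (v2 x)) 0 1 (fst (ip1 u1 u2)).
Proof.
  move=> H1 H2 E1 E2; apply: re_CInt_conj => // x Hx.
  have Ix : I01 x by split; lra.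
  have Hx0 : RtoC x <> RtoC 0 by move/RtoC_inj; lra.
  rewrite E1 // E2 //.
  have -> : Cconj (RtoC x * v2 x) = (RtoC x * Cconj (v2 x))%C.
  { by apply: injective_projections => /=; ring. }
  have -> : RtoC (x ^ 2) = (RtoC x * RtoC x)%C by rewrite -RtoC_mult; congr RtoC; ring.
  by field.
Qed.

Lemma re_ip2 u1 u2 v1 v2 : continuous_on I01 v1 -> continuous_on I01 v2 ->
  (forall x, I01 x -> D01 u1 x = v1 x) -> (forall x, I01 x -> D01 u2 x = v2 x) ->
  is_RInt (fun x => re_dot (v1 x) (v2 x)) 0 1 (fst (ip2 u1 u2)).
Proof.
  move=> H1 H2 E1 E2; apply: re_CInt_conj => // x Hx.
  have Ix : I01 x by split; lra.
  by rewrite E1 // E2.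
Qed.

(** In the first component the terms u1 and -u2 cancel on differentiation, leaving -x u1'' + x u2'',
    divisible by x as the weight of H1 requires. In the second, u1'/x is the C^1 function v, with
    v(0) = 0 because u1''(0) = 0. *)
Lemma Lt_structure u1 u2 : domLt_1 u1 -> domLt_2 u2 ->
  Ht1 (Lt_1 u1 u2) /\ Ht2 (Lt_2 u1 u2) /\
  exists v v' w w' : R -> C,
    continuous_on I01 v' /\ continuous_on I01 w' /\
    (forall x, I01 x -> is_deriv01 v x (v' x)) /\
    (forall x, I01 x -> is_deriv01 w x (w' x)) /\ v 0 = RtoC 0 /\
    (forall x, I01 x -> D01 u1 x = (RtoC x * v x)%C) /\
    (forall x, I01 x -> D01 u2 x = w x) /\
    (forall x, I01 x -> D01 (Lt_1 u1 u2) x = (RtoC x * (w' x - v x - RtoC x * v' x))%C) /\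
    (forall x, I01 x -> D01 (Lt_2 u1 u2) x = (v' x - w x - RtoC x * w' x)%C).
Proof.
  move=> [Hu1 [u10 [p0 p'0]]] [Hu2 u20].
  have I0 : I01 0 by split; lra.
  have Hp : Ck01 2 (D01 u1) by case: Hu1.
  have Hq : Ck01 2 (D01 u2) by case: Hu2.
  have [v [v' [Hv' [dv [v0 pv]]]]] := C1_quotient _ Hp p0 p'0.
  pose q := D01 u2; pose q' := D01 q.
  have dp x : I01 x -> is_deriv01 (D01 u1) x (v x + RtoC x * v' x)%C.
  { move=> Hx; apply: (is_deriv01_ext (fun r => (RtoC r * v r)%C)) => //.
    apply: is_deriv01_mulX; exact: dv. }
  have dq x : I01 x -> is_deriv01 q x (q' x) by exact: (Ck01_D01 1).
  have dL1 x : I01 x ->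
    is_deriv01 (Lt_1 u1 u2) x (RtoC x * (q' x - v x - RtoC x * v' x))%C.
  { move=> Hx; rewrite /Lt_1.
    have -> : (RtoC x * (q' x - v x - RtoC x * v' x))%C =
      (- (D01 u1 x + RtoC x * (v x + RtoC x * v' x)) + D01 u1 x +
        (D01 u2 x + RtoC x * q' x) - D01 u2 x)%C by ring.
    apply: is_deriv01_minus => //; last exact: (Ck01_D01 2).
    apply: is_deriv01_plus; last by apply: is_deriv01_mulX; apply: dq.
    apply: is_deriv01_plus; last exact: (Ck01_D01 2).
    apply: is_deriv01_opp => //; apply: is_deriv01_mulX; exact: dp. }
  have L2E x : I01 x -> (v x - RtoC x * q x)%C = Lt_2 u1 u2 x.
  { move=> Hx; rewrite /Lt_2 pv -/q; case: (Req_dec x 0) => [->|Hx0].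
    - rewrite v0; ring.
    - rewrite RtoC_inv //; field; by move/RtoC_inj. }
  have dL2 x : I01 x -> is_deriv01 (Lt_2 u1 u2) x (v' x - q x - RtoC x * q' x)%C.
  { move=> Hx; apply: (is_deriv01_ext (fun r => (v r - RtoC r * q r)%C)) => //.
    have -> : (v' x - q x - RtoC x * q' x)%C = (v' x - (q x + RtoC x * q' x))%C by ring.
    apply: is_deriv01_minus => //; first exact: dv.
    apply: is_deriv01_mulX; exact: dq. }
  have Cq' : Ck01 1 q' by case: Hq.
  split; [|split].
  - split; [|split].
    + rewrite /Lt_1; apply: Ck01_minus; last exact: Ck01_pred.
      apply: Ck01_plus; last exact: Ck01_mulX.
      apply: Ck01_plus; last exact: Ck01_pred.
      apply: Ck01_opp; exact: Ck01_mulX.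
    + rewrite /Lt_1 u10 u20 p0; ring.
    + rewrite (D01_eq _ _ _ I0 (dL1 0 I0)); ring.
  - split.
    + apply: (Ck01_intro _ _ _ dL2).
      change (continuous_on I01 (fun x => (v' x - q x - RtoC x * q' x)%C)).
      apply: (Ck01_minus 0); last by apply: (Ck01_mulX 0); apply: Ck01_pred.
      apply: (Ck01_minus 0) => //; exact: (Ck01_continuous 2).
    + rewrite -L2E // v0; ring.
  - exists v, v', q, q'; do !split => //.
    + exact: (Ck01_continuous 1).
    + by move=> x Hx; apply: D01_eq => //; apply: dL1.
    + by move=> x Hx; apply: D01_eq => //; apply: dL2.
Qed.

(* With [v = a + i b], [w = c + i d], the energy flux is
   [- x |v|^2 - x |w|^2 + 2 Re (v conj w)]. *)
Lemma energy_flux_deriv (a b c d : R -> R) x a' b' c' d' :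
  is_derive a x a' -> is_derive b x b' -> is_derive c x c' -> is_derive d x d' ->
  is_derive (fun t => 2 * (a t * c t + b t * d t) -
      t * (a t * a t + b t * b t) - t * (c t * c t + d t * d t)) x
    (2 * (((c' - a x - x * a') * a x + (d' - b x - x * b') * b x) +
          ((a' - c x - x * c') * c x + (b' - d x - x * d') * d x)) +
     ((a x * a x + b x * b x) + (c x * c x + d x * d x))).
Proof.
  move=> Ha Hb Hc Hd; auto_derive.
  - by do !split; eexists; eassumption.
  - rewrite (is_derive_unique _ _ _ Ha) (is_derive_unique _ _ _ Hb).
    rewrite (is_derive_unique _ _ _ Hc) (is_derive_unique _ _ _ Hd); ring.
Qed.

Lemma Lt_dissipative_form u1 u2 : domLt_1 u1 -> domLt_2 u2 ->
  2 * (fst (ip1 (Lt_1 u1 u2) u1) + fst (ip2 (Lt_2 u1 u2) u2)) +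
  (fst (ip1 u1 u1) + fst (ip2 u2 u2)) <= 0.
Proof.
  move=> H1 H2.
  have [_ [_ [v [v' [w [w' [Hv' [Hw' [dv [dw [v0 [E1 [E2 [E3 E4]]]]]]]]]]]]]] :=
    Lt_structure _ _ H1 H2.
  have Hv : continuous_on I01 v.
  { apply: (Ck01_continuous 1); exact: (Ck01_intro 0 _ _ dv). }
  have Hw : continuous_on I01 w.
  { apply: (Ck01_continuous 1); exact: (Ck01_intro 0 _ _ dw). }
  have HL1 : continuous_on I01 (fun x => (w' x - v x - RtoC x * v' x)%C).
  { by apply: (Ck01_minus 0); [apply: (Ck01_minus 0)|apply: (Ck01_mulX 0)]. }
  have HL2 : continuous_on I01 (fun x => (v' x - w x - RtoC x * w' x)%C).
  { by apply: (Ck01_minus 0); [apply: (Ck01_minus 0)|apply: (Ck01_mulX 0)]. }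
  have R1 := re_ip1 _ _ _ _ HL1 Hv E3 E1.
  have R2 := re_ip2 _ _ _ _ HL2 Hw E4 E2.
  have R3 := re_ip1 _ _ _ _ Hv Hv E1 E1.
  have R4 := re_ip2 _ _ _ _ Hw Hw E2 E2.
  have R := is_RInt_plus _ _ _ _ _ _
    (is_RInt_scal _ _ _ 2 _ (is_RInt_plus _ _ _ _ _ _ R1 R2)) (is_RInt_plus _ _ _ _ _ _ R3 R4).
  have := is_RInt_unique _ _ _ _ R; rewrite /plus /scal /= /mult /= => <-.
  have cv c (Hc : component c) := clamp_cont_component c v Hc Hv.
  have cw c (Hc : component c) := clamp_cont_component c w Hc Hw.
  have cv' c (Hc : component c) := clamp_cont_component c v' Hc Hv'.
  have cw' c (Hc : component c) := clamp_cont_component c w' Hc Hw'.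
  have Cf : component fst by left. have Cs : component snd by right.
  have := (cv _ Cf, cv _ Cs, cw _ Cf, cw _ Cs, (cv' _ Cf, cv' _ Cs, cw' _ Cf, cw' _ Cs)).
  move=> [[[[c1 c2] c3] c4] [[[c5 c6] c7] c8]].
  pose a t := fst (v t); pose b t := snd (v t); pose c t := fst (w t); pose d t := snd (w t).
  pose a' t := fst (v' t); pose b' t := snd (v' t).
  pose c' t := fst (w' t); pose d' t := snd (w' t).
  pose e x := (2 * (((c' x - a x - x * a' x) * a x + (d' x - b x - x * b' x) * b x) +
          ((a' x - c x - x * c' x) * c x + (b' x - d x - x * d' x) * d x)) +
     ((a x * a x + b x * b x) + (c x * c x + d x * d x))).
  pose E t := 2 * (a t * c t + b t * d t) -
      t * (a t * a t + b t * b t) - t * (c t * c t + d t * d t).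
  rewrite (RInt_ext _ e); last first.
  { move=> x _; rewrite /e /re_dot /a /b /c /d /a' /b' /c' /d' /=; ring. }
  rewrite (ftc01 E e).
  (* The flux at 0 is 2 Re (v(0) conj w(0)), where w(0) is arbitrary; v(0) = 0 is what makes it
     vanish. *)
  - have a0 : a 0 = 0 by rewrite /a v0.
    have b0 : b 0 = 0 by rewrite /b v0.
    rewrite /E a0 b0.
    have := pow2_ge_0 (a 1 - c 1); have := pow2_ge_0 (b 1 - d 1); nra.
  - change (clamp_cont E); rewrite /E; clamp_cont_tac.
  - change (clamp_cont e); rewrite /e; clamp_cont_tac.
  - move=> x Hx; have Ix : I01 x by split; lra.
    by apply: energy_flux_deriv; apply: component_deriv => //; [apply: dv|apply: dv|apply: dw|apply: dw].
Qed.

(** * The operator in the energy space *)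

Section Hilbert.
Context (H : HilbertSpace).
Implicit Types x y z : H.

Lemma inner_self x : fst (inner H x x) = norm x ^ 2.
Proof. by rewrite inner_norm. Qed.

Lemma inner_plus_r x y z : inner H x (plus y z) = (inner H x y + inner H x z)%C.
Proof.
  rewrite inner_conj inner_plus_l (inner_conj H x y) (inner_conj H x z).
  by apply: injective_projections => /=; ring.
Qed.

Lemma inner_scal_r (a : C) x y : inner H x (scal a y) = (Cconj a * inner H x y)%C.
Proof.
  rewrite inner_conj inner_scal_l (inner_conj H x y).
  by apply: injective_projections => /=; ring.
Qed.

Lemma norm_sq_expand m x z :
  norm (minus (scal (RtoC m) x) z) ^ 2 =
  m ^ 2 * norm x ^ 2 - 2 * m * fst (inner H z x) + norm z ^ 2.
Proof.
  rewrite -!inner_self.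
  have -> : minus (scal (RtoC m) x) z = plus (scal (RtoC m) x) (scal (RtoC (-1)) z) by vring.
  rewrite !inner_plus_l !inner_plus_r !inner_scal_l !inner_scal_r (inner_conj H z x) /=; ring.
Qed.

End Hilbert.

Section Embedding.
Context {P : (R -> C) -> Prop} {ip : (R -> C) -> (R -> C) -> C} (H : Completion P ip).
Context (Pplus : forall u v, P u -> P v -> P (fun r => (u r + v r)%C)).
Context (Pscal : forall (a : C) u, P u -> P (fun r => (a * u r)%C)).

Lemma embed_diff u v : P u -> P v ->
  minus (embed H u) (embed H v) = embed H (fun r => (u r + RtoC (-1) * v r)%C).
Proof.
  move=> Hu Hv; rewrite embed_plus //; last exact: Pscal.
  rewrite embed_scal //; vring.
Qed.

Lemma embed_dist_sq u v : P u -> P v ->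
  norm (minus (embed H u) (embed H v)) ^ 2 =
  fst (ip (fun r => (u r + RtoC (-1) * v r)%C) (fun r => (u r + RtoC (-1) * v r)%C)).
Proof.
  move=> Hu Hv; rewrite embed_diff // -inner_self embed_inner //; apply: Pplus => //; exact: Pscal.
Qed.

End Embedding.

Lemma Ht1_plus u v : Ht1 u -> Ht1 v -> Ht1 (fun r => (u r + v r)%C).
Proof.
  move=> [Hu [u0 u0']] [Hv [v0 v0']]; split; [exact: Ck01_plus|split].
  - rewrite u0 v0; ring.
  - have I0 : I01 0 by split; lra.
    rewrite (D01_eq _ _ _ I0 (is_deriv01_plus _ _ _ _ _ (Ck01_D01 1 _ _ Hu I0) (Ck01_D01 1 _ _ Hv I0))).
    rewrite u0' v0'; ring.
Qed.

Lemma Ht1_scal (a : C) u : Ht1 u -> Ht1 (fun r => (a * u r)%C).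
Proof.
  move=> [Hu [u0 u0']]; split; [exact: Ck01_scal|split].
  - rewrite u0; ring.
  - have I0 : I01 0 by split; lra.
    rewrite (D01_eq _ _ _ I0 (is_deriv01_scal a _ _ _ (Ck01_D01 1 _ _ Hu I0))) u0'; ring.
Qed.

Lemma Ht2_plus u v : Ht2 u -> Ht2 v -> Ht2 (fun r => (u r + v r)%C).
Proof. move=> [Hu u0] [Hv v0]; split; [exact: Ck01_plus|rewrite u0 v0; ring]. Qed.

Lemma Ht2_scal (a : C) u : Ht2 u -> Ht2 (fun r => (a * u r)%C).
Proof. move=> [Hu u0]; split; [exact: Ck01_scal|rewrite u0; ring]. Qed.

Lemma D01_plus k u v x : Ck01 (S k) u -> Ck01 (S k) v -> I01 x ->
  D01 (fun r => (u r + v r)%C) x = (D01 u x + D01 v x)%C.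
Proof.
  move=> Hu Hv Ix; apply: D01_eq => //.
  by apply: is_deriv01_plus; apply: (Ck01_D01 k).
Qed.

Lemma D01_scal k (a : C) u x : Ck01 (S k) u -> I01 x ->
  D01 (fun r => (a * u r)%C) x = (a * D01 u x)%C.
Proof. move=> Hu Ix; apply: D01_eq => //; apply: is_deriv01_scal; exact: (Ck01_D01 k). Qed.

Lemma D01_diff k u v x : Ck01 (S k) u -> Ck01 (S k) v -> I01 x ->
  D01 (fun r => (u r + RtoC (-1) * v r)%C) x = (D01 u x - D01 v x)%C.
Proof.
  move=> Hu Hv Ix; rewrite (D01_plus k) //; last exact: Ck01_scal.
  rewrite (D01_scal k) //; by apply: injective_projections => /=; ring.
Qed.

Section Energy.
Context (H1 : Completion Ht1 ip1) (H2 : Completion Ht2 ip2).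

(** The bridge between the abstract completion and L^2: distances of embedded functions become
    integrals in the quotients u'/x. *)
Lemma embed1_dist (u v a b : R -> C) : Ht1 u -> Ht1 v ->
  continuous_on I01 a -> continuous_on I01 b ->
  (forall x, I01 x -> D01 u x = (RtoC x * a x)%C) ->
  (forall x, I01 x -> D01 v x = (RtoC x * b x)%C) ->
  is_RInt (fun x => Cmod (a x - b x)%C ^ 2) 0 1 (norm (minus (embed H1 u) (embed H1 v)) ^ 2).
Proof.
  move=> Hu Hv Ha Hb Ea Eb.
  rewrite (embed_dist_sq H1 Ht1_plus Ht1_scal) //.
  apply: (is_RInt_ext (fun x => re_dot (a x - b x)%C (a x - b x)%C)).
  - move=> x _; exact: re_dot_self.
  - have E x : I01 x -> D01 (fun r => (u r + RtoC (-1) * v r)%C) x = (RtoC x * (a x - b x))%C.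
    { move=> Ix; rewrite (D01_diff 1) //; [|by case: Hu|by case: Hv].
      rewrite Ea // Eb //; ring. }
    apply: re_ip1 => //; exact: (Ck01_minus 0).
Qed.

Lemma embed2_dist (u v a b : R -> C) : Ht2 u -> Ht2 v ->
  continuous_on I01 a -> continuous_on I01 b ->
  (forall x, I01 x -> D01 u x = a x) -> (forall x, I01 x -> D01 v x = b x) ->
  is_RInt (fun x => Cmod (a x - b x)%C ^ 2) 0 1 (norm (minus (embed H2 u) (embed H2 v)) ^ 2).
Proof.
  move=> Hu Hv Ha Hb Ea Eb.
  rewrite (embed_dist_sq H2 Ht2_plus Ht2_scal) //.
  apply: (is_RInt_ext (fun x => re_dot (a x - b x)%C (a x - b x)%C)).
  - move=> x _; exact: re_dot_self.
  - have E x : I01 x -> D01 (fun r => (u r + RtoC (-1) * v r)%C) x = (a x - b x)%C.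
    { move=> Ix; rewrite (D01_diff 0) //; [|by case: Hu|by case: Hv].
      by rewrite Ea // Eb. }
    apply: re_ip2 => //; exact: (Ck01_minus 0).
Qed.

Lemma norm_0_of_RInt {X : NormedModule C_AbsRing} (x y : X) (a : R -> C) :
  is_RInt (fun t => Cmod (a t - a t)%C ^ 2) 0 1 (norm (minus x y) ^ 2) -> x = y.
Proof.
  move=> HI; apply: dist_eq_0.
  have HI0 : is_RInt (fun t => Cmod (a t - a t)%C ^ 2) 0 1 (scal (1 - 0) 0).
  { apply: (is_RInt_ext (fun _ => 0)); last exact: is_RInt_const.
    move=> t _; have -> : (a t - a t)%C = RtoC 0 by ring.
    rewrite Cmod_0 /=; ring. }
  have := is_RInt_unique _ _ _ _ HI; rewrite (is_RInt_unique _ _ _ _ HI0) /scal /= /mult /=.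
  have := norm_ge_0 (minus x y); nra.
Qed.

(** [embed] acts on total functions. Equality on [0,1] gives equal derivatives there, hence a common
    quotient and distance 0. *)
Lemma embed1_ext u v : Ht1 u -> Ht1 v -> (forall x, I01 x -> u x = v x) -> embed H1 u = embed H1 v.
Proof.
  move=> Hu Hv E; have [Cu [_ u0']] := Hu.
  have [a [Ha Ea]] := C0_quotient _ (proj2 Cu) u0'.
  apply: (norm_0_of_RInt _ _ a); apply: embed1_dist => // x Hx.
  rewrite -Ea; symmetry; apply: D01_ext => //; exists (D01 u x); exact: (Ck01_D01 1).
Qed.

Lemma embed2_ext u v : Ht2 u -> Ht2 v -> (forall x, I01 x -> u x = v x) -> embed H2 u = embed H2 v.
Proof.
  move=> Hu Hv E; have [Cu _] := Hu.
  apply: (norm_0_of_RInt _ _ (D01 u)); apply: embed2_dist => //; try by case: Cu.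
  move=> x Hx; symmetry; apply: D01_ext => //; exists (D01 u x); exact: (Ck01_D01 0).
Qed.

Lemma domLt_1_Ht1 u : domLt_1 u -> Ht1 u.
Proof. by move=> [Hu [u0 [u0' _]]]; split; [exact: Ck01_pred|]. Qed.

Lemma domLt_2_Ht2 u : domLt_2 u -> Ht2 u.
Proof. by move=> [Hu u0]; split=> //; do 2 apply: Ck01_pred. Qed.

Lemma domLt_1_intro u : Ht1 u -> Ck01 3 u -> D01 (D01 u) 0 = RtoC 0 -> domLt_1 u.
Proof. by move=> [_ [u0 u0']]. Qed.

Lemma domLt_1_plus u v : domLt_1 u -> domLt_1 v -> domLt_1 (fun r => (u r + v r)%C).
Proof.
  move=> Hu Hv; have I0 : I01 0 by split; lra.
  move: (Hu) (Hv) => [Cu [_ [_ u0]]] [Cv [_ [_ v0]]].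
  apply: domLt_1_intro; [by apply: Ht1_plus; apply: domLt_1_Ht1|exact: Ck01_plus|].
  rewrite -(D01_ext (fun r => (D01 u r + D01 v r)%C)) //.
  - rewrite (D01_plus 1) //; [|by case: Cu|by case: Cv].
    rewrite u0 v0; ring.
  - by move=> y Hy; rewrite (D01_plus 2).
  - exists (D01 (D01 u) 0 + D01 (D01 v) 0)%C.
    by apply: is_deriv01_plus; apply: (Ck01_D01 1) => //; [case: Cu|case: Cv].
Qed.

Lemma domLt_1_scal (a : C) u : domLt_1 u -> domLt_1 (fun r => (a * u r)%C).
Proof.
  move=> Hu; have I0 : I01 0 by split; lra.
  move: (Hu) => [Cu [_ [_ u0]]].
  apply: domLt_1_intro; [by apply: Ht1_scal; apply: domLt_1_Ht1|exact: Ck01_scal|].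
  rewrite -(D01_ext (fun r => (a * D01 u r)%C)) //.
  - rewrite (D01_scal 1) //; last by case: Cu.
    rewrite u0; ring.
  - by move=> y Hy; rewrite (D01_scal 2).
  - exists (a * D01 (D01 u) 0)%C.
    by apply: is_deriv01_scal; apply: (Ck01_D01 1) => //; case: Cu.
Qed.

Lemma domLt_2_plus u v : domLt_2 u -> domLt_2 v -> domLt_2 (fun r => (u r + v r)%C).
Proof. move=> [Hu u0] [Hv v0]; split; [exact: Ck01_plus|rewrite u0 v0; ring]. Qed.

Lemma domLt_2_scal (a : C) u : domLt_2 u -> domLt_2 (fun r => (a * u r)%C).
Proof. move=> [Hu u0]; split; [exact: Ck01_scal|rewrite u0; ring]. Qed.

(** [Lt] of a combination equals the combination of the images on [0,1] only, since [D01] is linear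
    only there; [embed1_ext] and [embed2_ext] absorb the difference. *)
Lemma Lt_linear_graph : linear_graph (Lt_graph H1 H2).
Proof.
  split.
  - move=> x y x' y' [u1 [u2 [D1 [D2 [-> ->]]]]] [w1 [w2 [D1' [D2' [-> ->]]]]].
    have [L1 [L2 _]] := Lt_structure _ _ D1 D2; have [L1' [L2' _]] := Lt_structure _ _ D1' D2'.
    have S1 := domLt_1_plus _ _ D1 D1'; have S2 := domLt_2_plus _ _ D2 D2'.
    have [T1 [T2 _]] := Lt_structure _ _ S1 S2.
    exists (fun r => (u1 r + w1 r)%C), (fun r => (u2 r + w2 r)%C); do 3 split=> //.
    + rewrite !embed_plus //; try exact: domLt_1_Ht1; exact: domLt_2_Ht2.
    + have -> : embed H1 (Lt_1 (fun r => (u1 r + w1 r)%C) (fun r => (u2 r + w2 r)%C)) =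
        embed H1 (fun r => (Lt_1 u1 u2 r + Lt_1 w1 w2 r)%C).
      { apply: embed1_ext => //; first exact: Ht1_plus.
        move=> r Ir; rewrite /Lt_1 !(D01_plus 2) //; [ring|by case: D2|by case: D2'|by case: D1|by case: D1']. }
      have -> : embed H2 (Lt_2 (fun r => (u1 r + w1 r)%C) (fun r => (u2 r + w2 r)%C)) =
        embed H2 (fun r => (Lt_2 u1 u2 r + Lt_2 w1 w2 r)%C).
      { apply: embed2_ext => //; first exact: Ht2_plus.
        move=> r Ir; rewrite /Lt_2 !(D01_plus 2) //; [ring|by case: D2|by case: D2'|by case: D1|by case: D1']. }
      by rewrite (embed_plus _ _ H1 _ _ L1 L1') (embed_plus _ _ H2 _ _ L2 L2').
  - move=> c x y [u1 [u2 [D1 [D2 [-> ->]]]]].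
    have [L1 [L2 _]] := Lt_structure _ _ D1 D2.
    have S1 := domLt_1_scal c _ D1; have S2 := domLt_2_scal c _ D2.
    have [T1 [T2 _]] := Lt_structure _ _ S1 S2.
    exists (fun r => (c * u1 r)%C), (fun r => (c * u2 r)%C); do 3 split=> //.
    + rewrite !embed_scal //; try exact: domLt_1_Ht1; exact: domLt_2_Ht2.
    + have -> : embed H1 (Lt_1 (fun r => (c * u1 r)%C) (fun r => (c * u2 r)%C)) =
        embed H1 (fun r => (c * Lt_1 u1 u2 r)%C).
      { apply: embed1_ext => //; first exact: Ht1_scal.
        move=> r Ir; rewrite /Lt_1 !(D01_scal 2) //; [ring|by case: D2|by case: D1]. }
      have -> : embed H2 (Lt_2 (fun r => (c * u1 r)%C) (fun r => (c * u2 r)%C)) =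
        embed H2 (fun r => (c * Lt_2 u1 u2 r)%C).
      { apply: embed2_ext => //; first exact: Ht2_scal.
        move=> r Ir; rewrite /Lt_2 !(D01_scal 2) //; [ring|by case: D2|by case: D1]. }
      by rewrite (embed_scal _ _ H1 _ _ L1) (embed_scal _ _ H2 _ _ L2).
Qed.

Lemma Hsp_norm_sq (x : Hsp H1 H2) : norm x ^ 2 = norm (fst x) ^ 2 + norm (snd x) ^ 2.
Proof.
  rewrite [norm x]/(sqrt (norm (fst x) ^ 2 + norm (snd x) ^ 2)) pow2_sqrt //.
  have := pow2_ge_0 (norm (fst x)); have := pow2_ge_0 (norm (snd x)); lra.
Qed.

(** For m = l - w and z = y - w x one has Re (z|x) <= 0, so the expansion of |m x - z|^2 is at least
    m^2 |x|^2. *)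
Lemma Hsp_dissipative w (x y : Hsp H1 H2) l :
  fst (inner H1 (fst y) (fst x)) + fst (inner H2 (snd y) (snd x)) <= w * norm x ^ 2 ->
  w < l -> (l - w) * norm x <= norm (minus (scal (RtoC l) x) y).
Proof.
  move=> F Hl.
  pose z : Hsp H1 H2 := minus y (scal (RtoC w) x).
  have -> : minus (scal (RtoC l) x) y = minus (scal (RtoC (l - w)) x) z by (rewrite /z; vring).
  set m := l - w; have Hm : 0 < m by rewrite /m; lra.
  have E : norm (minus (scal (RtoC m) x) z) ^ 2 =
    norm (minus (scal (RtoC m) (fst x)) (fst z)) ^ 2 +
    norm (minus (scal (RtoC m) (snd x)) (snd z)) ^ 2 by exact: Hsp_norm_sq.
  have Z1 : fst (inner H1 (fst z) (fst x)) = fst (inner H1 (fst y) (fst x)) - w * norm (fst x) ^ 2.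
  { have -> : fst z = plus (fst y) (scal (RtoC (- w)) (fst x)).
    { change (fst z) with (minus (fst y) (scal (RtoC w) (fst x))); vring. }
    rewrite inner_plus_l inner_scal_l inner_norm /=; ring. }
  have Z2 : fst (inner H2 (snd z) (snd x)) = fst (inner H2 (snd y) (snd x)) - w * norm (snd x) ^ 2.
  { have -> : snd z = plus (snd y) (scal (RtoC (- w)) (snd x)).
    { change (snd z) with (minus (snd y) (scal (RtoC w) (snd x))); vring. }
    rewrite inner_plus_l inner_scal_l inner_norm /=; ring. }
  rewrite !norm_sq_expand Z1 Z2 in E.
  rewrite Hsp_norm_sq in F.
  have Nx := Hsp_norm_sq x.
  have P1 := pow2_ge_0 (norm (fst z)); have P2 := pow2_ge_0 (norm (snd z)).
  have N0 := norm_ge_0 (minus (scal (RtoC m) x) z).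
  apply: Rnot_lt_le => Hlt.
  have : norm (minus (scal (RtoC m) x) z) ^ 2 < (m * norm x) ^ 2.
  { rewrite /= !Rmult_1_r; apply: Rmult_le_0_lt_compat => //. }
  rewrite Rpow_mult_distr Nx E; nra.
Qed.

Lemma Lt_dissipative : dissipative (- (1 / 2)) (Lt_graph H1 H2).
Proof.
  move=> l x y Hl [u1 [u2 [D1 [D2 [-> ->]]]]].
  have [L1 [L2 _]] := Lt_structure _ _ D1 D2.
  have F := Lt_dissipative_form _ _ D1 D2.
  have N1 := domLt_1_Ht1 _ D1; have N2 := domLt_2_Ht2 _ D2.
  apply: Hsp_dissipative Hl.
  rewrite -!(embed_inner _ _ H1) // -!(embed_inner _ _ H2) // !inner_self in F.
  rewrite Hsp_norm_sq /=; move: F => /=; lra.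
Qed.

End Energy.

(** * Weierstrass approximation *)

(** Generated by the operations that the lifting argument follows by induction; [poly_ext] lets
    polynomials be handled up to pointwise equality. *)
Inductive is_poly : (R -> R) -> Prop :=
  | poly_const c : is_poly (fun _ => c)
  | poly_plus p q : is_poly p -> is_poly q -> is_poly (fun x => p x + q x)
  | poly_mulX p : is_poly p -> is_poly (fun x => x * p x)
  | poly_ext p q : (forall x, p x = q x) -> is_poly p -> is_poly q.

Lemma poly_scal c p : is_poly p -> is_poly (fun x => c * p x).
Proof.
  elim=> {p} [a|p q _ Hp _ Hq|p _ Hp|p q E _ Hp].
  - exact: poly_const.
  - by apply: poly_ext (poly_plus _ _ Hp Hq) => x; ring.
  - by apply: poly_ext (poly_mulX _ Hp) => x; ring.
  - by apply: poly_ext Hp => x; rewrite E.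
Qed.

(* The Bernstein operator, [bernstein n g x = E (g K)] for a binomial variable
   [K] of parameters [n] and [x], by conditioning on the first trial. *)
Fixpoint bernstein (n : nat) (g : nat -> R) (x : R) : R :=
  match n with
  | O => g O
  | S n => (1 - x) * bernstein n g x + x * bernstein n (fun k => g (S k)) x
  end.

Lemma bernstein_poly n g : is_poly (bernstein n g).
Proof.
  elim: n g => [|n IH] g; first exact: poly_const.
  have H1 := IH g; have H2 := IH (fun k => g (S k)).
  apply: poly_ext (poly_plus _ _ H1 (poly_mulX _ (poly_plus _ _ H2 (poly_scal (-1) _ H1)))).
  move=> x /=; ring.
Qed.

Lemma bernstein_le n g h x : 0 <= x <= 1 -> (forall k, (k <= n)%nat -> g k <= h k) ->
  bernstein n g x <= bernstein n h x.
Proof.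
  move=> Hx; elim: n g h => [|n IH] g h H /=; first exact: H.
  have := IH g h (fun k Hk => H k (le_S _ _ Hk)).
  have := IH (fun k => g (S k)) (fun k => h (S k)) (fun k Hk => H _ (le_n_S _ _ Hk)).
  nra.
Qed.

Lemma bernstein_ext n g h x : (forall k, g k = h k) -> bernstein n g x = bernstein n h x.
Proof.
  elim: n g h => [|n IH] g h E /=; first exact: E.
  by rewrite (IH g h) // (IH (fun k => g (S k)) (fun k => h (S k))).
Qed.

Lemma bernstein_affine n a b g x :
  bernstein n (fun k => a + b * g k) x = a + b * bernstein n g x.
Proof.
  elim: n g => [|n IH] g //=.
  rewrite IH (IH (fun k => g (S k))); ring.
Qed.

(** For a binomial K this is E (K + c)^2 = (E K + c)^2 + Var K. The shift c is general because
    conditioning on a success replaces c by c + 1. *)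
Lemma bernstein_square n c x :
  bernstein n (fun k => (INR k + c) ^ 2) x = (INR n * x + c) ^ 2 + INR n * x * (1 - x).
Proof.
  elim: n c => [|n IH] c; first by rewrite /=; ring.
  have E : forall y, bernstein n (fun k => (INR (S k) + c) ^ 2) y =
                     bernstein n (fun k => (INR k + (c + 1)) ^ 2) y.
  { move=> y; apply: bernstein_ext => k; rewrite S_INR; ring. }
  rewrite [bernstein (S n) _ x]/=.
  change ((1 - x) * bernstein n (fun k => (INR k + c) ^ 2) x +
          x * bernstein n (fun k => (INR (S k) + c) ^ 2) x =
          (INR (S n) * x + c) ^ 2 + INR (S n) * x * (1 - x)).
  rewrite E !IH S_INR; ring.
Qed.

(** Bernstein's proof: |f(x) - f(y)| <= eps/3 + K (x - y)^2 on [0,1], and the expectation of the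
    quadratic term is K times the variance x (1 - x)/n of the empirical mean. *)
Lemma weierstrass (f : R -> R) eps : (forall x, continuous f x) -> 0 < eps ->
  exists p, is_poly p /\ forall x, 0 <= x <= 1 -> Rabs (f x - p x) < eps.
Proof.
  move=> Hf He.
  have Hc x : 0 <= x <= 1 -> continuity_pt f x by move=> _; apply/continuity_pt_filterlim; apply: Hf.
  have [Mx [HMx _]] := continuity_ab_maj f 0 1 Rle_0_1 Hc.
  have [mx [Hmx _]] := continuity_ab_min f 0 1 Rle_0_1 Hc.
  set M := f Mx - f mx.
  have He2 : 0 < eps / 3 by lra.
  have [[d Hd] D] := Heine_cor2 Hc (mkposreal _ He2); rewrite /= in D.
  have HM : 0 <= M.
  { have := HMx 0 ltac:(lra); have := Hmx 0 ltac:(lra); rewrite /M; lra. }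
  (* Beyond distance d the oscillation M is dominated by K (x - y)^2; within it, uniform continuity
     gives eps/3. *)
  pose K := M / d ^ 2.
  have Hd2 : 0 < d ^ 2 by apply: pow_lt.
  have HK : 0 <= K by apply: Rdiv_le_0_compat.
  have KE : K * d ^ 2 = M by rewrite /K; field; lra.
  have modulus x y : 0 <= x <= 1 -> 0 <= y <= 1 -> Rabs (f x - f y) <= eps / 3 + K * (x - y) ^ 2.
  { move=> Hx Hy; have Hsq := pow2_ge_0 (x - y).
    case: (Rlt_dec (Rabs (x - y)) d) => Hxy.
    - have := D x y Hx Hy Hxy; nra.
    - have : d ^ 2 <= (x - y) ^ 2.
      { rewrite -(pow2_abs (x - y)); apply: pow_incr; lra. }
      have : Rabs (f x - f y) <= M.
      { apply: Rabs_le; have := HMx x Hx; have := HMx y Hy.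
        have := Hmx x Hx; have := Hmx y Hy; rewrite /M; lra. }
      nra. }
  have [n Hn] : exists n : nat, 0 < INR n /\ K < eps / 3 * INR n.
  { have [n Hn] := nfloor_ex (K / (eps / 3)) (Rdiv_le_0_compat _ _ HK He2).
    exists (S n); rewrite S_INR; have := pos_INR n; split; first lra.
    have E : K = eps / 3 * (K / (eps / 3)) by field; lra.
    rewrite {1}E; apply: Rmult_lt_compat_l; lra. }
  exists (bernstein n (fun k => f (INR k / INR n))); split; first exact: bernstein_poly.
  move=> x Hx.
  pose h k := eps / 3 + K / INR n ^ 2 * (INR k + - (INR n * x)) ^ 2.
  have Hg k : (k <= n)%nat -> Rabs (f (INR k / INR n) - f x) <= h k.
  { move=> /le_INR Hk; rewrite /h.
    have -> : K / INR n ^ 2 * (INR k + - (INR n * x)) ^ 2 = K * (INR k / INR n - x) ^ 2.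
    { field; lra. }
    apply: modulus => //; split.
    - apply: Rdiv_le_0_compat; [exact: pos_INR|lra].
    - apply: (Rmult_le_reg_r (INR n)); first lra.
      have -> : INR k / INR n * INR n = INR k by field; lra.
      lra. }
  have Hh : bernstein n h x < 2 * (eps / 3).
  { rewrite /h bernstein_affine bernstein_square.
    have -> : K / INR n ^ 2 * ((INR n * x + - (INR n * x)) ^ 2 + INR n * x * (1 - x)) =
      K / INR n * (x * (1 - x)) by field; lra.
    have : K / INR n < eps / 3.
    { apply: (Rmult_lt_reg_r (INR n)); first lra.
      have -> : K / INR n * INR n = K by field; lra.
      lra. }
    have : 0 <= K / INR n by apply: Rdiv_le_0_compat; lra.
    nra. }
  have U := bernstein_le n (fun k => f (INR k / INR n)) (fun k => f x + 1 * h k) x Hx.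
  have L := bernstein_le n (fun k => f x + -1 * h k) (fun k => f (INR k / INR n)) x Hx.
  rewrite bernstein_affine in U; rewrite bernstein_affine in L.
  have {}U := U ltac:(by move=> k Hk; have := Rabs_le_between (f (INR k / INR n) - f x) (h k);
    move=> [B _]; have := B (Hg k Hk); lra).
  have {}L := L ltac:(by move=> k Hk; have := Rabs_le_between (f (INR k / INR n) - f x) (h k);
    move=> [B _]; have := B (Hg k Hk); lra).
  apply: Rabs_def1; lra.
Qed.

(** * Density of odd monomials *)

Definition mono (m : nat) (r : R) : C := RtoC (r ^ m).

Lemma mono_deriv m x : I01 x -> is_deriv01 (mono m) x (RtoC (INR m * x ^ pred m)).
Proof.
  move=> Ix; elim: m => [|m IH].
  - have -> : INR 0 * x ^ pred 0 = 0 by rewrite /=; ring.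
    exact: (is_deriv01_const (RtoC 1)).
  - apply: (is_deriv01_ext (fun r => (RtoC r * mono m r)%C)) => //.
    { by move=> y _; rewrite /mono -RtoC_mult. }
    have -> : RtoC (INR (S m) * x ^ pred (S m)) =
      (mono m x + RtoC x * RtoC (INR m * x ^ pred m))%C.
    { rewrite /mono -RtoC_mult -RtoC_plus S_INR; congr RtoC.
      by case: m {IH} => [|m]; rewrite /=; ring. }
    exact: is_deriv01_mulX.
Qed.

Lemma D01_mono m x : I01 x -> D01 (mono m) x = RtoC (INR m * x ^ pred m).
Proof. by move=> Ix; apply: D01_eq => //; apply: mono_deriv. Qed.

Lemma Ck01_mono k m : Ck01 k (mono m).
Proof.
  elim: m => [|m IH]; first exact: (Ck01_const k (RtoC 1)).
  apply: Ck01_ext (Ck01_mulX _ _ IH) => y _; by rewrite /mono -RtoC_mult.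
Qed.

Lemma Ht2_mono m : Ht2 (mono (S m)).
Proof. split; [exact: Ck01_mono|by rewrite /mono /= Rmult_0_l]. Qed.

Lemma Ht1_mono m : Ht1 (mono (S (S m))).
Proof.
  have I0 : I01 0 by split; lra.
  split; [exact: Ck01_mono|split].
  - by rewrite /mono /= Rmult_0_l.
  - by rewrite D01_mono //= Rmult_0_l Rmult_0_r.
Qed.

(** * Lifting polynomials in the square of the variable *)

Section PolynomialLift.
Context {P : (R -> C) -> Prop} {ip : (R -> C) -> (R -> C) -> C} (H : Completion P ip).
Context (Pplus : forall u v, P u -> P v -> P (fun r => (u r + v r)%C)).
Context (Pscal : forall (a : C) u, P u -> P (fun r => (a * u r)%C)).
Context (PC1 : forall u, P u -> Ck01 1 u).
Context (i : nat) (Pmono : forall j, P (mono (S (2 * (j + i))))).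
Context (M : H -> Prop) (Mplus : forall x y, M x -> M y -> M (plus x y)).
Context (Mscal : forall (a : C) x, M x -> M (scal a x)).
Context (Mmono : forall j, M (embed H (mono (S (2 * (j + i)))))).

(** Multiplying p by its variable raises the power of x by 2, that is j by 1, so j is quantified
    inside the induction. [M] is any linear set containing the odd monomials; [i] is 0 for H2 and 1
    for H1, whose lowest odd monomial is rho^3. *)
Lemma poly_lift p : is_poly p -> forall j, exists u, P u /\
  (forall x, I01 x -> D01 u x = RtoC (x ^ (2 * (j + i)) * p (x * x))) /\ M (embed H u).
Proof.
  elim=> {p} [c|p q _ Hp _ Hq|p _ Hp|p q E _ Hp] j.
  - set m := (2 * (j + i))%nat.
    exists (fun r => (RtoC (c / INR (S m)) * mono (S m) r)%C); split; [|split].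
    + apply: Pscal; exact: Pmono.
    + move=> x Ix; rewrite (D01_scal 0) //; last exact: Ck01_mono.
      rewrite D01_mono // -RtoC_mult; congr RtoC.
      have Hm : INR (S m) <> 0 by apply: not_0_INR.
      rewrite [pred (S m)]/=; move: (INR (S m)) Hm => t Ht; by field.
    + rewrite (embed_scal _ _ H _ _ (Pmono j)); apply: Mscal; exact: Mmono.
  - have [u [Hu [Du Mu]]] := Hp j; have [v [Hv [Dv Mv]]] := Hq j.
    exists (fun r => (u r + v r)%C); split; [exact: Pplus|split].
    + move=> x Ix; rewrite (D01_plus 0) //; try exact: PC1.
      rewrite Du // Dv // -RtoC_plus; congr RtoC; ring.
    + rewrite embed_plus //; exact: Mplus.
  - have [u [Hu [Du Mu]]] := Hp (S j); exists u; split=> //; split=> // x Ix.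
    rewrite Du //; congr RtoC.
    have -> : (2 * (S j + i) = 2 + 2 * (j + i))%nat by lia.
    rewrite pow_add /=; ring.
  - have [u [Hu [Du Mu]]] := Hp j; exists u; split=> //; split=> // x Ix.
    by rewrite Du // E.
Qed.

Lemma poly_lift_complex p q : is_poly p -> is_poly q -> exists u, P u /\
  (forall x, I01 x -> D01 u x = (RtoC (x ^ (2 * i)) * (p (x * x)%R, q (x * x)%R))%C) /\
  M (embed H u).
Proof.
  move=> Hp Hq; have [u [Hu [Du Mu]]] := poly_lift _ Hp 0%nat.
  have [v [Hv [Dv Mv]]] := poly_lift _ Hq 0%nat.
  exists (fun r => (u r + Ci * v r)%C); split; [by apply: Pplus => //; apply: Pscal|split].
  - move=> x Ix; rewrite (D01_plus 0) ?(D01_scal 0) //; try exact: PC1; last first.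
    { by apply: PC1; apply: Pscal. }
    rewrite Du // Dv //; by apply: injective_projections => /=; ring.
  - rewrite embed_plus ?embed_scal //; last exact: Pscal.
    by apply: Mplus => //; apply: Mscal.
Qed.

End PolynomialLift.

Lemma bounded01 (u : R -> C) : continuous_on I01 u ->
  exists B, 0 <= B /\ forall c x, component c -> I01 x -> Rabs (c (u x)) <= B.
Proof.
  move=> Hu.
  have HB c : component c -> exists B, forall x, I01 x -> Rabs (c (u x)) <= B.
  { move=> Hc; have HC := clamp_cont_component c u Hc Hu.
    have Hp x : 0 <= x <= 1 -> continuity_pt (fun t => c (u (clamp 0 1 t))) x.
    { move=> _; apply/continuity_pt_filterlim; exact: HC. }
    have [Mx [H1 _]] := continuity_ab_maj _ 0 1 Rle_0_1 Hp.
    have [mx [H2 _]] := continuity_ab_min _ 0 1 Rle_0_1 Hp.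
    exists (Rabs (c (u (clamp 0 1 Mx))) + Rabs (c (u (clamp 0 1 mx)))) => x Ix.
    have := H1 x Ix; have := H2 x Ix; rewrite (clamp_id 0 1 x Ix) => A1 A2.
    have B1 := Rle_abs (c (u (clamp 0 1 Mx))).
    have B2 := Rle_abs (- c (u (clamp 0 1 mx))); rewrite Rabs_Ropp in B2.
    have := Rabs_pos (c (u (clamp 0 1 Mx))); have := Rabs_pos (c (u (clamp 0 1 mx))).
    move=> ? ?; apply: Rabs_le; lra. }
  have [B1 H1] := HB fst (or_introl eq_refl).
  have [B2 H2] := HB snd (or_intror eq_refl).
  have I0 : I01 0 by split; lra.
  have P1 := Rle_trans _ _ _ (Rabs_pos _) (H1 0 I0).
  have P2 := Rle_trans _ _ _ (Rabs_pos _) (H2 0 I0).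
  exists (B1 + B2); split; first lra.
  by move=> c x [->|->] Ix; [have := H1 x Ix|have := H2 x Ix]; lra.
Qed.

(** The substitution s = x^2 turns approximation by even polynomials into Weierstrass's theorem; the
    clamp makes the function continuous on all of R. *)
Lemma sqrt_clamp_continuous c (u : R -> C) x : component c -> continuous_on I01 u ->
  continuous (fun s => c (u (clamp 0 1 (sqrt s)))) x.
Proof.
  move=> Hc Hu; apply: (continuous_comp sqrt (fun t => c (u (clamp 0 1 t)))).
  - exact: continuous_sqrt.
  - exact: (clamp_cont_component c u Hc Hu (sqrt x)).
Qed.

Lemma sq_le_of_Rabs_le t b : Rabs t <= b -> t ^ 2 <= b ^ 2.
Proof. by move=> H; rewrite -(pow2_abs t); apply: pow_incr; split=> //; apply: Rabs_pos. Qed.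

Lemma Cmod_sq z : Cmod z ^ 2 = fst z ^ 2 + snd z ^ 2.
Proof. exact: Cmod2_alt. Qed.

(** The square of 1 - x/(x + d), the relative error of the regularised division below; its integral
    is at most d. *)
Lemma is_RInt_cutoff d : 0 < d ->
  is_RInt (fun x => (d / (x + d)) ^ 2) 0 1 (d / (1 + d)).
Proof.
  move=> Hd.
  have -> : d / (1 + d) = minus (- d ^ 2 / (1 + d)) (- d ^ 2 / (0 + d)).
  { rewrite /minus /plus /opp /=; field; lra. }
  apply: (is_RInt_derive (fun x => - d ^ 2 / (x + d))).
  - move=> x; rewrite Rmin_left ?Rmax_right; [|lra|lra] => Hx.
    auto_derive; first lra. field; lra.
  - move=> x; rewrite Rmin_left ?Rmax_right; [|lra|lra] => Hx.
    apply: ex_derive_continuous; auto_derive; lra.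
Qed.

Section Density.
Context (H1 : Completion Ht1 ip1) (H2 : Completion Ht2 ip2).

Lemma density_reduction {P : (R -> C) -> Prop} {ip} (H : Completion P ip) (M : H -> Prop) :
  (forall f eps, P f -> 0 < eps -> exists u, P u /\ M (embed H u) /\
     norm (minus (embed H f) (embed H u)) < eps) ->
  forall x eps, 0 < eps -> exists y, M y /\ norm (minus x y) < eps.
Proof.
  move=> HM x eps He.
  have [|f [Hf Df]] := embed_dense _ _ H x (eps / 2); first lra.
  have [|u [_ [Mu Du]]] := HM f (eps / 2) Hf; first lra.
  exists (embed H u); split=> //.
  apply: Rle_lt_trans (dist_triangle (embed H f) _ _) _.
  apply: Rlt_le_trans (Rplus_lt_compat _ _ _ _ Df Du) _; lra.
Qed.

(** Uniform approximation of w(sqrt s) by a polynomial p gives w(x) close to p(x^2), and the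
    primitives of even polynomials vanishing at 0 are combinations of odd monomials. *)
Lemma odd_monomials_dense2 (M : H2 -> Prop) :
  (forall x y, M x -> M y -> M (plus x y)) -> (forall (a : C) x, M x -> M (scal a x)) ->
  (forall j, M (embed H2 (mono (S (2 * j))))) ->
  forall x eps, 0 < eps -> exists y, M y /\ norm (minus x y) < eps.
Proof.
  move=> Mplus Mscal Mmono; apply: density_reduction => f eps Hf He.
  have Hw : continuous_on I01 (D01 f) by case: Hf => -[].
  have Cf : component fst by left. have Cs : component snd by right.
  have He2 : 0 < eps / 2 by lra.
  have [p [Hp Ap]] := weierstrass _ _ (fun x => sqrt_clamp_continuous fst _ x Cf Hw) He2.
  have [q [Hq Aq]] := weierstrass _ _ (fun x => sqrt_clamp_continuous snd _ x Cs Hw) He2.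
  have [|||u [Hu [Du Mu]]] := poly_lift_complex H2 Ht2_plus Ht2_scal _ 0%nat _ M Mplus Mscal _ p q Hp Hq.
  - by move=> u [].
  - move=> j; exact: Ht2_mono.
  - move=> j; rewrite Nat.add_0_r; exact: Mmono.
  - exists u; split=> //; split=> //.
    have Hu' : continuous_on I01 (D01 u) by case: Hu => -[].
    have HI := embed2_dist H2 f u _ _ Hf Hu Hw Hu' (fun _ _ => eq_refl) (fun _ _ => eq_refl).
    have HC : is_RInt (fun _ => eps ^ 2 / 2) 0 1 (scal (1 - 0) (eps ^ 2 / 2)) by apply: is_RInt_const.
    have LE := is_RInt_le _ _ _ _ _ _ Rle_0_1 HI HC.
    have {}LE : norm (minus (embed H2 f) (embed H2 u)) ^ 2 <= scal (1 - 0) (eps ^ 2 / 2).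
    { apply: LE => x Hx; have Ix : I01 x by split; lra.
      rewrite Du // Cmod_sq.
      rewrite [fst _](_ : _ = fst (D01 f x) - p (x * x)); last by (rewrite /=; ring).
      rewrite [snd _](_ : _ = snd (D01 f x) - q (x * x)); last by (rewrite /=; ring).
      have Ix2 : 0 <= x * x <= 1 by nra.
      have B1 := Ap _ Ix2; have B2 := Aq _ Ix2.
      have Hx0 : 0 <= x by lra.
      rewrite (sqrt_square x Hx0) (clamp_id 0 1 x Ix) in B1 B2.
      have := sq_le_of_Rabs_le _ _ (Rlt_le _ _ B1).
      have := sq_le_of_Rabs_le _ _ (Rlt_le _ _ B2); lra. }
    rewrite /scal /= /mult /= in LE.
    have := norm_ge_0 (minus (embed H2 f) (embed H2 u)); nra.
Qed.

(** Here v is to be approximated by x p(x^2), although v(0) may be nonzero and v(x)/x unbounded.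
    Dividing by x + d instead keeps the quotient continuous, at an L^2 cost that tends to 0 with
    d. *)
Lemma odd_monomials_dense1 (M : H1 -> Prop) :
  (forall x y, M x -> M y -> M (plus x y)) -> (forall (a : C) x, M x -> M (scal a x)) ->
  (forall j, M (embed H1 (mono (S (2 * (j + 1)))))) ->
  forall x eps, 0 < eps -> exists y, M y /\ norm (minus x y) < eps.
Proof.
  move=> Mplus Mscal Mmono; apply: density_reduction => f eps Hf He.
  have [v [Hv Ev]] : exists v : R -> C, continuous_on I01 v /\ forall x, D01 f x = (RtoC x * v x)%C.
  { by apply: C0_quotient; case: Hf => -[_ ?] [_ ?]. }
  have [B [HB Bv]] := bounded01 _ Hv.
  have He4 : 0 < eps / 4 by lra.
  (* Chosen so that the cutoff contributes 4 B^2 d <= eps^2 / 2; the polynomial error adds eps^2 /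
     4. *)
  pose d := eps ^ 2 / (8 * (B ^ 2 + 1)).
  have HB2 : 0 < B ^ 2 + 1 by have := pow2_ge_0 B; lra.
  have Hd : 0 < d by apply: Rdiv_lt_0_compat; [apply: pow_lt|lra].
  have cont c x : component c ->
    continuous (fun s => c (v (clamp 0 1 (sqrt s))) * / (sqrt s + d)) x.
  { move=> Hc; apply: (@continuous_mult R_UniformSpace R_AbsRing).
    - exact: (sqrt_clamp_continuous c v x Hc Hv).
    - apply: continuous_Rinv_comp; last by have := sqrt_pos x; lra.
      apply: (@continuous_plus R_UniformSpace R_AbsRing R_NormedModule).
      + exact: continuous_sqrt.
      + exact: continuous_const. }
  have Cf : component fst by left. have Cs : component snd by right.
  have [p [Hp Ap]] := weierstrass _ _ (fun x => cont fst x Cf) He4.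
  have [q [Hq Aq]] := weierstrass _ _ (fun x => cont snd x Cs) He4.
  have [||u [Hu [Du Mu]]] := poly_lift_complex H1 Ht1_plus Ht1_scal _ 1%nat _ M Mplus Mscal Mmono p q Hp Hq.
  - by move=> u [Cu _]; apply: Ck01_pred.
  - move=> j; have -> : (2 * (j + 1) = S (S (2 * j)))%nat by lia. exact: Ht1_mono.
  - exists u; split=> //; split=> //.
    have [a [Ha Ea]] : exists a : R -> C, continuous_on I01 a /\ forall x, D01 u x = (RtoC x * a x)%C.
    { by apply: C0_quotient; case: Hu => -[_ ?] [_ ?]. }
    have HI := embed1_dist H1 f u v a Hf Hu Hv Ha (fun x _ => Ev x) (fun x _ => Ea x).
    have HC := is_RInt_plus _ _ _ _ _ _ (is_RInt_scal _ _ _ (4 * B ^ 2) _ (is_RInt_cutoff d Hd))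
      (is_RInt_const 0 1 (eps ^ 2 / 4)).
    have LE := is_RInt_le _ _ _ _ _ _ Rle_0_1 HI HC.
    have {}LE : norm (minus (embed H1 f) (embed H1 u)) ^ 2 <=
       plus (scal (4 * B ^ 2) (d / (1 + d))) (scal (1 - 0) (eps ^ 2 / 4)).
    { apply: LE => x Hx; have Ix : I01 x by split; lra.
      have Ex : a x = (RtoC x * (p (x * x)%R, q (x * x)%R))%C.
      { have Hx0 : RtoC x <> RtoC 0 by move/RtoC_inj; lra.
        have E := Ea x; rewrite Du // in E.
        have -> : a x = (RtoC x * a x * / RtoC x)%C by field.
        rewrite -E; have -> : RtoC (x ^ (2 * 1)) = (RtoC x * RtoC x)%C.
        { rewrite -RtoC_mult; congr RtoC; rewrite /=; ring. }
        by field. }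
      have Ix2 : 0 <= x * x <= 1 by nra.
      have B1 := Ap _ Ix2; have B2 := Aq _ Ix2.
      have Hx0 : 0 <= x by lra.
      rewrite (sqrt_square x Hx0) (clamp_id 0 1 x Ix) in B1 B2.
      have V1 := Bv fst x Cf Ix; have V2 := Bv snd x Cs Ix.
      rewrite Cmod_sq Ex /=.
      (* For one component: t - x r is t d/(x + d) plus x times the approximation error, followed by
         (a + b)^2 <= 2 a^2 + 2 b^2. *)
      have main t r : Rabs (t * / (x + d) - r) < eps / 4 -> Rabs t <= B ->
        (t - x * r) ^ 2 <= 2 * B ^ 2 * (d / (x + d)) ^ 2 + eps ^ 2 / 8.
      { move=> K1 K2.
        have -> : t - x * r = t * (d / (x + d)) + x * (t * / (x + d) - r) by field; lra.
        set k := d / (x + d); set y := t * / (x + d) - r in K1 *.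
        have Hy2 : y ^ 2 <= (eps / 4) ^ 2.
        { apply: sq_le_of_Rabs_le; lra. }
        have Ht2 : t ^ 2 <= B ^ 2.
        { exact: sq_le_of_Rabs_le. }
        have Hk2 := pow2_ge_0 k; have Hy0 := pow2_ge_0 y.
        have S1 : (t * k) ^ 2 <= B ^ 2 * k ^ 2 by rewrite Rpow_mult_distr; nra.
        have S2 : (x * y) ^ 2 <= (eps / 4) ^ 2.
        { rewrite Rpow_mult_distr; have : x ^ 2 <= 1 by nra.
          have := pow2_ge_0 x; nra. }
        have := pow2_ge_0 (t * k - x * y); nra. }
      have M1 := main _ _ B1 V1; have M2 := main _ _ B2 V2.
      rewrite /plus /scal /= /mult /=.
      move: M1 M2; rewrite /=; lra. }
    rewrite /plus /scal /= /mult /= in LE.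
    have Hd1 : d / (1 + d) <= d.
    { apply: (Rmult_le_reg_r (1 + d)); first lra.
      have -> : d / (1 + d) * (1 + d) = d by field; lra.
      nra. }
    have Ed : 8 * (B ^ 2 + 1) * d = eps ^ 2 by rewrite /d; field; lra.
    have E2 : 4 * B ^ 2 * (d / (1 + d)) <= eps ^ 2 / 2.
    { have : 0 <= 4 * B ^ 2 by have := pow2_ge_0 B; lra.
      nra. }
    have := norm_ge_0 (minus (embed H1 f) (embed H1 u)).
    have He3 : 0 < eps ^ 2 by apply: pow_lt.
    rewrite /= in E2 He3; nra.
Qed.

End Density.

(** * Generation *)

Section Generation.
Context (H1 : Completion Ht1 ip1) (H2 : Completion Ht2 ip2).
Local Notation L0 := (graph_closure (Lt_graph H1 H2)).

Definition mono1 m : Hsp H1 H2 := (embed H1 (mono m), zero).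
Definition mono2 m : Hsp H1 H2 := (zero, embed H2 (mono m)).

Lemma pair_plus (x x' : H1) (y y' : H2) :
  plus ((x, y) : Hsp H1 H2) (x', y') = (plus x x', plus y y').
Proof. by []. Qed.

Lemma pair_scal (a : C) (x : H1) (y : H2) :
  scal a ((x, y) : Hsp H1 H2) = (scal a x, scal a y).
Proof. by []. Qed.

Lemma Hsp_dense (M : Hsp H1 H2 -> Prop) :
  (forall x y, M x -> M y -> M (plus x y)) -> (forall (a : C) x, M x -> M (scal a x)) ->
  (forall j, M (mono1 (S (2 * (j + 1))))) -> (forall j, M (mono2 (S (2 * j)))) ->
  forall x eps, 0 < eps -> exists y, M y /\ norm (minus x y) < eps.
Proof.
  move=> Mplus Mscal M1 M2 [x1 x2] eps He.
  have [||||y1 [My1 D1]] := odd_monomials_dense1 H1 (fun h => M (h, zero)) _ _ _ x1 (eps / 2).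
  - move=> x y Hx Hy; have := Mplus _ _ Hx Hy.
    by rewrite pair_plus plus_zero_l.
  - move=> a x Hx; have := Mscal a _ Hx.
    by rewrite pair_scal (scal_zero_r a).
  - exact: M1.
  - lra.
  - have [||||y2 [My2 D2]] := odd_monomials_dense2 H2 (fun h => M (zero, h)) _ _ _ x2 (eps / 2).
    + move=> x y Hx Hy; have := Mplus _ _ Hx Hy.
      by rewrite pair_plus plus_zero_l.
    + move=> a x Hx; have := Mscal a _ Hx.
      by rewrite pair_scal (scal_zero_r a).
    + exact: M2.
    + lra.
    + exists (y1, y2); split.
      * have := Mplus _ _ My1 My2.
        by rewrite pair_plus plus_zero_l plus_zero_r.
      * apply: Rle_lt_trans (norm_pair_le (minus ((x1, x2) : Hsp H1 H2) (y1, y2))) _.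
        apply: Rlt_le_trans (Rplus_lt_compat _ _ _ _ D1 D2) _; lra.
Qed.

(** Additivity and homogeneity of [embed] are given on functions of the class, so the zero function
    is reached as 0 times a monomial. *)
Lemma embed1_zero : embed H1 (fun _ => RtoC 0) = zero.
Proof.
  have H := Ht1_mono 0.
  rewrite -(embed1_ext H1 (fun r => (RtoC 0 * mono 2 r)%C)).
  - rewrite (embed_scal _ _ H1 _ _ H); vring.
  - exact: Ht1_scal.
  - split; [exact: Ck01_const|split=> //].
    apply: D01_eq; [split; lra|exact: is_deriv01_const].
  - by move=> x _; ring.
Qed.

Lemma embed2_zero : embed H2 (fun _ => RtoC 0) = zero.
Proof.
  have H := Ht2_mono 0.
  rewrite -(embed2_ext H2 (fun r => (RtoC 0 * mono 1 r)%C)).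
  - rewrite (embed_scal _ _ H2 _ _ H); vring.
  - exact: Ht2_scal.
  - by split; [exact: Ck01_const|].
  - by move=> x _; ring.
Qed.

Lemma D01_zero x : I01 x -> D01 (fun _ => RtoC 0) x = RtoC 0.
Proof. by move=> Ix; apply: D01_eq => //; apply: is_deriv01_const. Qed.

Lemma domLt_1_zero : domLt_1 (fun _ => RtoC 0).
Proof.
  have I0 : I01 0 by split; lra.
  apply: domLt_1_intro; [|exact: Ck01_const|].
  - split; [exact: Ck01_const|split=> //; exact: D01_zero].
  - rewrite -(D01_ext (fun _ => RtoC 0)) ?D01_zero //.
    + by move=> y Iy; rewrite D01_zero.
    + by exists (RtoC 0); apply: is_deriv01_const.
Qed.

Lemma domLt_2_zero : domLt_2 (fun _ => RtoC 0).
Proof. by split; [exact: Ck01_const|]. Qed.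

Lemma domLt_1_mono m : domLt_1 (mono (S (S (S m)))).
Proof.
  have I0 : I01 0 by split; lra.
  apply: domLt_1_intro; [exact: Ht1_mono|exact: Ck01_mono|].
  set k := S (S m).
  rewrite -(D01_ext (fun r => (RtoC (INR (S k)) * mono k r)%C)) //.
  - rewrite (D01_scal 0) //; last exact: Ck01_mono.
    by rewrite D01_mono // /k /= Rmult_0_l !Rmult_0_r; ring.
  - move=> y Iy; rewrite D01_mono // -RtoC_mult; by congr RtoC.
  - exists (RtoC (INR (S k)) * RtoC (INR k * 0 ^ pred k))%C.
    apply: is_deriv01_scal; exact: mono_deriv.
Qed.

Lemma domLt_2_mono m : domLt_2 (mono (S m)).
Proof. split; [exact: Ck01_mono|by rewrite /mono /= Rmult_0_l]. Qed.

(** Powers start at 3, because rho^2 violates the condition on the second derivative at 0. *)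
Lemma Lt_mono1 m : Lt_graph H1 H2 (mono1 (S (S (S m))))
  (minus (scal (RtoC (INR (S (S (S m))))) (mono2 (S m)))
         (scal (RtoC (INR (S (S m)))) (mono1 (S (S (S m)))))).
Proof.
  set n := S (S m).
  have [L1 [L2 _]] := Lt_structure _ _ (domLt_1_mono m) domLt_2_zero.
  exists (mono (S n)), (fun _ => RtoC 0); split; [exact: domLt_1_mono|split; first exact: domLt_2_zero].
  split; first by rewrite embed2_zero.
  have HT1 := Ht1_mono (S m); have HT2 := Ht2_mono m.
  rewrite -(embed1_ext H1 (fun r => (RtoC (- INR n) * mono (S n) r)%C)) //; last first.
  { move=> x Ix; rewrite /Lt_1 D01_zero // D01_mono // /mono S_INR -[x ^ S n]/(x * x ^ n).
    rewrite -[pred (S n)]/n; move: (INR n) (x ^ n) => t p.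
    by apply: injective_projections => /=; ring. }
  { exact: Ht1_scal. }
  rewrite -(embed2_ext H2 (fun r => (RtoC (INR (S n)) * mono (S m) r)%C)) //; last first.
  { move=> x Ix; rewrite /Lt_2 D01_zero // D01_mono // /mono -[pred (S n)]/n.
    rewrite -[x ^ S m]/(x * x ^ m) -[x ^ n]/(x * (x * x ^ m)).
    move: (INR (S n)) (x ^ m) => s p.
    case: (Req_dec x 0) => [->|Hx].
    - by apply: injective_projections => /=; ring.
    - by apply: injective_projections => /=; field. }
  { exact: Ht2_scal. }
  rewrite (embed_scal _ _ H1 _ _ HT1) (embed_scal _ _ H2 _ _ HT2).
  apply: injective_projections.
  - change (minus (scal (RtoC (INR (S n))) zero) (scal (RtoC (INR n)) (embed H1 (mono (S n)))) =
      scal (RtoC (- INR n)) (embed H1 (mono (S n)))).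
    move: (INR (S n)) (INR n) => s t; vring.
  - change (minus (scal (RtoC (INR (S n))) (embed H2 (mono (S m)))) (scal (RtoC (INR n)) zero) =
      scal (RtoC (INR (S n))) (embed H2 (mono (S m)))).
    move: (INR (S n)) (INR n) => s t; vring.
Qed.

Lemma Lt_mono2 m : Lt_graph H1 H2 (mono2 (S (S m)))
  (minus (scal (RtoC (INR (S m))) (mono1 (S (S m))))
         (scal (RtoC (INR (S (S m)))) (mono2 (S (S m))))).
Proof.
  set n := S m.
  have [L1 [L2 _]] := Lt_structure _ _ domLt_1_zero (domLt_2_mono n).
  exists (fun _ => RtoC 0), (mono (S n)); split; [exact: domLt_1_zero|split; first exact: domLt_2_mono].
  split; first by rewrite embed1_zero.
  have HT1 := Ht1_mono m; have HT2 := Ht2_mono n.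
  rewrite -(embed1_ext H1 (fun r => (RtoC (INR n) * mono (S n) r)%C)) //; last first.
  { move=> x Ix; rewrite /Lt_1 D01_zero // D01_mono // /mono S_INR -[x ^ S n]/(x * x ^ n).
    rewrite -[pred (S n)]/n; move: (INR n) (x ^ n) => t p.
    by apply: injective_projections => /=; ring. }
  { exact: Ht1_scal. }
  rewrite -(embed2_ext H2 (fun r => (RtoC (- INR (S n)) * mono (S n) r)%C)) //; last first.
  { move=> x Ix; rewrite /Lt_2 D01_zero // D01_mono // /mono -[x ^ S n]/(x * x ^ n).
    rewrite -[pred (S n)]/n; move: (INR (S n)) (x ^ n) => s p.
    by apply: injective_projections => /=; ring. }
  { exact: Ht2_scal. }
  rewrite (embed_scal _ _ H1 _ _ HT1) (embed_scal _ _ H2 _ _ HT2).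
  apply: injective_projections.
  - change (minus (scal (RtoC (INR n)) (embed H1 (mono (S n)))) (scal (RtoC (INR (S n))) zero) =
      scal (RtoC (INR n)) (embed H1 (mono (S n)))).
    move: (INR (S n)) (INR n) => s t; vring.
  - change (minus (scal (RtoC (INR n)) zero) (scal (RtoC (INR (S n))) (embed H2 (mono (S n)))) =
      scal (RtoC (- INR (S n))) (embed H2 (mono (S n)))).
    move: (INR (S n)) (INR n) => s t; vring.
Qed.

(** The bottom of the triangular scheme. It is separate from [Lt_mono2] because rho is not in [Ht1],
    so that [mono1 1] would be meaningless even with coefficient 0. *)
Lemma Lt_mono2_1 : Lt_graph H1 H2 (mono2 1) (scal (RtoC (-1)) (mono2 1)).
Proof.
  have [L1 [L2 _]] := Lt_structure _ _ domLt_1_zero (domLt_2_mono 0).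
  have HT2 := Ht2_mono 0.
  exists (fun _ => RtoC 0), (mono 1); split; [exact: domLt_1_zero|split; first exact: domLt_2_mono].
  split; first by rewrite embed1_zero.
  rewrite -(embed1_ext H1 (fun r => RtoC 0)) //; last first.
  { move=> x Ix; rewrite /Lt_1 D01_zero // D01_mono // /mono.
    by apply: injective_projections => /=; ring. }
  { by apply: domLt_1_Ht1; apply: domLt_1_zero. }
  rewrite -(embed2_ext H2 (fun r => (RtoC (-1) * mono 1 r)%C)) //; last first.
  { move=> x Ix; rewrite /Lt_2 D01_zero // D01_mono // /mono.
    by apply: injective_projections => /=; ring. }
  { exact: Ht2_scal. }
  rewrite (embed_scal _ _ H2 _ _ HT2) embed1_zero; congr pair.
  change (scal (RtoC (-1)) (zero : H1) = zero); vring.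
Qed.

Lemma scal_cancel (M : Hsp H1 H2 -> Prop) (c : R) x :
  (forall (a : C) x, M x -> M (scal a x)) -> 0 < c -> M (scal (RtoC c) x) -> M x.
Proof.
  move=> Mscal Hc Hx; have := Mscal (RtoC (/ c)) _ Hx.
  by have -> : scal (RtoC (/ c)) (scal (RtoC c) x) = x by vring.
Qed.

Lemma L0_m_dissipative : m_dissipative (- (1 / 2)) L0.
Proof.
  have Tlin := Lt_linear_graph H1 H2; have Tdiss := Lt_dissipative H1 H2.
  have Llin := linear_graph_closure _ Tlin.
  split=> //; first exact: dissipative_closure.
  - move=> l f Hl.
    (* The range of l - L0, a linear set to which the density of odd monomials is applied. *)
    pose M g := exists x y, L0 x y /\ minus (scal (RtoC l) x) y = g.
    have Mplus g g' : M g -> M g' -> M (plus g g').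
    { move=> [x [y [Hxy <-]]] [x' [y' [Hxy' <-]]].
      exists (plus x x'), (plus y y'); split; [exact: (graph_add _ Llin)|vring]. }
    have Mscal (a : C) g : M g -> M (scal a g).
    { move=> [x [y [Hxy <-]]]; exists (scal a x), (scal a y); split; [exact: (graph_scal _ Llin)|vring]. }
    have Mgraph x y : Lt_graph H1 H2 x y -> M (minus (scal (RtoC l) x) y).
    { by move=> H; exists x, y; split=> //; apply: graph_closure_incl. }
    (* (l - L)(rho^n, 0) = (l + n - 1)(rho^n, 0) - n (0, rho^(n-2)) with n = 2j + 3, and l + n - 1 >
       0. *)
    have step1 j : M (mono2 (S (2 * j))) -> M (mono1 (S (2 * (j + 1)))).
    { have -> : (2 * (j + 1) = S (S (2 * j)))%nat by lia.
      move: (2 * j)%nat => m Hm.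
      have Hp := pos_INR m.
      apply: (scal_cancel M (l + INR (S (S m)))) => //; first by rewrite !S_INR; lra.
      have := Mplus _ _ (Mgraph _ _ (Lt_mono1 m)) (Mscal (RtoC (INR (S (S (S m))))) _ Hm).
      move: (INR (S (S (S m)))) (INR (S (S m))) => s t.
      set u := plus _ _; suff -> : u = scal (RtoC (l + t)) (mono1 (S (S (S m)))) by [].
      rewrite /u; vring. }
    (* (l - L)(0, rho^n) = (l + n)(0, rho^n) - (n - 1)(rho^n, 0) with n = 2j + 3, and l + n > 0. *)
    have step2 j : M (mono1 (S (2 * (j + 1)))) -> M (mono2 (S (2 * (j + 1)))).
    { have -> : (2 * (j + 1) = S (S (2 * j)))%nat by lia.
      move: (2 * j)%nat => m Hm.
      have Hp := pos_INR m.
      apply: (scal_cancel M (l + INR (S (S (S m))))) => //; first by rewrite !S_INR; lra.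
      have := Mplus _ _ (Mgraph _ _ (Lt_mono2 (S m))) (Mscal (RtoC (INR (S (S m)))) _ Hm).
      move: (INR (S (S (S m)))) (INR (S (S m))) => s t.
      set u := plus _ _; suff -> : u = scal (RtoC (l + s)) (mono2 (S (S (S m)))) by [].
      rewrite /u; vring. }
    have M2 j : M (mono2 (S (2 * j))).
    { elim: j => [|j IH].
      - apply: (scal_cancel M (l + 1)) => //; first lra.
        have := Mgraph _ _ Lt_mono2_1.
        set u := minus _ _; suff -> : u = scal (RtoC (l + 1)) (mono2 1) by [].
        rewrite /u; vring.
      - have -> : (S j = j + 1)%nat by lia.
        by apply: step2; apply: step1. }
    have M1 j : M (mono1 (S (2 * (j + 1)))) by apply: step1.
    have [u [Hu Mu]] := tends_choice M f (Hsp_dense M Mplus Mscal M1 M2 f).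
    apply: (range_closure _ _ _ _ Tlin Tdiss Hl u f Hu Mu).
    by apply: cauchy_complete_prod; apply: complete_normed_cauchy.
  (* The same density criterion, now for the domain, which contains the odd monomials outright. *)
  - apply: (Hsp_dense (dom L0)).
    + by move=> x x' [y H] [y' H']; exists (plus y y'); apply: (graph_add _ Llin).
    + by move=> a x [y H]; exists (scal a y); apply: (graph_scal _ Llin).
    + move=> j; have -> : (2 * (j + 1) = S (S (2 * j)))%nat by lia.
      eexists; apply: graph_closure_incl; exact: Lt_mono1.
    + case=> [|j]; first by eexists; apply: graph_closure_incl; exact: Lt_mono2_1.
      have -> : (2 * S j = S (S (2 * j)))%nat by lia.
      eexists; apply: graph_closure_incl; exact: Lt_mono2.
Qed.

End Generation.

Theorem corollary4p10
  (H1 : Completion Ht1 ip1) (H2 : Completion Ht2 ip2)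
  (L' : Hsp H1 H2 -> Hsp H1 H2) (HL' : is_Lprime H1 H2 L') :
  let L0 := graph_closure (Lt_graph H1 H2) in
  exists S : R -> Hsp H1 H2 -> Hsp H1 H2,
    C0_semigroup S /\
    generates (graph_plus L0 L') S /\
    (forall tau, 0 <= tau ->
       op_norm (S tau) <= exp ((- (1 / 2) + op_norm L') * tau)) /\
    (forall (T : R) (uT : Hsp H1 H2), 0 < T -> dom L0 uT ->
       classical_solution (graph_plus L0 L') (- ln T) uT
         (fun tau => S (tau + ln T) uT) /\
       forall Phi : R -> Hsp H1 H2,
         classical_solution (graph_plus L0 L') (- ln T) uT Phi ->
         forall tau, - ln T <= tau -> Phi tau = S (tau + ln T) uT).
Proof.
  move=> L0; have Llin := proj1 HL'.
  have HX : cauchy_complete (Hsp H1 H2).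
  { by apply: cauchy_complete_prod; apply: complete_normed_cauchy. }
  have HB := m_dissipative_perturb HX _ _ _ _ (L0_m_dissipative H1 H2) Llin
    (op_norm_ge_0 _ Llin) (fun x => op_norm_le _ x Llin).
  set w := _ + op_norm L' in HB *.
  have [S [HS [HG Sle]]] := hille_yosida w _ HX HB.
  exists S; split=> //; split=> //; split.
  - move=> t Ht; have Hp := exp_pos (w * t).
    have [[_ H] _] := op_norm_bounds (S t) (exp (w * t)) (Rlt_le _ _ Hp) (fun x => Sle t x Ht).
    exact: H.
  - move=> T uT HT [y Hy].
    (* L' is defined everywhere, so a point of the domain of L0 is one of the domain of L0 + L'. *)
    split; first by apply: (semigroup_classical S _ w) => //; exists (plus y (L' uT)), y.
    move=> Phi HPhi tau Htau.
    rewrite (classical_unique S _ w HS HG Sle _ _ _ HPhi tau Htau).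
    congr (S _ uT); ring.
Qed.
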